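(* For $\lambda\in\mathbb Z_+^n$ we have $$\mathrm{ch}\,L(\Lambda(\lambda))=\det\left(\mathrm{ch}\,L(\Lambda(\lambda_i-i+j))\right)_{1\le i,j\le n},$$ where $L(\Lambda(\lambda))$ is the irreducible highest weight $\widehat{\mathfrak{gl}}_{\infty|\infty}$-module associated with $\lambda$, and in the determinant each integer $\lambda_i-i+j$ is regarded as an element of $\mathbb Z_+^1=\mathbb Z$ (generalized partition of level $1$).
   Context: $\frac12\mathbb Z=\{k/2:k\in\mathbb Z\}$. Index the basis of a superspace by $\frac12\mathbb Z$, with basis vectors indexed by $\mathbb Z$ even and by $\frac12+\mathbb Z$ odd. $\mathfrak{gl}_{\infty|\infty}$ is the Lie superalgebra (supercommutator) of complex matrices $(a_{ij})_{i,j\in\frac12\mathbb Z}$ with $a_{ij}=0$ for $|i-j|\gg0$; $e_{ij}$ are elementary matrices. $\widehat{\mathfrak{gl}}_{\infty|\infty}=\mathfrak{gl}_{\infty|\infty}\oplus\mathbb CK$ is the central extension by the two-cocycle $\alpha(A,B)=\mathrm{str}([J,A]B)$, $J=\sum_{r\le0}e_{rr}$, $\mathrm{str}(a_{ij})=\sum_i(-1)^{2i}a_{ii}$. It has a triangular decomposition $\mathfrak n_+\oplus\mathfrak h\oplus\mathfrak n_-$, with $\mathfrak h$ spanned by diagonal matrices and $K$, and $\mathfrak n_+$ (resp. $\mathfrak n_-$) the strictly upper (resp. lower) triangular matrices. $L(\Lambda)$ is the irreducible highest weight module with highest weight $\Lambda\in\mathfrak h^*$. $\mathbb Z_+^n=\{\lambda\in\mathbb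 Z^n:\lambda_1\ge\dots\ge\lambda_n\}$. Draw $\lambda\in\mathbb Z^n_+$ as a generalized Young diagram: fix a vertical line and put in row $k$ $|\lambda_k|$ boxes, immediately right of the line if $\lambda_k\ge0$, immediately left if $\lambda_k\le0$; columns to the right are indexed $1,2,\dots$ outward, to the left $-1,-2,\dots$ outward; $\lambda'_i$ is the number of boxes in column $i$, $i\in\mathbb Z\setminus\{0\}$. $\Lambda(\lambda)\in\mathfrak h^*$ is determined by $\Lambda(\lambda)(K)=n$ and $\Lambda(\lambda)(e_{kk})=\max\{\lambda'_k-k,0\}$ for $k\in\mathbb Z_{>0}$; $=-\max\{\lambda'_{k-1}+k,0\}$ for $k\in\mathbb Z_{\le0}$; $=\max\{\lambda_{k+\frac12}-k+\frac12,0\}$ for $k\in\frac12+\mathbb Z_{\ge0}$; $=-\max\{-\lambda_{n+k+\frac12}+k-\frac12,0\}$ for $k\in-\frac12-\mathbb Z_{\ge0}$ (with $\lambda_j=0$ for $j\notin\{1,\dots,n\}$); only finitely many values are nonzero and $\Lambda(\lambda)$ of a diagonal matrix is the corresponding finite sum. The character $\mathrm{ch}$ is taken with respect to the action of $\bigoplus_{k\in\frac12\mathbb Z}\mathbb Ce_{kk}$ (so the eigenvalue of $K$ is not recorded), as a formal series in $x_k=e^{\omega_k}$ ($k>0$) and $x_k^{-1}$ ($k\le 0$), where $\omega_k(e_{ll})=\delta_{kl}$, $\omega_k(K)=0$. *)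

(* Defs.v *)
From HB Require Import structures.
From mathcomp Require Import all_boot all_order all_algebra.
From mathcomp Require Import finmap multiset complex.
From mathcomp Require Import all_classical all_reals.

Set Implicit Arguments.
Unset Strict Implicit.
Unset Printing Implicit Defensive.

Import Order.TTheory GRing.Theory Num.Theory.
Local Open Scope classical_set_scope.
Local Open Scope ring_scope.

(* Throughout, an index k in (1/2)Z is represented by the integer r = 2k:     *)
(* even r are the elements of Z (even basis vectors), odd r those of 1/2 + Z  *)
(* (odd basis vectors).                                                       *)

Definition oddz (r : int) : bool := odd `|r|%N.

Section SuperGl.
Variable F : fieldType.

Definition banded (A : int -> int -> F^o) : Prop :=
  exists N : nat, forall i j : int, (N < `|i - j|)%N -> A i j = 0.

Definition glset : {pred int -> int -> F^o} := fun A => `[< banded A >].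

Fact glset_submod_closed : submod_closed glset.
Proof.
split; first by apply/asboolP; exists 0%N.
move=> a A B /asboolP[N hA] /asboolP[M hB]; apply/asboolP.
exists (maxn N M) => i j; rewrite gtn_max => /andP[hN hM].
rewrite -[LHS]/(a *: A i j + B i j).
by rewrite (hA i j hN) (hB i j hM) scaler0 addr0.
Qed.

HB.instance Definition _ :=
  GRing.isSubmodClosed.Build F (int -> int -> F^o) glset glset_submod_closed.

Definition gl := {A : int -> int -> F^o | glset A}.
HB.instance Definition _ := SubType.on gl.
HB.instance Definition _ := Choice.on gl.
HB.instance Definition _ := [SubChoice_isSubLmodule of gl by <:].

Definition glmk (A : int -> int -> F^o) (hA : banded A) : gl :=
  exist _ A (asboolT hA).

Definition entry (A : gl) : int -> int -> F := val A.

Lemma entry_banded (A : gl) : banded (entry A).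
Proof. by case: A => A hA; apply/asboolP. Qed.

Fact glmul_banded (A B : gl) :
  banded (fun i j => \sum_(k \in [set: int]) entry A i k * entry B k j).
Proof.
have [N hN] := entry_banded A; have [M hM] := entry_banded B.
exists (N + M)%N => i j hij; apply: fsbig1 => k _.
have [h|h] := ltnP N `|i - k|%N; first by rewrite (hN _ _ h) mul0r.
have [h'|h'] := ltnP M `|k - j|%N; first by rewrite (hM _ _ h') mulr0.
have := leq_ltn_trans (leq_add h h') hij; rewrite ltnNge => /negP[].
have -> : i - j = (i - k) + (k - j) by rewrite addrA subrK.
by rewrite -lez_nat PoszD !abszE ler_normD.
Qed.

(* Each of these sums has only finitely many nonzero terms. *)
Definition glmul (A B : gl) : gl := glmk (glmul_banded A B).

Fact glunit_banded (r s : int) :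
  banded (fun i j => ((i == r) && (j == s))%:R : F^o).
Proof.
exists `|r - s|%N => i j; case: eqP => [->|]//; case: eqP => [->|]//.
by rewrite ltnn.
Qed.
Definition glunit (r s : int) : gl := glmk (glunit_banded r s).

Fact glpart_banded (p : bool) (A : gl) :
  banded (fun i j => if oddz (i + j) == p then entry A i j else 0).
Proof.
have [N hN] := entry_banded A; exists N => i j h.
by case: ifP => // _; exact: hN.
Qed.
(* The component of parity p (true = odd) of a matrix. *)
Definition glpart (p : bool) (A : gl) : gl := glmk (glpart_banded p A).

Definition glbracket (A B : gl) : gl :=
  \sum_(p : bool) \sum_(q : bool)
    (glmul (glpart p A) (glpart q B)
     - (-1) ^+ (p && q) *: glmul (glpart q B) (glpart p A)).

Fact glJ_banded : banded (fun i j => ((i == j) && (i <= 0))%:R : F^o).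
Proof. by exists 0%N => i j; case: eqP => [->|]//; rewrite subrr. Qed.
Definition glJ : gl := glmk glJ_banded.

(* Only used on matrices whose diagonal has finite support, as is the case    *)
(* for [J, A] B.                                                              *)
Definition str (A : gl) : F :=
  \sum_(r \in [set: int]) (-1) ^+ oddz r * entry A r r.

Definition cocycle (A B : gl) : F := str (glmul (glbracket glJ A) B).

(* The pair (A, a) stands for A + a K. *)
Definition ghat := (gl * F^o)%type.
HB.instance Definition _ := GRing.Lmodule.on ghat.

Definition hbracket (x y : ghat) : ghat :=
  (glbracket x.1 y.1, cocycle x.1 y.1).

Definition ghom (p : bool) (x : ghat) : Prop :=
  (forall i j, oddz (i + j) != p -> entry x.1 i j = 0) /\ (p -> x.2 = 0).

Definition cartan (x : ghat) : Prop :=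
  forall i j, i != j -> entry x.1 i j = 0.

Definition nplus (x : ghat) : Prop :=
  (forall i j, j <= i -> entry x.1 i j = 0) /\ x.2 = 0.

(* A superspace is a pair of vector spaces (even part, odd part). *)
Definition vhom (V0 V1 : lmodType F) (p : bool) (v : V0 * V1) : Prop :=
  if p then v.1 = 0 else v.2 = 0.

Record smodule := Smodule {
  sm0 : lmodType F;
  sm1 : lmodType F;
  act : ghat -> (sm0 * sm1)%type -> (sm0 * sm1)%type;
  act_linl : forall v, linear (fun x => act x v);
  act_linr : forall x, linear (act x);
  act_parity : forall p q x v,
    ghom p x -> vhom q v -> vhom (p (+) q) (act x v);
  act_bracket : forall p q x y v, ghom p x -> ghom q y ->
    act (hbracket x y) v = act x (act y v) - (-1) ^+ (p && q) *: act y (act x v)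
}.

Definition carrier (M : smodule) : lmodType F := (sm0 M * sm1 M)%type.

(* Graded submodules. *)
Definition submodule (M : smodule) (W : set (carrier M)) : Prop :=
  [/\ W 0,
      forall (a : F) u v, W u -> W v -> W (a *: u + v),
      forall v : carrier M, W v -> W (v.1, 0) /\ W (0, v.2)
    & forall x v, W v -> W (act x v)].

Definition irreducible (M : smodule) : Prop :=
  (exists v : carrier M, v != 0) /\
  forall W : set (carrier M), submodule W -> W = [set 0] \/ W = setT.

(* Only the restriction of Lam to the Cartan subalgebra matters. *)
Definition hw_vector (M : smodule) (Lam : ghat -> F) (v : carrier M) : Prop :=
  [/\ v != 0,
      exists p : bool, vhom p v,
      forall x, nplus x -> act x v = 0
    & forall x, cartan x -> act x v = Lam x *: v].

Definition hw_module (M : smodule) (Lam : ghat -> F) : Prop :=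
  exists v : carrier M, hw_vector Lam v /\
    forall W : set (carrier M), submodule W -> W v -> W = setT.

(* Determines M up to isomorphism and parity shift; this is the               *)
(* characterization of L(Lam).                                                *)
Definition irr_hw_module (M : smodule) (Lam : ghat -> F) : Prop :=
  irreducible M /\ hw_module M Lam.

End SuperGl.

(* Generalized partitions; the row k of the text is the ordinal k - 1.        *)
Definition genpart (n : nat) (lam : 'I_n -> int) : Prop :=
  forall i j : 'I_n, (i <= j)%N -> lam j <= lam i.

Definition row_len (n : nat) (lam : 'I_n -> int) (j : int) : int :=
  \sum_(i < n | i.+1%:Z == j) lam i.

Definition in_diagram (n : nat) (lam : 'I_n -> int) (k : 'I_n) (c : int) :=
  (0 < c <= lam k) || (lam k <= c < 0).

Definition col_len (n : nat) (lam : 'I_n -> int) (c : int) : int :=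
  #|[set k : 'I_n | in_diagram lam k c]|%:Z.

(* Lambda(lam)(e_kk), with r = 2k. *)
Definition hwcoef (n : nat) (lam : 'I_n -> int) (r : int) : int :=
  if ~~ oddz r then
    let k := (r %/ 2)%Z in
    if 0 < k then Num.max (col_len lam k - k) 0
    else - Num.max (col_len lam (k - 1) + k) 0
  else
    let kp := ((r + 1) %/ 2)%Z in (* k + 1/2 *)
    let km := ((r - 1) %/ 2)%Z in (* k - 1/2 *)
    if 0 < r then Num.max (row_len lam kp - km) 0
    else - Num.max (- row_len lam (n%:Z + kp) + km) 0.

Definition Lambda (F : fieldType) (n : nat) (lam : 'I_n -> int)
    (x : ghat F) : F :=
  (\sum_(r \in [set: int]) entry x.1 r r * (hwcoef lam r)%:~R) + x.2 * n%:R.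

(* Formal power series with integer coefficients in the variables x_k (k > 0) *)
(* and x_k^-1 (k <= 0). Monomials are finite multisets m of indices: m r is   *)
(* the exponent of x_k, resp. x_k^-1, where r = 2k.                           *)
Definition monomial := multiset int.
Definition series := monomial -> int.

HB.instance Definition _ := GRing.Zmodule.on series.

Definition series_one : series := fun m => (m == mset0)%:R.

(* m has finitely many factorizations, see finite_submset. *)
Definition series_mul (f g : series) : series := fun m =>
  \sum_(p \in [set p : monomial * monomial | msetD p.1 p.2 = m])
    f p.1 * g p.2.

Fact finite_submset (m : monomial) :
  finite_set [set a : monomial | forall r, (a r <= m r)%N].
Proof.
pose s := enum_mset m.
have fT : finite_set [set: (size s).-tuple bool] by exact: finite_finset.
apply: sub_finite_set
  (finite_image (fun b : (size s).-tuple bool => seq_mset (mask b s)) fT).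
move=> a /= ha.
have /count_subseqP[t /subseqP[b sb ->] pt] :
    forall r, (count_mem r (enum_mset a) <= count_mem r s)%N.
  by move=> r; rewrite !count_mem_mset; exact: ha.
exists (Tuple (introT eqP sb)) => //=; apply/msetP => r.
by rewrite mset_seqE -(permP pt) count_mem_mset.
Qed.

Fact series_mulE (m : monomial) (S : seq monomial) (f g : series) :
  uniq S -> (forall a : monomial, (forall r, (a r <= m r)%N) -> a \in S) ->
  series_mul f g m =
  \sum_(a <- S) \sum_(b <- S) (if msetD a b == m then f a * g b else 0).
Proof.
move=> uS hS; rewrite /series_mul.
rewrite (fsbigE [seq p <- [seq (a, b) | a <- S, b <- S]
                | msetD p.1 p.2 == m]).
- rewrite big_filter_cond big_mkcond big_allpairs.
  apply: eq_bigr => a _; apply: eq_bigr => b _ /=.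
  by case: eqP => [e|//]; rewrite mem_set.
- by rewrite filter_uniq// allpairs_uniq// => -[? ?] [? ?].
- by move=> p /=; rewrite mem_filter => /andP[/eqP].
- move=> [a b] /= hab; rewrite mem_filter /= hab eqxx/= => /negP[].
  by apply/allpairsP; exists (a, b); split=> //=; apply: hS => r;
    rewrite -hab msetE2 ?leq_addr ?leq_addl.
Qed.

Fact submsets_ex (m : monomial) :
  exists2 S : seq monomial, uniq S &
    forall a, (a \in S) <-> (forall r, (a r <= m r)%N).
Proof.
exists (fset_set [set a : monomial | forall r, (a r <= m r)%N]);
  first exact: fset_uniq.
move=> a; rewrite in_fset_set; [by rewrite inE | exact: finite_submset].
Qed.

Fact sum_pick (S : seq monomial) (e m : monomial) (P : monomial -> bool)
  (x : int) : uniq S -> (P e -> e \in S) ->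
  \sum_(d <- S) (if P d && (e == d) then x else 0) = if P e then x else 0.
Proof.
move=> uS hS; case: ifPn => Pe.
  rewrite (bigD1_seq e) ?hS//= Pe eqxx/= big1 ?addr0// => d de.
  by rewrite eq_sym (negPf de) andbF.
by rewrite big1// => d _; case: eqP => [<-|]; rewrite ?andbF// (negPf Pe).
Qed.

Fact series_mulC : commutative series_mul.
Proof.
move=> f g; apply/funext => m; have [S uS hS] := submsets_ex m.
rewrite !(@series_mulE m S)//; [|by move=> a /hS..].
rewrite exchange_big/=; apply: eq_bigr => a _; apply: eq_bigr => b _.
by rewrite msetDC mulrC.
Qed.

Fact series_mulA : associative series_mul.
Proof.
move=> f g h.
have key (u v w : series) (m : monomial) (S : seq monomial) : uniq S ->
    (forall a, (a \in S) <-> (forall r, (a r <= m r)%N)) ->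
    series_mul u (series_mul v w) m = \sum_(a <- S) \sum_(b <- S)
      \sum_(c <- S) (if msetD a (msetD b c) == m then u a * (v b * w c) else 0).
  move=> uS hS; rewrite (@series_mulE m S)//; last by move=> a /hS.
  apply: eq_bigr => a _.
  transitivity (\sum_(d <- S) \sum_(b <- S) \sum_(c <- S)
     if (msetD a d == m) && (msetD b c == d) then u a * (v b * w c) else 0).
    apply: eq_bigr => d _; case: ifPn => had /=; last first.
      by rewrite big1// => b _; rewrite big1.
    rewrite (@series_mulE d S)//; last first.
      move=> x hx; apply/hS => r; rewrite -(eqP had) msetE2.
      exact: leq_trans (hx r) (leq_addl _ _).
    rewrite mulr_sumr; apply: eq_bigr => b _.
    rewrite mulr_sumr; apply: eq_bigr => c _.
    by case: ifP => //; rewrite mulr0.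
  rewrite exchange_big/=; apply: eq_bigr => b _.
  rewrite exchange_big/=; apply: eq_bigr => c _.
  apply: (@sum_pick S _ m (fun d => msetD a d == m)) => //.
  by move=> /eqP e; apply/hS => r; rewrite -e (msetE2 a) leq_addl.
apply/funext => m; have [S uS hS] := submsets_ex m.
rewrite [in RHS]series_mulC !(key _ _ _ m S)// [in RHS]exchange_big/=.
apply: eq_bigr => a _; rewrite [in RHS]exchange_big/=.
apply: eq_bigr => b _; apply: eq_bigr => c _.
by rewrite (msetDC c) msetDA [h c * _]mulrC mulrA -msetDA.
Qed.

Fact series_mul1l : left_id series_one series_mul.
Proof.
move=> f; apply/funext => m; have [S uS hS] := submsets_ex m.
have le0 (a : monomial) : (forall r, (mset0 r <= a r)%N).
  by move=> r; rewrite mset0E.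
rewrite (@series_mulE m S)//; last by move=> a /hS.
rewrite (bigD1_seq mset0)/=; [|exact/hS|done].
rewrite [X in _ + X]big1 ?addr0; last first.
  move=> a a0; rewrite big1// => b _; rewrite /series_one (negPf a0) mul0r.
  by case: ifP.
rewrite (bigD1_seq m)/=; [|by apply/hS|done].
rewrite mset0D eqxx /series_one eqxx mul1r big1 ?addr0// => b bm.
by rewrite mset0D (negPf bm).
Qed.

Fact series_mulDl : left_distributive series_mul +%R.
Proof.
move=> f g h; apply/funext => m; have [S uS hS] := submsets_ex m.
rewrite -[RHS]/(series_mul f h m + series_mul g h m).
rewrite !(@series_mulE m S)//; [|by move=> a /hS..].
rewrite -big_split/=; apply: eq_bigr => a _.
rewrite -big_split/=; apply: eq_bigr => b _.
by case: ifP; rewrite ?addr0// -mulrDl.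
Qed.

Fact series_one_neq0 : series_one != 0.
Proof.
by apply/eqP => /(congr1 (fun f : series => f mset0)); rewrite /series_one eqxx.
Qed.

HB.instance Definition _ := GRing.Zmodule_isComNzRing.Build series
  series_mulA series_mulC series_mul1l series_mulDl series_one_neq0.

Section Character.
Variables (F : fieldType) (M : smodule F).

Definition Ekk (r : int) : ghat F := (glunit F r r, 0).

(* The weight space of the monomial m : it is the weight                      *)
(* sum_(k > 0) m_k omega_k - sum_(k <= 0) m_k omega_k.                        *)
Definition weight_space (m : monomial) : set (carrier M) :=
  [set v | forall r : int,
     act (Ekk r) v = (if 0 < r then (m r)%:R else - (m r)%:R) *: v].

Definition has_dim (W : set (carrier M)) (d : nat) : Prop :=
  exists b : 'I_d -> carrier M,
    (forall i, W (b i)) /\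
    forall w, W w -> exists! c : 'rV[F]_d, w = \sum_i c 0 i *: b i.

(* The character is well defined when M is the sum (automatically direct in   *)
(* characteristic 0) of weight spaces of this form, all finite dimensional.   *)
Definition has_ch : Prop :=
  (forall m, exists d, has_dim (weight_space m) d) /\
  (forall v : carrier M, exists s : seq (carrier M),
     v = \sum_(w <- s) w /\
     forall w, w \in s -> exists m, weight_space m w).

Definition ch : series :=
  fun m => (xget 0%N [set d | has_dim (weight_space m) d])%:Z.

End Character.

(* Submission.v *)
Require Import Defs.
From HB Require Import structures.
From mathcomp Require Import all_boot all_order all_algebra perm.
From mathcomp Require Import finmap multiset complex.
From mathcomp Require Import all_classical all_reals.
From mathcomp Require Import zify ring.

Set Implicit Arguments.
Unset Strict Implicit.
Unset Printing Implicit Defensive.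

Import Order.TTheory GRing.Theory Num.Theory.
Local Open Scope ring_scope.

(* The Fock space of n colours of fermions (even indices) and bosons (odd
   indices) carries commuting actions of the superalgebra, of level n, and of
   gl_n (the row operators). Every gl_n-singular vector of weight lam and of
   finite support is carried by the superalgebra to one purely fermionic
   configuration (removing bosons, then raising fermions; positivity of a
   Casimir-type identity shows that nothing else is left), and odd reflections
   turn that configuration into a highest weight vector of weight Lambda(lam).
   By contravariance of the Hermitian form it generates all the singular
   vectors and spans a simple module, which is identified with L(Lambda(lam))
   through the graph generated by the pair of highest weight vectors.

   Thus the weight space of content m in L(Lambda(lam)) has for dimension the
   number of times lam is a highest weight of a finite-dimensional unitary
   gl_n-module with a basis of weight vectors, namely the configurations of
   content m. By the Weyl character formula this is the alternating sum over
   permutations s of the number of configurations with row charges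
   lam_i - i + s(i); these counts are the coefficients of products of
   characters of level 1, whence the determinant. That form of the Weyl
   formula is proved by induction on n, with the Dirac operator
   D = sum_i (E_(i,z) psi_i^+ + E_(z,i) psi_i^-) relating gl_(n+1) and gl_n,
   z being the last index. *)

(** * Highest weight vectors and graphs of isomorphisms *)

(** The superalgebra contains infinite banded matrices, [smodule] carries no topology, and Fock
    space is given operators for the elementary matrices only. The comparison is therefore made over
    elementary matrices, and it has to be shown that they already generate the irreducible module
    and act simply on it. The key is that a lowering band supported far from zero kills the highest
    weight vector: its images would otherwise generate a nonzero proper submodule. Fock vectors are
    arbitrary functions of configurations; finiteness comes from the content, since finitely many
    configurations share a finitely supported one. Bosons go first because the Casimir-type identity
    is one between anticommuting modes: there the quartic terms of the two sums cancel and a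
    nonnegative count remains. Sending every singular vector to the same configuration is what
    proves multiplicity one: two orthogonal submodules cannot both contain that configuration. The
    Weyl formula is used as a multiplicity formula for a module known only through its weight basis,
    and of D only the index enters, the difference between the dimensions of an even and an odd
    space. *)

Section Words.
Variables (F : numFieldType) (V : lmodType F) (E : int -> int -> {linear V -> V}).

Definition par (r s : int) : bool := oddz (r + s).

(** The cocycle at two elementary matrices, times [n] because [K] acts by [n]. *)
Definition central_coef (n : nat) (r s t u : int) : F :=
  ((s == t) && (u == r))%:R * (-1) ^+ oddz r * ((r <= 0)%R%:R - (s <= 0)%R%:R)
  * n%:R.

(** Supercommutation at level [n], asked of elementary matrices only: this is what the module and
    Fock space have in common. *)
Definition gl_rel (n : nat) := forall r s t u x,
  E r s (E t u x) = (-1) ^+ (par r s && par t u) *: E t u (E r s x)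
    + (s == t)%:R *: E r u x
    - ((-1) ^+ (par r s && par t u) * (u == r)%:R) *: E t s x
    + central_coef n r s t u *: x.

Inductive gen (v : V) : V -> Prop :=
| gen_base : gen v v
| gen_lin a x y : gen v x -> gen v y -> gen v (a *: x + y)
| gen_act r s x : gen v x -> gen v (E r s x).

Lemma gen0 v : gen v 0.
Proof. by have := gen_lin (-1) (gen_base v) (gen_base v); rewrite scaleN1r addNr. Qed.

Lemma genZ v a x : gen v x -> gen v (a *: x).
Proof. by move=> h; have := gen_lin a h (gen0 v); rewrite addr0. Qed.

Lemma genD v x y : gen v x -> gen v y -> gen v (x + y).
Proof. by move=> hx hy; have := gen_lin 1 hx hy; rewrite scale1r. Qed.

Lemma genB v x y : gen v x -> gen v y -> gen v (x - y).
Proof. by move=> hx hy; rewrite -scaleN1r addrC; exact: gen_lin. Qed.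

Lemma gen_sum v (I : Type) (r : seq I) (P : pred I) (f : I -> V) :
  (forall i, P i -> gen v (f i)) -> gen v (\sum_(i <- r | P i) f i).
Proof.
by move=> h; apply: big_ind => //; [exact: gen0|exact: genD].
Qed.

Lemma gen_trans u v x : gen u v -> gen v x -> gen u x.
Proof.
by move=> uv; elim=> {x}// [a x y _ hx _ hy|r s x _ hx];
  [exact: gen_lin|exact: gen_act].
Qed.

Definition kron (t r : int) : int := (r == t)%:Z.

(** Words in strictly lowering operators, with factors in any order; [mu] records the displacement
    of the weight from that of [v]. *)
Inductive loword (v : V) : (int -> int) -> V -> Prop :=
| loword0 : loword v (fun=> 0) v
| loword_act t u mu x : u < t -> loword v mu x ->
    loword v (fun r => mu r + kron t r - kron u r) (E t u x).

Inductive lospan (v : V) : V -> Prop :=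
| lospan0 : lospan v 0
| lospan_lin a mu x y : loword v mu x -> lospan v y -> lospan v (a *: x + y).

Lemma lospanZD v a x y : lospan v x -> lospan v y -> lospan v (a *: x + y).
Proof.
move=> hx hy; elim: hx => [|b mu {}x z hx _ IH]; first by rewrite scaler0 add0r.
by rewrite scalerDr scalerA -addrA; exact: lospan_lin hx IH.
Qed.

Lemma lospanZ v a x : lospan v x -> lospan v (a *: x).
Proof. by move=> h; have := lospanZD a h (lospan0 v); rewrite addr0. Qed.

Lemma lospanD v x y : lospan v x -> lospan v y -> lospan v (x + y).
Proof. by move=> h h'; have := lospanZD 1 h h'; rewrite scale1r. Qed.

Lemma lospan_word v mu x : loword v mu x -> lospan v x.
Proof. by move=> h; have := lospan_lin 1 h (lospan0 v); rewrite addr0 scale1r. Qed.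

Lemma lospan_low v t u x : u < t -> lospan v x -> lospan v (E t u x).
Proof.
move=> ut; elim=> {x} [|a mu x y hx _ IH]; first by rewrite linear0; exact: lospan0.
by rewrite linearP; apply: lospan_lin (loword_act ut hx) IH.
Qed.

Definition eigen (wt : int -> F) x := forall r, E r r x = wt r *: x.

Section Highest.
Variables (n : nat) (rel : gl_rel n) (v : V) (Lam : int -> F).
Hypothesis raise0 : forall r s, r < s -> E r s v = 0.
Hypothesis weightv : eigen Lam v.

(** The spanning half of a PBW theorem, by induction on the word: past the first factor, every term
    has an operator acting on a shorter word, and on [v] raising operators vanish and diagonal ones
    are scalars. *)
Lemma word_act mu x r s : loword v mu x -> lospan v (E r s x).
Proof.
move=> h; elim: h r s => {mu x} [|t u mu x ut hx IH] r s.
  have [rs|rs|->] := ltgtP r s.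
  - by rewrite raise0//; exact: lospan0.
  - by apply: lospan_low => //; exact: lospan_word (loword0 v).
  - by rewrite weightv; apply: lospanZ; exact: lospan_word (loword0 v).
rewrite rel; apply: lospanD; [apply: lospanD; [apply: lospanD|]|].
- by apply: lospanZ; apply: lospan_low.
- by apply/lospanZ/IH.
- by rewrite -scaleNr; apply/lospanZ/IH.
- by apply/lospanZ/lospan_word/hx.
Qed.

Lemma gen_lospan x : gen v x -> lospan v x.
Proof.
elim=> {x} [|a x y _ hx _ hy|r s x _].
- exact: lospan_word (loword0 v).
- exact: lospanZD.
elim=> {x} [|a mu x y hx _ IH]; first by rewrite linear0; exact: lospan0.
by rewrite linearP; apply: lospanZD IH; exact: word_act hx.
Qed.

Lemma eigen_act wt r s x : eigen wt x ->
  eigen (fun q => wt q + (kron r q)%:~R - (kron s q)%:~R) (E r s x).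
Proof.
move=> h q; rewrite rel h /kron.
have -> : central_coef n q q r s = 0.
  by rewrite /central_coef; do 2?case: eqVneq => //= ->; rewrite ?subrr !(mulr0, mul0r).
have -> : par q q = false.
  by rewrite /par /oddz -mulr2n -mulr_natr abszM /= oddM andbF.
rewrite expr0 scale1r linearZ/= mul1r scale0r addr0.
rewrite scalerBl scalerDl; congr (_ + _ - _).
  by case: eqVneq => [->|]; rewrite ?scale1r ?scale0r.
by rewrite eq_sym; case: eqVneq => [->|]; rewrite ?scale1r ?scale0r.
Qed.

Lemma loword_eigen mu x : loword v mu x -> eigen (fun q => Lam q + (mu q)%:~R) x.
Proof.
elim=> {mu x} [|t u mu x ut _ IH].
  by move=> q; rewrite addr0; exact: weightv.
move=> q; have -> := eigen_act t u IH q; congr (_ *: _).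
by rewrite rmorphB rmorphD /= !addrA.
Qed.

(** Each factor adds one at [t] and removes one at a smaller [u], so the largest index where the
    displacement is nonzero carries a positive value, which no further factor can cancel. *)
Lemma loword_top mu x : loword v mu x ->
  (x = v /\ mu = fun=> 0) \/ exists2 q, 0 < mu q & forall t, q < t -> mu t = 0.
Proof.
elim=> {mu x} [|t u mu x ut _ IH]; first by left.
right; rewrite /kron; case: IH => [[_ ->]|[q q0 hq]]; last first.
  have [qt|tq] := ltP q t.
    exists t => [|t' tt']; first by rewrite hq// eqxx; lia.
    by rewrite hq; lia.
  by exists q => [|t' tt']; [lia|rewrite hq; lia].
by exists t => [|t' tt']; lia.
Qed.

(* Products of operators E_rr - a: they isolate the component of highest      *)
(* weight without any appeal to an infinite diagonal matrix.                  *)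
Fixpoint sieve (l : seq (int * F)) (x : V) : V :=
  if l is p :: l' then E p.1 p.1 (sieve l' x) - p.2 *: sieve l' x else x.

Definition sieves (l : seq (int * F)) := all (fun p => p.2 != Lam p.1) l.

Fact sieve_is_linear l : linear (sieve l).
Proof.
elim: l => //= p l IH a x y; rewrite IH linearP scalerDr scalerBr !scalerA mulrC.
by rewrite opprD addrACA.
Qed.
HB.instance Definition _ l := GRing.isLinear.Build F V V _ (sieve l) (sieve_is_linear l).

Lemma diag_comm q r x : E q q (E r r x) = E r r (E q q x).
Proof.
rewrite rel.
have -> : central_coef n q q r r = 0.
  by rewrite /central_coef; have [->|_] := eqVneq q r; rewrite ?subrr !(mulr0, mul0r).
have -> : par q q = false by rewrite /par /oddz -mulr2n -mulr_natr abszM /= oddM andbF.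
rewrite scale1r mul1r scale0r addr0 (eq_sym r q).
by have [->|_] := eqVneq q r; rewrite ?eqxx ?scale0r ?subr0 ?addr0 ?addrK.
Qed.

Lemma sieveC l1 l2 x : sieve l1 (sieve l2 x) = sieve l2 (sieve l1 x).
Proof.
have key p l y : sieve l (E p.1 p.1 y - p.2 *: y) =
    E p.1 p.1 (sieve l y) - p.2 *: sieve l y.
  elim: l => //= q l ->; set z := sieve l y.
  rewrite !linearB !linearZ /= diag_comm !scalerA [p.2 * _]mulrC ?opprB.
  by rewrite addrACA.
by elim: l1 => //= p l1 ->; rewrite key.
Qed.

Lemma sieve_v l : sieve l v = (\prod_(p <- l) (Lam p.1 - p.2)) *: v.
Proof.
elim: l => [|p l IH] /=; first by rewrite big_nil scale1r.
by rewrite big_cons IH linearZ /= weightv !scalerA mulrBl scalerBl mulrC.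
Qed.

Lemma sieve_v_neq0 l : sieves l -> \prod_(p <- l) (Lam p.1 - p.2) != 0.
Proof.
move=> /allP h; rewrite prodf_seq_neq0; apply/allP => p /h /=.
by rewrite subr_eq0 eq_sym.
Qed.

Lemma gen_sieve u l x : gen u x -> gen u (sieve l x).
Proof.
by move=> hx; elim: l => //= p l IH; apply: genB; [exact: gen_act|exact: genZ].
Qed.

(** Every nonempty lowering word has, at some [q], an eigenvalue of [E q q] other than [Lam q]; the
    corresponding factor of the sieve kills the word and is invertible on [v]. *)
Lemma gen_top x : gen v x ->
  exists (c : F) (l : seq (int * F)), sieves l /\ sieve l (x - c *: v) = 0.
Proof.
move=> /gen_lospan; elim=> {x} [|a mu x y hx _ [c [l [hl IH]]]].
  by exists 0, [::]; rewrite scale0r subr0.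
have [[-> _]|[q q0 _]] := loword_top hx.
  exists (a + c), l; split=> //.
  by rewrite scalerDl opprD addrACA subrr add0r.
exists c, ((q, Lam q + (mu q)%:~R) :: l); split=> /=.
  rewrite hl andbT -[X in _ != X]addr0 (inj_eq (addrI _)).
  by rewrite intr_eq0 gt_eqF.
have -> : a *: x + y - c *: v = a *: x + (y - c *: v) by rewrite addrA.
have -> : sieve l (a *: x + (y - c *: v)) = a *: sieve l x.
  by rewrite sieve_is_linear IH addr0.
have := sieveC [:: (q, Lam q + (mu q)%:~R)] l (a *: x) => /=; rewrite linearZ /= => ->.
by rewrite linearZ /= (loword_eigen hx) scalerA mulrC -scalerA subrr linear0.
Qed.

End Highest.
End Words.

(** * Graphs inside a direct sum of two modules *)

Section PairAction.
Variables (F : numFieldType) (V W : lmodType F).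
Variables (E : int -> int -> {linear V -> V}) (E' : int -> int -> {linear W -> W}).

Definition pair_act (r s : int) (p : V * W) : V * W := (E r s p.1, E' r s p.2).

Fact pair_act_is_linear r s : linear (pair_act r s).
Proof. by move=> a x y; rewrite /pair_act !linearP. Qed.
HB.instance Definition _ r s :=
  GRing.isLinear.Build F (V * W)%type (V * W)%type _ (pair_act r s)
    (pair_act_is_linear r s).

Lemma gen_pair v w x : gen E v x -> exists y, gen (fun r s => pair_act r s) (v, w) (x, y).
Proof.
elim=> {x} [|a x x' _ [y hy] _ [y' hy']|r s x _ [y hy]].
- by exists w; exact: gen_base.
- by exists (a *: y + y'); exact: (gen_lin a hy hy').
- by exists (E' r s y); exact: (gen_act r s hy).
Qed.

Lemma gen_fst v w p : gen (fun r s => pair_act r s) (v, w) p -> gen E v p.1.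
Proof.
elim=> {p} [|a x y _ hx _ hy|r s x _ hx] /=;
  [exact: gen_base|exact: gen_lin|exact: gen_act].
Qed.

Lemma gen_snd v w p : gen (fun r s => pair_act r s) (v, w) p -> gen E' w p.2.
Proof.
elim=> {p} [|a x y _ hx _ hy|r s x _ hx] /=;
  [exact: gen_base|exact: gen_lin|exact: gen_act].
Qed.

Lemma gen_pair0 v x : gen E v x -> gen (fun r s => pair_act r s) (v, 0) (x, 0).
Proof.
elim=> {x} [|a x x' _ hx _ hx'|r s x _ hx].
- exact: gen_base.
- suff -> : (a *: x + x', 0 : W) = a *: (x, 0) + (x', 0) by exact: gen_lin.
  by congr pair; rewrite /= scaler0 addr0.
- by have := gen_act r s hx; rewrite /= /pair_act /= linear0.
Qed.

Lemma gl_rel_pair n : gl_rel E n -> gl_rel E' n -> gl_rel (fun r s => pair_act r s) n.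
Proof. by move=> h h' r s t u [x y]; rewrite /= /pair_act /= h h'. Qed.

Definition cyclic_simple (v : V) := forall x, gen E v x -> x != 0 -> gen E x v.

Lemma sieve_pair l p : sieve (fun r s => pair_act r s) l p = (sieve E l p.1, sieve E' l p.2).
Proof. by elim: l => [|q l /= ->]; [case: p|]. Qed.

(** If [x] were nonzero, simplicity would bring [(x, 0)] to [(v, 0)]. By [gen_top] this is a
    multiple [c] of [(v, w)] up to a vector killed by a sieve: the second component gives [c = 0],
    and then the first gives [v = 0]. *)
Lemma graph_ker n v w (Lam : int -> F) x :
  gl_rel E n -> gl_rel E' n ->
  (forall r s, r < s -> E r s v = 0) -> (forall r s, r < s -> E' r s w = 0) ->
  eigen E Lam v -> eigen E' Lam w -> v != 0 -> w != 0 -> cyclic_simple v ->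
  gen (fun r s => pair_act r s) (v, w) (x, 0) -> x = 0.
Proof.
move=> rE rE' rv rw wv ww v0 w0 sv hx; apply/eqP; apply: contraT => x0.
have xv := sv x (gen_fst hx) x0.
have h : gen (fun r s => pair_act r s) (v, w) (v, 0).
  exact: gen_trans hx (gen_pair0 xv).
have [] := gen_top (gl_rel_pair rE rE') _ _ h (Lam := Lam).
- by move=> r s rs; rewrite /= /pair_act /= rv// rw.
- by move=> r; rewrite /= /pair_act /= wv ww.
move=> c [l [hl]]; rewrite sieve_pair => -[].
move=> e1; have {}e1 : sieve E l (v - c *: v) = 0 by [].
move=> e2; have {}e2 : sieve E' l (0 - c *: w) = 0 by [].
have p0 := sieve_v_neq0 hl; move: e2 => /eqP.
rewrite sub0r -scaleNr linearZ /= (sieve_v ww) !scaler_eq0 oppr_eq0.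
rewrite (negPf w0) (negPf p0) !orbF => /eqP c0; move: e1 => /eqP.
by rewrite c0 scale0r subr0 (sieve_v wv) scaler_eq0 (negPf p0) (negPf v0).
Qed.

End PairAction.

Lemma gen_swap (F : numFieldType) (V W : lmodType F)
  (E : int -> int -> {linear V -> V}) (E' : int -> int -> {linear W -> W}) v w p :
  gen (fun r s => pair_act E E' r s) (v, w) p ->
  gen (fun r s => pair_act E' E r s) (w, v) (p.2, p.1).
Proof.
elim=> {p} [|a x y _ hx _ hy|r s x _ hx]; first exact: gen_base.
  exact: (gen_lin a hx hy).
exact: (gen_act r s hx).
Qed.

(** * Elementary matrices acting on the irreducible module *)

Lemma oddzD r s : oddz (r + s) = oddz r (+) oddz s.
Proof. rewrite /oddz. lia. Qed.

Lemma oddzN r : oddz (- r) = oddz r.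
Proof. by rewrite /oddz abszN. Qed.

Section HomogeneousMatrices.
Variable F : fieldType.

Lemma fsum_single (T : choiceType) (f : T -> F) (t : T) :
  (forall u, u != t -> f u = 0) -> (\sum_(u \in [set: T]) f u) = f t.
Proof.
move=> h; rewrite -(fsbig_widen [set t]%classic) ?fsbig_set1//.
by move=> u /= [_ /eqP/h].
Qed.

Lemma gl_ext (A B : gl F) : (forall i j, entry A i j = entry B i j) -> A = B.
Proof. by move=> h; apply/val_inj/funext => i; apply/funext => j; exact: h. Qed.

Lemma entryD (A B : gl F) i j : entry (A + B) i j = entry A i j + entry B i j.
Proof. by []. Qed.
Lemma entryN (A : gl F) i j : entry (- A) i j = - entry A i j.
Proof. by []. Qed.
Lemma entryZ a (A : gl F) i j : entry (a *: A) i j = a * entry A i j.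
Proof. by []. Qed.
Lemma entry0 i j : entry (0 : gl F) i j = 0.
Proof. by []. Qed.

Fact diag_banded (k : int) (a : int -> F) :
  banded (fun i j => if i - j == k then a j else 0 : F^o).
Proof. by exists `|k|%N => i j; case: eqP => // ->; rewrite ltnn. Qed.

(* Homogeneous of the superparity of k. *)
Definition shift (k : int) (a : int -> F) : gl F := glmk (diag_banded k a).

Lemma shiftE k a i j : entry (shift k a) i j = if i - j == k then a j else 0.
Proof. by []. Qed.

Lemma glunit_shift r s : glunit F r s = shift (r - s) (fun j => (j == s)%:R).
Proof.
apply: gl_ext => i j; rewrite shiftE.
have -> : entry (glunit F r s) i j = ((i == r) && (j == s))%:R by [].
have [->|js] := eqVneq j s; last by rewrite andbF; case: ifP.
by rewrite andbT (inj_eq (addIr _)); case: ifP.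
Qed.

Lemma glpart_shift p k a :
  glpart p (shift k a) = shift k (fun j => if oddz k == p then a j else 0).
Proof.
apply: gl_ext => i j.
have -> : entry (glpart p (shift k a)) i j =
  if oddz (i + j) == p then entry (shift k a) i j else 0 by [].
rewrite !shiftE; have [<-|_] := eqVneq (i - j) k; last by case: ifP.
by rewrite oddzD (oddzD i) oddzN.
Qed.

Lemma glmul_shift k l a b :
  glmul (shift k a) (shift l b) = shift (k + l) (fun j => a (j + l) * b j).
Proof.
apply: gl_ext => i j.
have -> : entry (glmul (shift k a) (shift l b)) i j =
  \sum_(t \in [set: int]) entry (shift k a) i t * entry (shift l b) t j by [].
rewrite (@fsum_single _ _ (j + l)) => [|u ul].
  rewrite !shiftE; have -> : j + l - j == l by lia.
  have -> : (i - (j + l) == k) = (i - j == k + l) by lia.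
  by case: ifP; rewrite ?mul0r.
by rewrite !shiftE; case: (eqVneq (u - j) l) => [e|_]; [lia|rewrite mulr0].
Qed.

Lemma glbracket_shift k l a b :
  glbracket (shift k a) (shift l b) = shift (k + l)
    (fun j => a (j + l) * b j - (-1) ^+ (oddz k && oddz l) * (b (j + k) * a j)).
Proof.
apply: gl_ext => i j; rewrite /glbracket !big_bool /=.
rewrite !entryD !entryN !entryZ !glpart_shift !glmul_shift !shiftE (addrC l k).
case: ifP => _; last by rewrite !(mulr0, subr0, addr0).
by case: (oddz k); case: (oddz l) => /=; ring.
Qed.

Lemma glJ_shift : glJ F = shift 0 (fun j => (j <= 0)%R%:R).
Proof.
apply: gl_ext => i j; rewrite shiftE.
have -> : entry (glJ F) i j = ((i == j) && (i <= 0)%R)%:R by [].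
by rewrite subr_eq0; have [->|_] := eqVneq i j.
Qed.

Lemma str_shift k a : str (shift k a) =
  if k == 0 then \sum_(r \in [set: int]) (-1) ^+ oddz r * a r else 0.
Proof.
rewrite /str; have [->|k0] := eqVneq k 0.
  by apply: eq_fsbigr => r _; rewrite shiftE subrr eqxx.
apply: fsbig1 => r _; rewrite shiftE subrr.
by rewrite eq_sym (negPf k0) mulr0.
Qed.

Lemma cocycle_shift k l a b : cocycle (shift k a) (shift l b) =
  if k + l == 0 then \sum_(r \in [set: int]) (-1) ^+ oddz r *
    (((r <= 0)%R%:R - (r + l <= 0)%R%:R) * a (r + l) * b r) else 0.
Proof.
rewrite /cocycle glJ_shift glbracket_shift glmul_shift str_shift add0r.
case: eqP => // kl; apply: eq_fsbigr => r _; congr (_ * _); congr (_ * _).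
have -> : r + l + k = r by lia.
by rewrite /= addr0 mul1r [a _ * _]mulrC -mulrBl.
Qed.

Lemma shift_inj_ext k a b : a =1 b -> shift k a = shift k b.
Proof. by move=> e; apply: gl_ext => i j; rewrite !shiftE e. Qed.

Lemma hbracket_glunit r s t u :
  hbracket (glunit F r s, 0) (glunit F t u, 0) =
  ((s == t)%:R *: glunit F r u
     - ((-1) ^+ (par r s && par t u) * (u == r)%:R) *: glunit F t s,
   ((s == t) && (u == r))%:R * (-1) ^+ oddz r *
     ((r <= 0)%R%:R - (s <= 0)%R%:R)).
Proof.
rewrite /hbracket /= !glunit_shift glbracket_shift cocycle_shift.
have pE x y : oddz (x - y) = par x y by rewrite /par !oddzD oddzN.
congr pair.
  apply: gl_ext => i j; rewrite entryD entryN !entryZ !shiftE !pE.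
  have -> : (s == t)%:R * (if i - j == r - u then (j == u)%:R else 0) =
      if i - j == r - s + (t - u) then (j + (t - u) == s)%:R * (j == u)%:R else 0 :> F.
    have [->|_] := eqVneq j u; last by rewrite !(mulr0, if_same).
    have -> : (u + (t - u) == s) = (s == t) by lia.
    have [->|_] := eqVneq s t; last by rewrite !mul0r if_same.
    by rewrite !mul1r; congr (if _ then _ else _); lia.
  have -> : (-1) ^+ (par r s && par t u) * (u == r)%:R * (if i - j == t - s then (j == s)%:R else 0) =
      if i - j == r - s + (t - u) then (-1) ^+ (par r s && par t u) *
        ((j + (r - s) == u)%:R * (j == s)%:R) else 0 :> F.
    have [->|_] := eqVneq j s; last by rewrite !(mulr0, if_same).
    have -> : (s + (r - s) == u) = (u == r) by lia.
    have [->|_] := eqVneq u r; last by rewrite !(mul0r, mulr0) if_same.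
    rewrite !mulr1; have -> : (i - s == t - s) = (i - s == r - s + (t - r)) by lia.
    by case: ifP; rewrite !(mulr1, mulr0, mul1r).
  by case: ifP; rewrite ?subrr.
rewrite (@fsum_single _ _ u) => [|q /negPf->]; last by rewrite !mulr0.
rewrite eqxx mulr1; have -> : u + (t - u) = t by lia.
rewrite (eq_sym t); have [<-{t}|st] := eqVneq s t; last by rewrite /= !(mulr0, mul0r) if_same.
have -> : (r - s + (s - u) == 0) = (u == r) by lia.
by case: eqVneq => [->|_] /=; rewrite ?mul0r// mulr1 mul1r.
Qed.

Lemma ghom_shift p k a : (forall j, oddz k != p -> a j = 0) -> ghom p (shift k a, 0).
Proof.
move=> h; split=> //= i j hp; rewrite shiftE; case: eqP => // e.
by apply: h; rewrite -e oddzD oddzN -oddzD.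
Qed.

Lemma glsum_entry (I : Type) (r : seq I) (A : I -> gl F) i j :
  entry (\sum_(x <- r) A x) i j = \sum_(x <- r) entry (A x) i j.
Proof. by elim/big_rec2: _ => // x y B _ <-; rewrite entryD. Qed.

Definition band (k : int) (A : gl F) : int -> F := fun j => entry A (j + k) j.

Lemma band_decomposition (A : gl F) :
  exists N : nat, A = \sum_(k < N.*2.+1) shift (k%:Z - N%:Z) (band (k%:Z - N%:Z) A).
Proof.
have [N hN] := entry_banded A; exists N; apply: gl_ext => i j.
rewrite glsum_entry; have [ij|ij] := ltnP N `|i - j|.
  rewrite hN// big1// => k _; rewrite shiftE; case: eqP => // e.
  by move: ij; rewrite e; have := ltn_ord k; lia.
have kN : (`|(i - j + N%:Z)%R| < N.*2.+1)%N by lia.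
rewrite (bigD1 (Ordinal kN))//= big1 ?addr0 => [|k /eqP kk].
  rewrite shiftE; have -> : i - j == `|(i - j + N%:Z)%R|%N%:Z - N%:Z by lia.
  by rewrite /band; congr entry; lia.
rewrite shiftE; case: eqP => // e; case: kk; apply: val_inj => /=.
by rewrite e subrK.
Qed.

End HomogeneousMatrices.

(** Elimination for distinct eigenvalues: [T - (c + N)] kills the last term and multiplies each
    other one by a nonzero scalar, so induction applies to the rescaled family. *)
Lemma eigen_separation (F : numFieldType) (V : lmodType F) (S : V -> Prop)
    (T : V -> V) (c : F) (y : nat -> V) (N : nat) :
  linear T -> S 0 -> (forall a u v, S u -> S v -> S (a *: u + v)) ->
  (forall u, S u -> S (T u)) ->
  (forall k, T (y k) = (c + k%:R) *: y k) ->
  S (\sum_(k < N) y k) -> forall k, (k < N)%N -> S (y k).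
Proof.
move=> linT S0 SL ST; have SZ a u : S u -> S (a *: u).
  by move=> Su; rewrite -[_ *: _]addr0; exact: SL.
pose T' : {linear V -> V} := HB.pack T (GRing.isLinear.Build F V V _ T linT).
elim: N y => // N IH y Ty hS.
have hlow k : (k < N)%N -> S (y k).
  move=> kN; have h : S (((k%:R - N%:R)^-1 : F) *: ((k%:R - N%:R) *: y k)).
    apply: SZ; move: k kN; apply: (IH (fun k => (k%:R - N%:R) *: y k)).
      by move=> k; rewrite -[T _]/(T' _) linearZ /= Ty !scalerA mulrC.
    have := SL (- (c + N%:R)) _ _ hS (ST _ hS).
    have -> : T (\sum_(k < N.+1) y k) = \sum_(k < N.+1) (c + k%:R) *: y k.
      by rewrite -[T _]/(T' _) linear_sum; apply: eq_bigr => k _; exact: Ty.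
    congr S; rewrite scaler_sumr -big_split big_ord_recr /= -scalerDl addNr scale0r addr0.
    by apply: eq_bigr => k _; rewrite -scalerDl; congr (_ *: _); ring.
  rewrite scalerA mulVf ?scale1r// in h.
  by rewrite subr_eq0 eqr_nat neq_ltn kN.
move=> k; rewrite ltnS leq_eqVlt => /orP[/eqP->|/hlow//].
move: hS; rewrite big_ord_recr /= => hS.
have hsum : S (\sum_(k < N) y k).
  by elim/big_ind: _ => // [u u' su su'|i _]; [rewrite -[u]scale1r; exact: SL|exact: hlow].
by have := SL (-1) _ _ hsum hS; rewrite scaleN1r addKr.
Qed.

(** * Elementary matrices suffice on the irreducible module *)

Section ModuleSide.
Variables (F : numFieldType) (M : smodule F) (n : nat) (lam : 'I_n -> int) (R : nat).
Hypothesis hR : forall r : int, (R < `|r|)%N -> hwcoef lam r = 0.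
Hypothesis irrM : irreducible M.
Variable v : carrier M.
Hypothesis hv : hw_vector (Lambda lam) v.
Hypothesis genv : forall W : set (carrier M), submodule W -> W v -> W = setT.

Local Notation L := (carrier M).
Implicit Types (x y : L) (a b : int -> F).

Lemma act_is_linear (g : ghat F) : linear (act g : L -> L).
Proof. exact: act_linr. Qed.

Lemma actDl g h x : act (g + h) x = act g x + act h x :> L.
Proof. by have := act_linl (x : sm0 M * sm1 M) 1 g h; rewrite !scale1r. Qed.
Lemma act0l x : act (0 : ghat F) x = 0 :> L.
Proof.
have := act_linl (x : sm0 M * sm1 M) (-1) 0 0; by rewrite !scaleN1r oppr0 addr0 addNr.
Qed.
Lemma actZl c g x : act (c *: g) x = c *: act g x :> L.
Proof.
by have := act_linl (x : sm0 M * sm1 M) c g 0; rewrite !addr0 => ->; rewrite act0l addr0.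
Qed.
Lemma act_suml (I : Type) (r : seq I) (g : I -> ghat F) x :
  act (\sum_(i <- r) g i) x = \sum_(i <- r) act (g i) x :> L.
Proof. by elim/big_rec2: _ => [|i y z _ <-]; rewrite ?act0l// actDl. Qed.

Definition sact (k : int) (a : int -> F) : L -> L := act (shift k a, 0 : F^o).
Definition kact : L -> L := act (0, 1 : F^o).
HB.instance Definition _ k a := GRing.isLinear.Build F L L _ (sact k a)
  (act_is_linear (shift k a, 0 : F^o)).

Lemma sact_ext k a b : a =1 b -> sact k a = sact k b.
Proof. by move=> e; rewrite /sact (shift_inj_ext k e). Qed.

Lemma actE (A : gl F) (c : F) x : act (A, c : F^o) x = act (A, 0 : F^o) x + c *: kact x :> L.
Proof.
rewrite /kact -actZl -actDl; congr (act _ x : L).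
by congr pair; rewrite /= ?scaler0 ?addr0// add0r [_ *: _]mulr1.
Qed.

Lemma act_band (A : gl F) : exists N : nat, forall x,
  act (A, 0 : F^o) x = \sum_(k < N.*2.+1) sact (k%:Z - N%:Z) (band (k%:Z - N%:Z) A) x :> L.
Proof.
have [N hN] := band_decomposition A; exists N => x.
rewrite /sact -act_suml; congr (act _ x : L).
rewrite {1}hN; apply: (big_ind2 (fun (X : gl F) (Y : ghat F) => (X, 0) = Y)) => //.
by move=> A1 _ A2 _ <- <-; congr pair; rewrite /= addr0.
Qed.

Lemma shift0E k : shift k (fun=> 0) = 0 :> gl F.
Proof. by apply: gl_ext => i j; rewrite shiftE if_same. Qed.

Lemma kact_comm k a x : kact (sact k a x) = sact k a (kact x).
Proof.
have h0 : ghom false (0 : gl F, 1 : F^o) by split=> // i j.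
have hk : ghom (oddz k) (shift k a, 0 : F^o) by apply: ghom_shift => j /eqP.
have := @act_bracket _ M _ _ _ _ x h0 hk; rewrite /= expr0 scale1r => /(congr1 (fun z : L => z + sact k a (kact x))).
rewrite subrK -[LHS]/(_ + sact k a (kact x)) -[RHS]/(kact (sact k a x)) => <-.
rewrite -[RHS]add0r; congr (_ + _).
rewrite /hbracket /= -(shift0E 0) glbracket_shift cocycle_shift.
rewrite (shift_inj_ext _ (b := fun=> 0)) => [|j]; last by rewrite mul0r !mulr0 subr0.
rewrite shift0E; set z := (X in (_, X)); suff -> : z = 0 by exact: act0l.
by rewrite /z; case: ifP => // _; apply: fsbig1 => r _; rewrite mulr0 mul0r mulr0.
Qed.

(** Closure under single bands, with no mention of parity or [K]: a matrix is a finite sum of bands,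
    [K] turns out to be scalar, and compatibility with parity is automatic by
    [stable_rep_graded]. *)
Definition stable (W : L -> Prop) :=
  [/\ W 0, forall c x y, W x -> W y -> W (c *: x + y)
    & forall k a x, W x -> W (sact k a x)].

Lemma stableZ W c x : stable W -> W x -> W (c *: x).
Proof. by case=> W0 WL _ Wx; rewrite -[_ *: _]addr0; exact: WL. Qed.
Lemma stableD W x y : stable W -> W x -> W y -> W (x + y).
Proof. by case=> W0 WL _ Wx Wy; rewrite -[x]scale1r; exact: WL. Qed.

Lemma stable_act0 W (A : gl F) x : stable W -> W x -> W (act (A, 0 : F^o) x).
Proof.
move=> sW Wx; have [N ->] := act_band A.
by apply: big_ind => [|u u'|k _]; [case: sW|exact: stableD|case: sW => _ _; exact].
Qed.

Lemma hv_neq0 : v != 0. Proof. by case: hv. Qed.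

(** The eigenspace of the central element is a submodule, graded because [K] is even, and it
    contains the generator [v]. *)
Lemma kactE x : kact x = n%:R *: x.
Proof.
pose W : set L := [set x | kact x = n%:R *: x]%classic.
suff -> : W x by [].
have lin : linear kact by exact: act_is_linear.
pose kl : {linear L -> L} := HB.pack kact (GRing.isLinear.Build F L L _ kact lin).
have WL c y z : W y -> W z -> W (c *: y + z).
  by rewrite /W /= => ey ez; rewrite lin ey ez scalerDr !scalerA mulrC.
have W0 : W 0 by rewrite /W /= scaler0; exact: (linear0 kl).
have sW : stable W by split=> // k a y; rewrite /W /= kact_comm => ->; rewrite linearZ.
suff -> : W = setT by [].
apply: genv; last first.
  case: hv => _ _ _ h; rewrite /W /= /kact h; last by move=> i j _; rewrite /= entry0.
  rewrite /Lambda /= fsbig1 ?add0r ?mul1r// => r _.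
  by rewrite mul0r.
split=> //.
  move=> y; have k0 := @act_parity _ M false _ (0, 1 : F^o) _.
  have h0 : ghom false (0 : gl F, 1 : F^o) by split=> // i j.
  rewrite /W /= => ey.
  have e : kact y = kact (y.1, 0) + kact (0, y.2).
    rewrite -(linearD kl); congr (kact _); rewrite {1}[y]surjective_pairing.
    by congr pair; rewrite /= ?addr0 ?add0r.
  have := k0 false (y.1, 0) h0 erefl; have := k0 true (0, y.2) h0 erefl.
  rewrite /vhom /= => e1 e2.
  move: e ey => -> ey.
  have := congr1 fst ey; have := congr1 snd ey => /=; rewrite /= -/kact.
  rewrite e1 e2 addr0 add0r => es ef; split.
    by rewrite [LHS]surjective_pairing e2 ef; congr pair; rewrite /= scaler0.
  by rewrite [LHS]surjective_pairing e1 es; congr pair; rewrite /= scaler0.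
move=> [A c] y Wy; rewrite actE; apply: stableD => //; first exact: stable_act0.
by apply: stableZ => //; have := WL (n%:R) _ _ Wy W0; rewrite addr0 Wy.
Qed.

Lemma sact_comm k l a b x : sact k a (sact l b x) =
  (-1) ^+ (oddz k && oddz l) *: sact l b (sact k a x)
  + sact (k + l)
      (fun j => a (j + l) * b j - (-1) ^+ (oddz k && oddz l) * (b (j + k) * a j)) x
  + (cocycle (shift k a) (shift l b) * n%:R) *: x.
Proof.
have hk : ghom (oddz k) (shift k a, 0 : F^o) by apply: ghom_shift => j /eqP.
have hl : ghom (oddz l) (shift l b, 0 : F^o) by apply: ghom_shift => j /eqP.
have := @act_bracket _ M _ _ _ _ x hk hl.
move=> /(congr1 (fun z : L => z + (-1) ^+ (oddz k && oddz l) *: sact l b (sact k a x))).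
rewrite subrK -[RHS]/(sact k a (sact l b x)) => <-; rewrite -addrA addrC; congr (_ + _).
by rewrite /hbracket /= actE kactE scalerA glbracket_shift.
Qed.

Variable p0 : bool.
Hypothesis hp0 : vhom p0 v.

(** The diagonal matrix with entry [j] at [j], infinite but banded. A band of shift [k] raises its
    eigenvalue by [k], so it measures the depth below [v]. *)
Definition deg_op : L -> L := sact 0 (fun j => j%:~R).
Definition deg0 : F := Lambda lam (shift 0 (fun j => j%:~R), 0 : F^o).

Lemma deg_op_act k b x : deg_op (sact k b x) = sact k b (deg_op x) + k%:~R *: sact k b x.
Proof.
rewrite /deg_op sact_comm /= expr0 scale1r.
have -> : cocycle (shift 0 (fun j => j%:~R)) (shift k b) = 0 :> F.
  rewrite cocycle_shift; case: ifP => // /eqP; rewrite add0r => ->.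
  by apply: fsbig1 => r _; rewrite addr0 subrr !mul0r mulr0.
rewrite mul0r scale0r addr0 add0r; congr (_ + _).
rewrite /sact -actZl; congr (act _ x : L); congr pair; last by rewrite /= scaler0.
apply: gl_ext => i j; rewrite entryZ !shiftE; case: ifP => _; last by rewrite mulr0.
by rewrite addr0 rmorphD /=; ring.
Qed.

(** Degree and parity are tied, a band of shift [k] having the parity of [k]. A subspace that splits
    into degrees therefore splits into even and odd parts, as [submodule] demands. *)
Definition homog (k : nat) x :=
  deg_op x = (deg0 + k%:R) *: x /\ vhom (p0 (+) odd k) x.

Lemma homogP k c x y : homog k x -> homog k y -> homog k (c *: x + y).
Proof.
move=> [ex px] [ey py]; split.
  by rewrite /deg_op linearP /= -!/(deg_op _) ex ey scalerDr !scalerA mulrC.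
by move: px py; rewrite /vhom; case: ifP => _ /= -> ->; rewrite scaler0 addr0.
Qed.

Lemma homog0 k : homog k 0.
Proof.
split; first by rewrite /deg_op linear0 scaler0.
by rewrite /vhom; case: ifP.
Qed.

Lemma homog_act k l b x : homog k x -> homog (k + l) (sact l%:Z b x).
Proof.
move=> [ex px]; split.
  rewrite deg_op_act ex linearZ /= -scalerDl; congr (_ *: _).
  by rewrite natrD addrA.
have hl : ghom (odd l) (shift l%:Z b, 0 : F^o).
  by apply: ghom_shift => j; rewrite /oddz /= eqxx.
have := act_parity hl px; rewrite oddD.
by case: (odd l); case: p0; case: (odd k).
Qed.

(** With [s] true the component of degree zero is absent: this expresses that [x] lies strictly
    below [v]. *)
Definition rep (s : bool) x := exists N (y : nat -> L),
  [/\ forall k, homog k (y k), forall k, (N <= k)%N -> y k = 0,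
     s -> y 0 = 0 & x = \sum_(k < N) y k].

Lemma repP s c x x' : rep s x -> rep s x' -> rep s (c *: x + x').
Proof.
move=> [N [y [hy y0 sy ->]]] [N' [y' [hy' y0' sy' ->]]].
exists (maxn N N'), (fun k => c *: y k + y' k); split.
- by move=> k; exact: homogP.
- by move=> k; rewrite geq_max => /andP[h h']; rewrite y0// y0'// scaler0 addr0.
- by move=> st; rewrite sy// sy'// scaler0 addr0.
rewrite big_split /= -scaler_sumr; congr (_ *: _ + _).
  rewrite (big_ord_widen _ y (leq_maxl N N')) big_mkcond /=; apply: eq_bigr => k _.
  by case: ltnP => // /y0.
rewrite (big_ord_widen _ y' (leq_maxr N N')) big_mkcond /=; apply: eq_bigr => k _.
by case: ltnP => // /y0'.
Qed.

Lemma rep_homog (s : bool) k x : (s -> (0 < k)%N) -> homog k x -> rep s x.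
Proof.
move=> sk hx; exists k.+1, (fun j => if j == k then x else 0); split.
- by move=> j; case: eqP => [->|_] //; exact: homog0.
- by move=> j; case: eqP => // ->; rewrite ltnn.
- by move=> /sk; case: k {hx sk}.
rewrite big_ord_recr /= eqxx big1 ?add0r// => j _.
by rewrite ltn_eqF.
Qed.

Lemma rep_separation s x W : stable W -> rep s x -> W x ->
  exists N (y : nat -> L), [/\ forall k, homog k (y k), s -> y 0 = 0,
    forall k, (k < N)%N -> W (y k) & x = \sum_(k < N) y k].
Proof.
move=> [W0 WL WA] [N [y [hy _ sy ->]]] Wx; exists N, y; split=> //.
apply: (@eigen_separation _ _ W deg_op deg0) Wx => //.
- exact: act_is_linear.
- by move=> u; exact: WA.
- by move=> k; case: (hy k).
Qed.

Inductive lower_span (B : L -> Prop) : L -> Prop :=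
| ls0 : lower_span B 0
| ls_lin c x y : lower_word B x -> lower_span B y -> lower_span B (c *: x + y)
with lower_word (B : L -> Prop) : L -> Prop :=
| lw_base x : B x -> lower_word B x
| lw_act k a x : (0 < k)%N -> lower_word B x -> lower_word B (sact k%:Z a x).

Lemma ls_P B c x y : lower_span B x -> lower_span B y -> lower_span B (c *: x + y).
Proof.
move=> hx hy; elim: hx => [|d {}x z hx _ IH]; first by rewrite scaler0 add0r.
by rewrite scalerDr scalerA -addrA; exact: ls_lin hx IH.
Qed.

Lemma ls_word B x : lower_word B x -> lower_span B x.
Proof. by move=> h; have := ls_lin 1 h (ls0 B); rewrite addr0 scale1r. Qed.

Lemma ls_Z B c x : lower_span B x -> lower_span B (c *: x).
Proof. by move=> h; rewrite -[_ *: _]addr0; apply: ls_P => //; exact: ls0. Qed.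

Lemma ls_D B x y : lower_span B x -> lower_span B y -> lower_span B (x + y).
Proof. by move=> h; rewrite -[x + y](congr1 (+%R^~ y) (scale1r x)); exact: ls_P. Qed.

Lemma ls_lower B k a x : (0 < k)%N -> lower_span B x -> lower_span B (sact k%:Z a x).
Proof.
move=> k0; elim=> {x} [|c x y hx _ IH]; first by rewrite linear0; exact: ls0.
by rewrite linearP; apply: ls_lin IH; exact: lw_act.
Qed.

Lemma lower_span_stable B :
  (forall k a x, (k <= 0)%R -> B x -> lower_span B (sact k a x)) ->
  stable (lower_span B).
Proof.
move=> hB; split=> [|c x y|k a x]; [exact: ls0|exact: ls_P|].
have hw y l b : lower_word B y -> lower_span B (sact l b y).
  move=> h; elim: h l b => {y} [y By|j d y j0 hy IH] l b.
    have [l0|l0] := leP l 0; first exact: hB.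
    have -> : l = `|l|%N by lia.
    by apply: ls_lower; [lia|apply: ls_word; exact: lw_base].
  rewrite sact_comm; apply: ls_D; [apply: ls_D|].
  - by apply/ls_Z/ls_lower.
  - exact: IH.
  - by apply/ls_Z/ls_word.
elim=> {x} [|c x y hx _ IH]; first by rewrite linear0; exact: ls0.
by rewrite linearP; apply: ls_P IH; exact: hw.
Qed.

Lemma lower_span_rep (s : bool) B : (forall x, B x -> exists2 k, homog k x & s -> (0 < k)%N) ->
  forall x, lower_span B x -> rep s x.
Proof.
move=> hB x.
have hw y : lower_word B y -> exists2 k, homog k y & s -> (0 < k)%N.
  elim=> {y} [y /hB//|j d y j0 _ [k hk sk]].
  by exists (k + j)%N; [exact: homog_act|move=> /sk; rewrite addn_gt0 => ->].
elim=> {x} [|c x y hx _ IH].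
  exists 0, (fun=> 0); split=> //; [exact: homog0|by rewrite big_ord0].
by apply: repP IH; have [k hk sk] := hw _ hx; exact: rep_homog hk.
Qed.

Lemma sact_pos_v k a : k < 0 -> sact k a v = 0.
Proof.
move=> k0; case: hv => _ _ h _; apply: h; split=> //= i j ij.
rewrite shiftE; case: eqP => // e; lia.
Qed.

Lemma sact_diag_v a : sact 0 a v = Lambda lam (shift 0 a, 0 : F^o) *: v.
Proof.
case: hv => _ _ _ h; apply: h => i j ij /=; rewrite shiftE.
by rewrite subr_eq0 (negPf ij).
Qed.

Lemma homog_v : homog 0 v.
Proof. by split; [rewrite /deg_op sact_diag_v addr0|rewrite addbF]. Qed.

Lemma stable_rep_graded s W x : stable W -> rep s x -> W x -> W (x.1, 0) /\ W (0, x.2).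
Proof.
move=> sW rx Wx; have [N [y [hy _ Wy ->]]] := rep_separation sW rx Wx.
have split_y k : (k < N)%N -> W ((y k).1, 0) /\ W (0, (y k).2).
  move=> kN; have := Wy k kN; case: (hy k) => _; rewrite [y k]surjective_pairing /vhom.
  by case: ifP => _ /= ->; split=> //; case: sW.
split.
  rewrite (big_morph (fun z : L => (z.1, 0) : L) (id1 := 0) (op1 := +%R)) //.
    by apply: big_ind => [|? ?|k _]; [case: sW|exact: stableD|case: (split_y k (ltn_ord k))].
  by move=> z z'; congr pair; rewrite /= addr0.
rewrite (big_morph (fun z : L => (0, z.2) : L) (id1 := 0) (op1 := +%R)) //.
  by apply: big_ind => [|? ?|k _]; [case: sW|exact: stableD|case: (split_y k (ltn_ord k))].
by move=> z z'; congr pair; rewrite /= addr0.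
Qed.

Lemma stable_submodule (W : set L) : stable W -> (forall x, W x -> W (x.1, 0) /\ W (0, x.2)) ->
  submodule W.
Proof.
move=> sW gW; have [W0 WL _] := sW; split=> // -[A c] x Wx.
rewrite actE; apply: stableD => //; first exact: stable_act0.
by rewrite kactE; apply: stableZ => //; exact: stableZ.
Qed.

Lemma rep_all x : rep false x.
Proof.
pose B := fun y => y = v.
have hB k a y : k <= 0 -> B y -> lower_span B (sact k a y).
  rewrite le_eqVlt => /orP[/eqP->|k0] ->.
    by rewrite sact_diag_v; apply/ls_Z/ls_word/lw_base.
  by rewrite sact_pos_v//; exact: ls0.
have sB := lower_span_stable hB.
have rB y : lower_span B y -> rep false y.
  apply: lower_span_rep => z ->; exists 0%N => //; exact: homog_v.
apply: (rB x); suff -> : lower_span B = setT by [].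
apply: genv; last by apply/ls_word/lw_base.
by apply: stable_submodule => // y By; apply: stable_rep_graded (rB _ By) By.
Qed.

Lemma stable_full W x : stable W -> W x -> x != 0 -> forall y, W y.
Proof.
move=> sW Wx x0 y; case: irrM => _ /(_ W) [].
- by apply: stable_submodule => // z; exact: stable_rep_graded (rep_all z).
- by move=> e; move: Wx x0; rewrite e /= => ->; rewrite eqxx.
- by move->.
Qed.

Lemma rep_true_v : ~ rep true v.
Proof.
move=> [N [y [hy y0 /(_ isT) y00 ev]]].
have s0 : stable (fun x => x = 0).
  split=> // [c x z -> ->|k a x ->]; rewrite ?scaler0 ?addr0//.
  exact: linear0.
(* With [- v] placed in degree zero the family sums to zero, and separation of eigenvectors inside
   the zero subspace yields [v = 0]. *)
pose y' k := if k == 0%N then - v else y k.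
have hy' k : homog k (y' k).
  rewrite /y'; case: eqP => [->|_] //.
  by rewrite -scaleN1r -[_ *: _]addr0; apply: homogP; [exact: homog_v|exact: homog0].
have := @eigen_separation _ _ (fun x => x = 0) deg_op deg0 y' N.+1.
move=> /(_ _ erefl _ _ _ _ 0%N isT) h.
suff : y' 0%N = 0 by rewrite /y' /= => /eqP; rewrite oppr_eq0 (negPf hv_neq0).
apply: h; [exact: act_is_linear| | | |].
- by case: s0.
- by move=> u ->; case: s0 => _ _; apply.
- by move=> k; case: (hy' k).
have e : \sum_(k < N.+1) y k = v.
  by rewrite big_ord_recr /= y0// addr0 -ev.
move: e; rewrite !big_ord_recl /= y00 add0r => e.
rewrite /y' /=; apply/eqP; rewrite addrC subr_eq0 -[X in _ == X]e; apply/eqP.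
by apply: eq_bigr.
Qed.

(** A nonzero element of [B] would generate a nonzero stable subspace living in positive degrees,
    hence without [v], against irreducibility. *)
Lemma lower_span_null B :
  (forall x, B x -> exists2 k, homog k x & (0 < k)%N) ->
  (forall k a x, (k <= 0)%R -> B x -> lower_span B (sact k a x)) ->
  forall x, B x -> x = 0.
Proof.
move=> hB sB x Bx; apply/eqP; apply: contraT => x0.
have := stable_full (lower_span_stable sB) (ls_word (lw_base Bx)) x0 v.
by move=> /(lower_span_rep (s := true)) h; case: rep_true_v; apply: h => y /hB[k]; exists k.
Qed.

(** For [k > 0] the row [j + k] and the column [j] are then both beyond [R] on the same side of
    zero, where the highest weight vanishes and the cocycle contributes nothing. *)
Definition far (k : int) (a : int -> F) :=
  forall j : int, a j != 0 -> (R%:Z < j) || (j + k < - R%:Z).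

Lemma Lambda_far a : (forall j : int, a j != 0 -> (R < `|j|)%N) ->
  Lambda lam (shift 0 a, 0 : F^o) = 0.
Proof.
move=> ha; rewrite /Lambda /= mul0r addr0; apply: fsbig1 => r _.
rewrite shiftE subrr eqxx; have [->|/ha/hR->] := eqVneq (a r) 0; first by rewrite mul0r.
by rewrite mulr0.
Qed.

(** Even an infinite far band kills [v]. Its commutator with a diagonal or raising band is again a
    far band, or a diagonal matrix on which the highest weight is zero, or a raising band; so
    [lower_span_null] applies to all vectors of this form together. *)
Lemma far_lower_v (k : nat) a : (0 < k)%N -> far k a -> sact k a v = 0.
Proof.
move=> k0 fa; pose B x := exists2 k : nat, (0 < k)%N & exists2 a, far k a & x = sact k a v.
apply: (@lower_span_null B) => [x [l l0 [b _ ->]]|l b x l0 [j j0 [d fd ->]]|].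
- by exists l => //; have := homog_act l b homog_v.
- have fz (z : int) : far j d -> d z = 0 \/ ((R%:Z < z) || (z + j%:Z < - R%:Z)).
    by move=> f; case: (eqVneq (d z) 0) => [|/f]; [left|right].
  rewrite sact_comm; apply: ls_D; [apply: ls_D|].
  + apply: ls_Z; move: l0; rewrite le_eqVlt => /orP[/eqP->|l0].
      rewrite sact_diag_v linearZ /=; apply/ls_Z/ls_word/lw_base.
      by exists j => //; exists d.
    by rewrite sact_pos_v// linear0; exact: ls0.
  + set d' := fun _ => _.
    have fd' z : d' z != 0 -> (R%:Z < z) || (z + (l + j%:Z) < - R%:Z).
      rewrite /d'; case: (fz z fd) => [->|h _]; last by lia.
      case: (fz (z + l) fd) => [->|h _]; last by lia.
      by rewrite !(mulr0, mul0r) subrr eqxx.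
    have [lj|lj|lj] := ltgtP (l + j%:Z) 0.
    * by rewrite sact_pos_v//; exact: ls0.
    * have e : l + j%:Z = `|(l + j%:Z)%R|%N%:Z by lia.
      rewrite e; apply/ls_word/lw_base; exists `|(l + j%:Z)%R|%N; first by lia.
      by exists d' => //; rewrite -e.
    * rewrite lj sact_diag_v Lambda_far ?scale0r; first exact: ls0.
      by move=> z /fd'; lia.
  + rewrite cocycle_shift; case: ifP => _; last by rewrite mul0r scale0r; exact: ls0.
    rewrite fsbig1 => [|r _]; first by rewrite mul0r scale0r; exact: ls0.
    case: (fz r fd) => [->|h]; first by rewrite !mulr0.
    have -> : (r + j%:Z <= 0) = (r <= 0) by lia.
    by rewrite subrr !mul0r mulr0.
- by exists k => //; exists a.
Qed.

Definition elem (r s : int) : L -> L := sact (r - s) (fun j => (j == s)%:R).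
HB.instance Definition _ r s := GRing.Linear.on (elem r s).

Lemma elemE r s x : elem r s x = act (glunit F r s, 0 : F^o) x.
Proof. by rewrite glunit_shift. Qed.

Lemma oddzB_par r s : oddz (r - s) = par r s.
Proof. by rewrite /par !oddzD oddzN. Qed.

Lemma elem_rel : gl_rel (fun r s => elem r s) n.
Proof.
move=> r s t u x.
have hh r' s' : ghom (par r' s') (glunit F r' s', 0 : F^o).
  by rewrite glunit_shift -oddzB_par; apply: ghom_shift => j /eqP.
have := @act_bracket _ M _ _ _ _ x (hh r s) (hh t u).
move=> /(congr1 (fun z : L => z + (-1) ^+ (par r s && par t u) *: elem t u (elem r s x))).
rewrite -!elemE subrK => e; rewrite -[LHS]/(elem r s (elem t u x)) -e.
rewrite hbracket_glunit actE kactE scalerA [LHS]addrC -!addrA; congr (_ + _).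
have -> (A B : gl F) c d (z : L) : act (c *: A - d *: B, 0 : F^o) z =
    c *: act (A, 0 : F^o) z - d *: act (B, 0 : F^o) z :> L.
  have -> : (c *: A - d *: B, 0 : F^o) = c *: (A, 0 : F^o) + (- d) *: (B, 0 : F^o) :> ghat F.
    by congr pair; rewrite /= ?scaleNr// !scaler0 subrr.
  by rewrite (actDl _ _ z) !actZl scaleNr.
by rewrite -!elemE -addrA.
Qed.

Local Notation gen := (gen (fun r s => elem r s)).

(** The bound [Q] depends on [x] and grows with each elementary factor: a band whose support avoids
    the two indices of an elementary matrix supercommutes with it, with zero cocycle. *)
Lemma sact_far_gen x (k : int) : gen v x -> exists Q : nat, forall a,
  (forall j : int, a j != 0 -> (Q < `|j|)%N && (Q < `|(j + k)%R|)%N) -> sact k a x = 0.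
Proof.
move=> h; elim: h k => {x} [|c x y _ IHx _ IHy|r s x _ IH] k.
- exists (R + `|k|)%N => a ha; have [k0|k0|k0] := ltgtP k 0.
  + exact: sact_pos_v.
  + have e : k = `|k|%N by lia.
    by rewrite e; apply: far_lower_v => [|j /ha]; lia.
  + by rewrite k0 sact_diag_v Lambda_far ?scale0r// => j /ha; lia.
- have [Q hQ] := IHx k; have [Q' hQ'] := IHy k; exists (Q + Q')%N => a ha.
  by rewrite linearP /= hQ ?hQ' ?scaler0 ?addr0// => j /ha; lia.
- have [Q hQ] := IH k; exists (Q + `|r| + `|s|)%N => a ha.
  have a0 j : (`|j| <= Q + `|r| + `|s|)%N || (`|(j + k)%R| <= Q + `|r| + `|s|)%N -> a j = 0.
    by move=> hj; apply/eqP; apply: contraT => /ha; lia.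
  rewrite /elem sact_comm hQ => [|j /ha]; last by lia.
  rewrite linear0 scaler0 add0r cocycle_shift.
  rewrite (_ : sact _ _ _ = 0) ?add0r.
    case: ifP => _; last by rewrite mul0r scale0r.
    rewrite fsbig1 ?mul0r ?scale0r// => q _; have [->|_] := eqVneq q s; last by rewrite !mulr0.
    by rewrite a0 ?mulr0 ?mul0r ?mulr0//; lia.
  rewrite (sact_ext _ (b := fun=> 0)) /sact ?shift0E ?act0l// => j.
  have [->|_] := eqVneq j s.
    rewrite (a0 (s + _)) ?mul0r; last by lia.
    by rewrite (a0 s) ?mulr0 ?subrr//; lia.
  have [e|_] := eqVneq (j + k) s; last by rewrite !(mul0r, mulr0) subrr.
  by rewrite (a0 j) ?mulr0 ?subrr//; lia.
Qed.

Lemma sactD k a b x : sact k (fun j => a j + b j) x = sact k a x + sact k b x.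
Proof.
rewrite /sact -actDl; congr (act _ x : L); congr pair; last by rewrite /= addr0.
by apply: gl_ext => i j; rewrite entryD !shiftE; case: ifP; rewrite ?addr0.
Qed.

Lemma sact_finite_gen k a (W : nat) x : (forall j : int, (W < `|j|)%N -> a j = 0) ->
  gen x (sact k a x).
Proof.
move=> ha.
have -> : sact k a x = \sum_(i < W.*2.+1) a (i%:Z - W%:Z) *: elem (i%:Z - W%:Z + k) (i%:Z - W%:Z) x.
  pose A (i : 'I_W.*2.+1) := shift (i%:Z - W%:Z + k - (i%:Z - W%:Z)) (fun j => (j == i%:Z - W%:Z)%:R : F).
  transitivity (act (\sum_(i < W.*2.+1) a (i%:Z - W%:Z) *: (A i, 0 : F^o)) x : L); last first.
    by rewrite act_suml; apply: eq_bigr => i _; rewrite actZl.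
  congr (act _ x : L); transitivity (\sum_(i < W.*2.+1) a (i%:Z - W%:Z) *: A i, 0 : F^o).
    congr pair; apply: gl_ext => i j; rewrite glsum_entry shiftE.
    have [jW|jW] := ltnP W `|j|%N.
      rewrite ha// if_same big1// => l _; rewrite entryZ shiftE.
      have -> : (j == l%:Z - W%:Z) = false by have := ltn_ord l; lia.
      by rewrite if_same mulr0.
    have jW' : (`|(j + W%:Z)%R| < W.*2.+1)%N by lia.
    rewrite (bigD1 (Ordinal jW'))//= big1 ?addr0 => [|l lj].
      rewrite entryZ shiftE; have -> : `|(j + W%:Z)%R|%N%:Z - W%:Z = j by lia.
      rewrite eqxx [j + k]addrC addrK; case: ifP => _; by rewrite ?mulr1 ?mulr0.
    rewrite entryZ shiftE; have [e|_] := eqVneq j (l%:Z - W%:Z).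
      by case/eqP: lj; apply: val_inj => /=; rewrite e subrK.
    by rewrite if_same mulr0.
  apply: (big_ind2 (fun (X : gl F) (Y : ghat F) => (X, 0) = Y)) => // [A1 _ A2 _ <- <-|i _].
    by congr pair; rewrite /= addr0.
  by congr pair; rewrite /= scaler0.
apply: gen_sum => i _; apply: genZ; apply: (@gen_act _ _ (fun r s => elem r s)); exact: gen_base.
Qed.

(** The band splits into a far part, which kills [x], and a finite part, which is a combination of
    elementary matrices. *)
Lemma gen_sact (k : int) a x : gen v x -> gen x (sact k a x).
Proof.
move=> hx; have [Q hQ] := sact_far_gen k hx.
pose c j := (Q < `|j|)%N && (Q < `|(j + k)%R|)%N.
rewrite (sact_ext _ (b := fun j => (if c j then a j else 0) + (if c j then 0 else a j))); last first.
  by move=> j; case: (c j); rewrite ?addr0 ?add0r.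
rewrite sactD hQ ?add0r => [|j]; last by rewrite /c; case: ifP => //; rewrite eqxx.
apply: (@sact_finite_gen _ _ (Q + `|k|)%N) => j hj.
by rewrite /c; case: ifP => //; lia.
Qed.

Lemma gen_stable x : gen v x -> stable (gen x).
Proof.
move=> hx; split=> [|c y z|k a y hy]; [exact: gen0|exact: gen_lin|].
by apply: (gen_trans hy); apply: gen_sact; exact: gen_trans hx hy.
Qed.

Lemma gen_all x : gen v x.
Proof.
exact: stable_full (gen_stable (gen_base _ v)) (gen_base _ v) hv_neq0 x.
Qed.

Lemma elem_simple : cyclic_simple (fun r s => elem r s) v.
Proof.
move=> x _ x0; exact: stable_full (gen_stable (gen_all x)) (gen_base _ x) x0 v.
Qed.

Lemma elem_raise r s : r < s -> elem r s v = 0.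
Proof. by move=> rs; apply: sact_pos_v; rewrite subr_lt0. Qed.

Lemma elem_weight : eigen (fun r s => elem r s) (fun r => (hwcoef lam r)%:~R) v.
Proof.
move=> r; rewrite -[LHS]/(sact (r - r) (fun j => (j == r)%:R) v) subrr sact_diag_v; congr (_ *: _).
rewrite /Lambda /= mul0r addr0 (@fsum_single _ _ _ r) => [|s sr].
  by rewrite shiftE subrr !eqxx mul1r.
by rewrite shiftE (negPf sr) if_same mul0r.
Qed.

End ModuleSide.

(** * Fock space *)

Section Oscillators.
Variables (C : numClosedFieldType) (Mode : countType) (fer : pred Mode).

Definition config := Mode -> nat.
Definition fock := config -> C^o.
HB.instance Definition _ := GRing.Lmodule.on fock.
Implicit Types (k : config) (p q : Mode) (f g : fock).

Definition inc k q : config := fun p => (k p + (p == q))%N.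
Definition dec k q : config := fun p => (k p - (p == q))%N.

Lemma incC k p q : inc (inc k p) q = inc (inc k q) p.
Proof. by apply/funext => r; rewrite /inc addnAC. Qed.
Lemma incK k q : dec (inc k q) q = k.
Proof. by apply/funext => r; rewrite /inc /dec addnK. Qed.
Lemma decK k q : (0 < k q)%N -> inc (dec k q) q = k.
Proof. by move=> h; apply/funext => r; rewrite /inc /dec; case: eqP => [->|_]; lia. Qed.
Lemma config_case k q : k q = 0%N \/ exists k', k = inc k' q.
Proof.
have [e|h] := posnP (k q); first by left.
by right; exists (dec k q); rewrite decK.
Qed.
Lemma inc_same k q : inc k q q = (k q).+1.
Proof. by rewrite /inc eqxx addn1. Qed.
Lemma inc_other k p q : p != q -> inc k q p = k p.
Proof. by move=> /negPf h; rewrite /inc h addn0. Qed.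

(* The exponent of the Jordan-Wigner sign. *)
Definition jw q k : nat :=
  \sum_(j < choice.pickle q) (if (pickle_inv j : option Mode) is Some p then fer p * k p else 0)%N.

Lemma jw_inc q p k : jw q (inc k p) = (jw q k + (fer p && (choice.pickle p < choice.pickle q)))%N.
Proof.
rewrite /jw -[X in (_ + X)%N](_ : (\sum_(j < choice.pickle q)
   (if (pickle_inv j : option Mode) is Some r then fer r * (r == p) else 0))%N = _).
  rewrite -big_split /=; apply: eq_bigr => j _.
  by case: pickle_inv => // r; rewrite /inc mulnDr.
have [pq|pq] := ltnP (choice.pickle p) (choice.pickle q).
  rewrite (bigD1 (Ordinal pq)) //= pickleK_inv eqxx muln1 big1 ?addn0 ?andbT// => j jp.
  case e: pickle_inv => [r|//]; have [rp|] := eqVneq r p; last by rewrite muln0.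
  move: (@pickle_invK Mode j); rewrite /ocancel e /= => jr; case/eqP: jp; apply: val_inj.
  by rewrite /= -jr rp.
rewrite andbF big1// => j _; case e: pickle_inv => [r|//].
have [rp|] := eqVneq r p; last by rewrite muln0.
move: (@pickle_invK Mode j); rewrite /ocancel e /= rp => jr.
by have := leq_trans (ltn_ord j) pq; rewrite -jr ltnn.
Qed.

(** A fermionic mode may hold any number of particles, of which only the parity is seen: the levels
    pair up as 0-1, 2-3 and so on, and the anticommutation relations hold on each pair. The
    exclusion principle is imposed later on supports, by [good]. For bosons the square root makes
    [ann] the adjoint of [cre]. *)
Definition amp q k : C :=
  if fer q then (odd (k q))%:R * (-1) ^+ jw q k else sqrtC (k q)%:R.

Definition ord_sign q p : C := (-1) ^+ [&& fer q, fer p & (choice.pickle p < choice.pickle q)%N].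
Definition exch q p : C := (-1) ^+ (fer q && fer p).

Lemma amp_inc q p k : q != p -> amp q (inc k p) = ord_sign q p * amp q k.
Proof.
move=> qp; rewrite /amp /ord_sign inc_other//; case: (fer q) => /=; last by rewrite mul1r.
by rewrite jw_inc exprD mulrA mulrC.
Qed.

Lemma amp0 q k : k q = 0%N -> amp q k = 0.
Proof. by rewrite /amp => ->; rewrite mul0r sqrtC0 if_same. Qed.

Lemma ord_signK q p : ord_sign q p * ord_sign q p = 1.
Proof. by rewrite -expr2 sqrr_sign. Qed.

Lemma ord_sign_exch q p : q != p -> ord_sign q p = exch q p * ord_sign p q.
Proof.
move=> qp; rewrite /ord_sign /exch; have : choice.pickle q != choice.pickle p.
  by apply: contraNneq qp => /(pcan_inj choice.pickleK) ->.
case: (fer q); case: (fer p) => //=; rewrite ?mul1r//.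
by rewrite neq_ltn; case: ltngtP => //= _ _; rewrite ?expr0 ?expr1 ?mulr1 ?mulN1r ?opprK.
Qed.

Lemma amp_conj q k : (amp q k)^* = amp q k.
Proof.
rewrite /amp; case: ifP => _; last by rewrite conj_Creal// ger0_real// sqrtC_ge0 ler0n.
by rewrite rmorphM rmorphXn rmorphN rmorph1 /= conjC_nat.
Qed.

Definition cre q f : fock := fun k => amp q k * f (dec k q).
Definition ann q f : fock := fun k => amp q (inc k q) * f (inc k q).

Fact cre_is_linear q : linear (cre q).
Proof. by move=> a f g; apply/funext => k; rewrite /cre mulrDr mulrCA. Qed.
HB.instance Definition _ q := GRing.isLinear.Build C fock fock _ (cre q) (cre_is_linear q).
Fact ann_is_linear q : linear (ann q).
Proof. by move=> a f g; apply/funext => k; rewrite /ann mulrDr mulrCA. Qed.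
HB.instance Definition _ q := GRing.isLinear.Build C fock fock _ (ann q) (ann_is_linear q).

Lemma scalefE a f k : (a *: f) k = a * f k.
Proof. by []. Qed.
Lemma addfE f g k : (f + g) k = f k + g k.
Proof. by []. Qed.
Lemma oppfE f k : (- f) k = - f k.
Proof. by []. Qed.

Lemma amp_sqr q k : amp q (inc k q) * amp q (inc k q) - exch q q * (amp q k * amp q k) = 1.
Proof.
rewrite /amp /exch andbb jw_inc ltnn andbF addn0 inc_same.
case: (fer q) => /=; last first.
  by rewrite mul1r -!expr2 !sqrtCK -natr1 addrAC subrr add0r.
have e : (-1) ^+ jw q k * (-1) ^+ jw q k = 1 :> C by rewrite -expr2 sqrr_sign.
by case: odd; rewrite /= expr1 ?mul0r ?mul1r e ?mulr0 ?subr0 ?sub0r ?mulN1r ?opprK.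
Qed.

Lemma exchC p q : exch p q = exch q p.
Proof. by rewrite /exch andbC. Qed.
Lemma exchK p q : exch p q * exch p q = 1.
Proof. by rewrite -expr2 sqrr_sign. Qed.

Lemma ann_ann p q f : ann p (ann q f) = exch p q *: ann q (ann p f).
Proof.
apply/funext => k; rewrite -[RHS]/(exch p q * ann q (ann p f) k) /ann.
have [<-|pq] := eqVneq p q.
  rewrite /exch andbb /amp; case: ifP => _; last by rewrite mul1r.
  by rewrite !inc_same /=; case: odd; rewrite /= !(mul0r, mulr0).
have qp : q != p by rewrite eq_sym.
have -> : amp q (inc (inc k p) q) = ord_sign q p * amp q (inc k q).
  by rewrite incC amp_inc.
have -> : amp p (inc (inc k q) p) = ord_sign p q * amp p (inc k p).
  by rewrite incC amp_inc.
by rewrite incC (ord_sign_exch pq) -[LHS]mul1r -(exchK p q); ring.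
Qed.

Lemma cre_cre p q f : cre p (cre q f) = exch p q *: cre q (cre p f).
Proof.
apply/funext => k; rewrite scalefE /cre.
have [<-|pq] := eqVneq p q.
  rewrite /exch andbb; case fp: (fer p); last by rewrite mul1r.
  have [k0|[k' ->]] := config_case k p; first by rewrite amp0// !mul0r mulr0.
  rewrite incK; have [k0|[k'' ->]] := config_case k' p; first by rewrite (amp0 k0) !(mul0r, mulr0).
  by rewrite /amp fp !inc_same /=; case: odd; rewrite /= !(mul0r, mulr0).
have qp : q != p by rewrite eq_sym.
have [k0|[k' ->]] := config_case k p.
  have k1 : dec k q p = 0%N by rewrite /dec k0.
  by rewrite (amp0 k0) (amp0 k1) !(mul0r, mulr0).
have [k0|[k'' ->]] := config_case k' q.
  have k1 : inc k' p q = 0%N by rewrite inc_other.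
  by rewrite incK (amp0 k0) (amp0 k1) !(mulr0, mul0r).
have eA : amp p (inc (inc k'' q) p) = ord_sign p q * amp p (inc k'' p).
  by rewrite incC amp_inc.
have eB : amp q (inc (inc k'' q) p) = ord_sign q p * amp q (inc k'' q).
  by rewrite amp_inc.
have -> : dec (inc (inc k'' q) p) q = inc k'' p by rewrite incC incK.
by rewrite eA eB !incK (ord_sign_exch pq); ring.
Qed.

Lemma ann_cre p q f : ann p (cre q f) = exch p q *: cre q (ann p f) + (p == q)%:R *: f.
Proof.
apply/funext => k; rewrite addfE !scalefE /cre /ann.
have [<-|pq] := eqVneq p q.
  rewrite incK mul1r.
  have [k0|[k' ek]] := config_case k p.
    by rewrite (amp0 k0) mul0r mulr0 add0r mulrA -[RHS]mul1r -(amp_sqr p k) (amp0 k0); ring.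
  rewrite decK ?ek ?inc_same// -ek mulrA.
  rewrite -[X in _ = _ + X]mul1r -(amp_sqr p k); ring.
have qp : q != p by rewrite eq_sym.
rewrite mul0r addr0; have [k0|[k' ->]] := config_case k q.
  have k1 : inc k p q = 0%N by rewrite inc_other.
  by rewrite (amp0 k0) (amp0 k1) !(mulr0, mul0r).
have eA : amp p (inc (inc k' q) p) = ord_sign p q * amp p (inc k' p).
  by rewrite incC amp_inc.
have eB : amp q (inc (inc k' q) p) = ord_sign q p * amp q (inc k' q).
  by rewrite amp_inc.
have -> : dec (inc (inc k' q) p) q = inc k' p by rewrite incC incK.
by rewrite eA eB !incK (ord_sign_exch pq) -[RHS]mul1r -(ord_signK q p); ring.
Qed.

Lemma cre_config_neq0 q f k : cre q f k != 0 -> exists2 k', k = inc k' q & f k' != 0.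
Proof.
have [k0|[k' ->]] := config_case k q; first by rewrite /cre amp0// mul0r eqxx.
rewrite /cre incK => h; exists k' => //; apply: contraNneq h => ->.
by rewrite mulr0.
Qed.

Lemma ann_config_neq0 q f k : ann q f k != 0 -> f (inc k q) != 0.
Proof. by apply: contraNneq => h; rewrite /ann h mulr0. Qed.

(* Meaningful only on functions of finite support: otherwise the sum may have
   the junk value 0. *)
Definition form f g : C := \sum_(k \in [set: config]) f k * (g k)^*.

Definition fin_supp f := finite_set [set k | f k != 0]%classic.

Lemma fin_suppZD a f g : fin_supp f -> fin_supp g -> fin_supp (a *: f + g).
Proof.
move=> hf hg; apply: (@sub_finite_set _ _ ([set k | f k != 0%R] `|` [set k | g k != 0%R])%classic).
  move=> k /=; rewrite addfE scalefE.
  have [->|_] := eqVneq (f k) 0; last by left.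
  by rewrite mulr0 add0r; right.
by rewrite finite_setU.
Qed.

Lemma fin_supp0 : fin_supp 0.
Proof.
rewrite /fin_supp (_ : [set k | _]%classic = set0) ?finite_set0//.
by apply/seteqP; split => k //=; rewrite eqxx.
Qed.

Lemma fin_supp_cre q f : fin_supp f -> fin_supp (cre q f).
Proof.
move=> hf; apply: sub_finite_set (finite_image (fun k => inc k q) hf).
by move=> k /= /cre_config_neq0[k' -> h]; exists k'.
Qed.

Lemma fin_supp_ann q f : fin_supp f -> fin_supp (ann q f).
Proof.
move=> hf; apply: sub_finite_set (finite_image (fun k => dec k q) hf).
by move=> k /= /ann_config_neq0 h; exists (inc k q); rewrite ?incK.
Qed.

Lemma form_cre q f g : fin_supp f -> form (cre q f) g = form f (ann q g).
Proof.
move=> hf; rewrite /form /cre /ann.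
pose A := [set k | exists k', k = inc k' q]%classic.
rewrite -(fsbig_widen A) //; last first.
  move=> k /= [_ nk]; have [k0|h] := config_case k q; last by case: nk.
  by rewrite amp0// !mul0r.
rewrite (reindex_fsbig (fun k => inc k q) setT A); last first.
  split=> [k _|k k' _ _ /(congr1 (fun k => dec k q))|k /= [k' ->]].
  - by exists k.
  - by rewrite !incK.
  - by exists k'.
by apply: eq_fsbigr => k _; rewrite incK rmorphM /= amp_conj; ring.
Qed.

Lemma form_seq (s : seq config) f g : uniq s -> (forall k, f k != 0 -> k \in s) ->
  form f g = \sum_(k <- s) f k * (g k)^*.
Proof.
move=> us hs; rewrite /form (fsbigE s)//; last first.
  by move=> k _ ks; have [->|/hs] := eqVneq (f k) 0; [rewrite mul0r|rewrite (negPf ks)].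
by apply: eq_bigl => k; rewrite mem_set.
Qed.

Lemma fin_supp_seq f g : fin_supp f -> fin_supp g -> exists s : seq config,
  [/\ uniq s, forall k, f k != 0 -> k \in s & forall k, g k != 0 -> k \in s].
Proof.
move=> hf hg; have hfg : finite_set ([set k | f k != 0%R] `|` [set k | g k != 0%R])%classic.
  by rewrite finite_setU.
exists (fset_set ([set k | f k != 0%R] `|` [set k | g k != 0%R])%classic).
by split=> [|k h|k h]; rewrite ?fset_uniq// in_fset_set// inE; [left|right].
Qed.

Lemma form_linearl a f f' g : fin_supp f -> fin_supp f' ->
  form (a *: f + f') g = a * form f g + form f' g.
Proof.
move=> hf hf'; have [s [us s1 s2]] := fin_supp_seq hf hf'.
rewrite !(form_seq _ us)// => [|k].
  rewrite mulr_sumr -big_split; apply: eq_bigr => k _ /=.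
  by rewrite addfE scalefE mulrDl mulrA.
rewrite addfE scalefE; have [->|/s1//] := eqVneq (f k) 0.
by rewrite mulr0 add0r => /s2.
Qed.

Lemma formC f g : fin_supp f -> fin_supp g -> form g f = (form f g)^*.
Proof.
move=> hf hg; have [s [us s1 s2]] := fin_supp_seq hf hg.
rewrite !(form_seq _ us)// rmorph_sum; apply: eq_bigr => k _ /=.
by rewrite rmorphM /= conjCK mulrC.
Qed.

Lemma form_linearr a f g g' : fin_supp f -> fin_supp g -> fin_supp g' ->
  form f (a *: g + g') = a^* * form f g + form f g'.
Proof.
move=> hf hg hg'; rewrite formC//; last exact: fin_suppZD.
by rewrite form_linearl// rmorphD rmorphM /= -!formC.
Qed.

Lemma form_ann q f g : fin_supp f -> fin_supp g -> form (ann q f) g = form f (cre q g).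
Proof.
move=> hf hg; rewrite (formC hg (fin_supp_ann q hf)) -form_cre// -formC//.
exact: fin_supp_cre.
Qed.

Lemma form_eq0 f : fin_supp f -> form f f = 0 -> f = 0.
Proof.
move=> hf; have [s [us s1 _]] := fin_supp_seq hf hf.
rewrite (form_seq _ us s1) => /eqP; rewrite psumr_eq0 => [|k _]; last exact: mul_conjC_ge0.
move=> /allP h; apply/funext => k; apply/eqP; apply: contraT => k0.
by have := h k (s1 k k0); rewrite mul_conjC_eq0 (negPf k0).
Qed.

End Oscillators.

(** * Commuting actions of the superalgebra and of gl_n *)

Section FockModule.
Variables (C : numClosedFieldType) (n : nat).

Definition mode : countType := ('I_n * int)%type.
Definition fermionic (q : mode) : bool := ~~ oddz q.2.
Notation H := (fock C mode).
Notation cre := (cre (C := C) fermionic).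
Notation ann := (ann (C := C) fermionic).
Notation exch := (exch C fermionic).
Implicit Types (p q : mode) (f g : H) (i j : 'I_n) (r s t u : int).

(* a^*_q and a_q : with respect to the vacuum, the modes of index r > 0 are   *)
(* created by a^* and those of index r <= 0 by a.                             *)
Definition st q f : H :=
  if 0 < q.2 then cre q f else (-1) ^+ oddz q.2 *: ann q f.
Definition de q f : H := if 0 < q.2 then ann q f else cre q f.

Fact st_is_linear q : linear (st q).
Proof.
move=> a f g; rewrite /st; case: ifP => _; rewrite linearP//=.
by rewrite scalerDr !scalerA mulrC.
Qed.
HB.instance Definition _ q := GRing.isLinear.Build C H H _ (st q) (st_is_linear q).
Fact de_is_linear q : linear (de q).
Proof. by move=> a f g; rewrite /de; case: ifP => _; rewrite linearP. Qed.
HB.instance Definition _ q := GRing.isLinear.Build C H H _ (de q) (de_is_linear q).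

Lemma st_st p q f : st p (st q f) = exch p q *: st q (st p f).
Proof.
rewrite /st; case: ifP => hp; case: ifP => hq; rewrite ?linearZ /=.
- exact: cre_cre.
- rewrite ann_cre; case: eqVneq => [e|_]; first by move: hp hq; rewrite e => ->.
  rewrite scale0r addr0 !scalerA; congr (_ *: _).
  by rewrite -[LHS]mul1r -(exchK _ fermionic p q) (exchC _ _ q p); ring.
- rewrite ann_cre; case: eqVneq => [e|_]; first by move: hp hq; rewrite e => ->.
  by rewrite scale0r addr0 !scalerA mulrC.
- by rewrite ann_ann !scalerA; congr (_ *: _); ring.
Qed.

Lemma de_de p q f : de p (de q f) = exch p q *: de q (de p f).
Proof.
rewrite /de; case: ifP => hp; case: ifP => hq.
- exact: ann_ann.
- rewrite ann_cre; case: eqVneq => [e|_]; first by move: hp hq; rewrite e => ->.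
  by rewrite scale0r addr0.
- rewrite ann_cre; case: eqVneq => [e|_]; first by move: hp hq; rewrite e => ->.
  by rewrite scale0r addr0 scalerA exchC exchK scale1r.
- exact: cre_cre.
Qed.

Lemma exch_diag q : exch q q = - (-1) ^+ oddz q.2.
Proof.
by rewrite /Submission.exch /fermionic andbb; case: oddz; rewrite /= ?expr0 ?expr1 ?opprK.
Qed.

(** For nonpositive indices [cre] and [ann] exchange roles, which costs the factor [- exch q q]; the
    sign put into [st] compensates it, so the constant is 1 on both sides of zero. *)
Lemma de_st p q f : de p (st q f) = exch p q *: st q (de p f) + (p == q)%:R *: f.
Proof.
rewrite /de /st; case: ifP => hp; case: ifP => hq; rewrite ?linearZ /=.
- exact: ann_cre.
- rewrite ann_ann; case: eqVneq => [e|_]; first by move: hp hq; rewrite e => ->.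
  by rewrite scale0r addr0 !scalerA mulrC.
- rewrite cre_cre; case: eqVneq => [e|_]; first by move: hp hq; rewrite e => ->.
  by rewrite scale0r addr0.
rewrite ann_cre scalerDr scalerDr !scalerA.
have -> : (-1) ^+ oddz q.2 * exch p q * exch q p = (-1) ^+ oddz q.2.
  by rewrite -[RHS]mul1r -(exchK _ fermionic p q) (exchC _ _ q p); ring.
rewrite -addrA -scalerDl -[LHS]addr0; congr (_ + _).
have [->|pq] := eqVneq p q; last by rewrite mulr0 addr0 scale0r.
rewrite mulr1 exch_diag mulrN -expr2 sqrr_sign addNr scale0r//.
Qed.

Lemma exch_mode i j r s : exch (i, r) (j, s) = (-1) ^+ (~~ oddz r && ~~ oddz s).
Proof. by []. Qed.

Lemma exch_modeK i i' j j' r s : exch (i, r) (j, s) * exch (i', r) (j', s) = 1.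
Proof. by rewrite !exch_mode -expr2 sqrr_sign. Qed.

(* Not normally ordered, hence the correction in fE. *)
Definition bil r s f : H := \sum_(i < n) st (i, r) (de (i, s) f).
Fact bil_is_linear r s : linear (bil r s).
Proof.
move=> a f g; rewrite /bil scaler_sumr -big_split; apply: eq_bigr => i _.
by rewrite !linearP.
Qed.
HB.instance Definition _ r s := GRing.isLinear.Build C H H _ (bil r s) (bil_is_linear r s).

Lemma bil_st r s k t f : bil r s (st (k, t) f) =
  (-1) ^+ (par r s && ~~ oddz t) *: st (k, t) (bil r s f) + (s == t)%:R *: st (k, r) f.
Proof.
rewrite linear_sum scaler_sumr /=.
have -> : (s == t)%:R *: st (k, r) f =
    \sum_(i < n) ((i, s) == (k, t))%:R *: st (i, r) f.
  rewrite (bigD1 k) //= xpair_eqE eqxx big1 ?addr0// => i /negPf ik.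
  by rewrite xpair_eqE ik scale0r.
rewrite -big_split; apply: eq_bigr => i _ /=.
rewrite de_st linearP /= st_st scalerA !linearZ /=; congr (_ *: _ + _).
by rewrite !exch_mode -signr_addb /par oddzD; case: oddz; case: oddz; case: oddz.
Qed.

Lemma bil_de r s k t f : bil r s (de (k, t) f) =
  (-1) ^+ (par r s && ~~ oddz t) *: (de (k, t) (bil r s f) - (r == t)%:R *: de (k, s) f).
Proof.
rewrite linear_sum /=.
have -> : (r == t)%:R *: de (k, s) f =
    \sum_(i < n) ((k, t) == (i, r))%:R *: de (i, s) f.
  rewrite (bigD1 k) //= xpair_eqE eqxx eq_sym big1 ?addr0// => i ik.
  by rewrite xpair_eqE eq_sym (negPf ik) scale0r.
rewrite -sumrB scaler_sumr; apply: eq_bigr => i _ /=.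
rewrite de_st addrK de_de !linearZ /= scalerA; congr (_ *: _).
by rewrite !exch_mode -signr_addb /par oddzD; case: oddz; case: oddz; case: oddz.
Qed.

Lemma par_sign r s t u :
  (-1) ^+ (par r s && ~~ oddz t) * (-1) ^+ (par r s && ~~ oddz u)
  = (-1) ^+ (par r s && par t u) :> C.
Proof.
rewrite -signr_addb /par !oddzD.
by case: oddz; case: oddz; case: oddz; case: oddz.
Qed.

Lemma bil_bil r s t u f : bil r s (bil t u f) =
  (-1) ^+ (par r s && par t u) *: bil t u (bil r s f)
  + (s == t)%:R *: bil r u f
  - ((-1) ^+ (par r s && par t u) * (u == r)%:R) *: bil t s f.
Proof.
rewrite [bil r u f]/bil [bil t s f]/bil [bil t u f]/bil [bil t u (bil r s f)]/bil.
rewrite linear_sum /= !scaler_sumr -big_split -sumrB /=.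
apply: eq_bigr => i _.
rewrite bil_st bil_de [st _ (_ *: _)]linearZ /= linearB /= [st _ (_ *: _)]linearZ /=.
by rewrite scalerA par_sign scalerBr scalerA addrAC (eq_sym r).
Qed.

(** The eigenvalue of [bil r r] on the vacuum. Its removal makes [fE r r] kill the vacuum, and the
    differences of these constants in a commutator are the central term. *)
Definition order_const r s : C := ((r == s) && (r <= 0)%R)%:R * (n%:R * (-1) ^+ oddz r).

Definition fE r s f : H := bil r s f - order_const r s *: f.
Fact fE_is_linear r s : linear (fE r s).
Proof.
move=> a f g; rewrite /fE linearP /= scalerDr opprD addrACA scalerBr !scalerA.
by rewrite [a * _]mulrC.
Qed.
HB.instance Definition _ r s := GRing.isLinear.Build C H H _ (fE r s) (fE_is_linear r s).

Lemma par_diag r : par r r = false.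
Proof. by rewrite /par oddzD addbb. Qed.

Lemma fE_rel : gl_rel (fun r s => fE r s) n.
Proof.
move=> r s t u f; rewrite -![GRing.Linear.sort _ _]/(fE _ _ _).
have e1 : (-1) ^+ (par r s && par t u) * order_const r s = order_const r s.
  rewrite /order_const; have [->|_] := eqVneq r s; last by rewrite !mul0r mulr0.
  by rewrite par_diag mul1r.
have e2 : (-1) ^+ (par r s && par t u) * order_const t u = order_const t u.
  rewrite /order_const; have [->|_] := eqVneq t u; last by rewrite !mul0r mulr0.
  by rewrite par_diag andbF mul1r.
have e3 : central_coef C n r s t u = (s == t)%:R * order_const r u
    - (-1) ^+ (par r s && par t u) * (u == r)%:R * order_const t s.
  rewrite /central_coef /order_const; have [->|st] := eqVneq s t; last first.
    by rewrite /= !(mul0r, mulr0) subrr.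
  have [->|ur] := eqVneq u r; last by rewrite /= !(mul0r, mulr0) subrr.
  rewrite /= !mul1r /par !oddzD.
  by case: (oddz r); case: (oddz t); rewrite /= ?expr0 ?expr1; ring.
have eF r' s' (g : H) k : fE r' s' g k = bil r' s' g k - order_const r' s' * g k by [].
have eB r' s' a (g h : H) k : bil r' s' (g - a *: h) k = bil r' s' g k - a * bil r' s' h k.
  by rewrite linearB /= [bil _ _ (_ *: _)]linearZ.
apply/funext => k; rewrite ?(addfE, oppfE, scalefE) !eF {1 2}/fE !eB bil_bil.
rewrite !(addfE, oppfE, scalefE) e3.
set ep := (-1) ^+ _ in e1 e2 *; apply/eqP; rewrite -subr_eq0; apply/eqP.
transitivity ((ep * order_const t u - order_const t u) * bil r s f k
  + (ep * order_const r s - order_const r s) * (bil t u f k - order_const t u * f k)).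
  by ring.
by rewrite e1 e2 !subrr !mul0r addr0.
Qed.

Lemma bil_neq r s f : r != s -> fE r s f = bil r s f.
Proof. by move=> /negPf rs; rewrite /fE /order_const rs mul0r scale0r subr0. Qed.

(** The generator E_ij of gl_n truncated to the columns in [l]: over all columns the sum would be
    infinite and, for i = j, would need normal ordering. *)
Definition row_op (l : seq int) i j f : H := \sum_(t <- l) st (i, t) (de (j, t) f).
Fact row_op_is_linear l i j : linear (row_op l i j).
Proof.
move=> a f g; rewrite /row_op scaler_sumr -big_split; apply: eq_bigr => t _.
by rewrite !linearP.
Qed.
HB.instance Definition _ l i j := GRing.isLinear.Build C H H _ (row_op l i j) (row_op_is_linear l i j).

Lemma row_op_st l i j k t f : uniq l -> t \in l ->
  row_op l i j (st (k, t) f) = st (k, t) (row_op l i j f) + (j == k)%:R *: st (i, t) f.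
Proof.
move=> ul tl; rewrite linear_sum /=.
have -> : (j == k)%:R *: st (i, t) f = \sum_(t' <- l) ((j, t') == (k, t))%:R *: st (i, t') f.
  rewrite (bigD1_seq t) //= xpair_eqE eqxx andbT big1 ?addr0// => t' /negPf tt.
  by rewrite xpair_eqE tt andbF scale0r.
rewrite -big_split; apply: eq_bigr => t' _ /=.
by rewrite de_st linearP /= st_st scalerA exch_modeK scale1r linearZ.
Qed.

Lemma row_op_de l i j k t f : uniq l -> t \in l ->
  row_op l i j (de (k, t) f) = de (k, t) (row_op l i j f) - (i == k)%:R *: de (j, t) f.
Proof.
move=> ul tl; rewrite linear_sum /=.
have -> : (i == k)%:R *: de (j, t) f = \sum_(t' <- l) ((k, t) == (i, t'))%:R *: de (j, t') f.
  rewrite (bigD1_seq t) //= xpair_eqE eqxx andbT eq_sym big1 ?addr0// => t' tt.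
  by rewrite xpair_eqE (eq_sym t) (negPf tt) andbF scale0r.
rewrite -sumrB; apply: eq_bigr => t' _ /=.
rewrite de_st addrK [de (j, _) _]de_de [st _ (_ *: _)]linearZ /=.
by rewrite exchC.
Qed.

(** The commutators with [st] and with [de] contribute [st (i, r) (de (j, s) f)] with opposite
    signs, provided that both columns are in the list. *)
Lemma row_op_bil l i j r s f : uniq l -> r \in l -> s \in l ->
  row_op l i j (bil r s f) = bil r s (row_op l i j f).
Proof.
move=> ul rl sl; rewrite [bil r s f]/bil linear_sum /=.
under eq_bigr => k _ do rewrite row_op_st// row_op_de// linearB /= [st _ (_ *: _)]linearZ /=.
rewrite !big_split /= sumrN -[RHS]addr0 -addrA; congr (_ + _).
rewrite (bigD1 i) //= eqxx scale1r big1 => [|k /negPf ki]; last by rewrite eq_sym ki scale0r.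
rewrite addr0 (bigD1 j) //= eqxx scale1r big1 => [|k /negPf kj]; last by rewrite eq_sym kj scale0r.
by rewrite addr0 addNr.
Qed.

Lemma row_op_fE l i j r s f : uniq l -> r \in l -> s \in l ->
  row_op l i j (fE r s f) = fE r s (row_op l i j f).
Proof. by move=> ul rl sl; rewrite /fE linearB /= row_op_bil// [row_op _ _ _ (_ *: _)]linearZ. Qed.

End FockModule.

(** * Windows, contents, charges and the contravariant form *)

Fixpoint win (Q : nat) : seq int :=
  if Q is Q'.+1 then Q%:Z :: - Q%:Z :: win Q' else [:: 0].

Lemma mem_win Q (r : int) : (r \in win Q) = (`|r| <= Q)%N.
Proof. by elim: Q => [|Q IH]; rewrite /= !inE ?IH; lia. Qed.

Lemma win_uniq Q : uniq (win Q).
Proof.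
elim: Q => //= Q ->; rewrite inE !mem_win andbT; apply/andP; split; last by lia.
by rewrite negb_or; lia.
Qed.

Section FockWeights.
Variables (C : numClosedFieldType) (n : nat).
Notation mode := (mode n).
Notation H := (fock C mode).
Notation fermionic := (@fermionic n).
Notation cre := (cre (C := C) fermionic).
Notation ann := (ann (C := C) fermionic).
Notation amp := (amp C fermionic).
Notation fE := (@fE C n).
Implicit Types (p q : mode) (f g : H) (i j : 'I_n) (r s t u : int) (k : config mode).

Definition content k r : nat := \sum_(i < n) k (i, r).
(** The exclusion principle, needed as a condition because [amp] sees a fermionic occupation number
    only through its parity. *)
Definition good k := forall i r, ~~ oddz r -> (k (i, r) <= 1)%N.
Definition wvec (m : int -> nat) f :=
  forall k, f k != 0 -> (forall r, content k r = m r) /\ good k.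

Definition mi (m : int -> nat) r : int -> nat := fun t => (m t + (t == r))%N.
Definition md (m : int -> nat) r : int -> nat := fun t => (m t - (t == r))%N.

Lemma content_inc k q r : content (inc k q) r = (content k r + (r == q.2))%N.
Proof.
rewrite /content; under eq_bigr => i _ do rewrite /inc.
rewrite big_split /=; congr addn; case: q => j s /=.
rewrite (bigD1 j) //= xpair_eqE eqxx big1 ?addn0// => i /negPf ij.
by rewrite xpair_eqE ij.
Qed.

Lemma wvec0 m : wvec m 0.
Proof. by move=> k; rewrite eqxx. Qed.

Lemma wvecP m a f g : wvec m f -> wvec m g -> wvec m (a *: f + g).
Proof.
move=> hf hg k; rewrite addfE scalefE; have [->|/hf//] := eqVneq (f k) 0.
by rewrite mulr0 add0r; exact: hg.
Qed.

Lemma wvecZ m a f : wvec m f -> wvec m (a *: f).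
Proof. by move=> h; rewrite -[_ *: _]addr0; apply: wvecP => //; exact: wvec0. Qed.

Lemma wvec_sum m (I : Type) (l : seq I) (F : I -> H) :
  (forall x, wvec m (F x)) -> wvec m (\sum_(x <- l) F x).
Proof.
move=> h; elim/big_rec: _ => [|x f _ hf]; first exact: wvec0.
by rewrite -[F x]scale1r; exact: wvecP.
Qed.

Lemma wvec_cre m q f : wvec m f -> wvec (mi m q.2) (cre q f).
Proof.
move=> hf k h; have [k' ek fk'] := cre_config_neq0 h.
have [c g] := hf k' fk'; split=> [r|i r er]; first by rewrite ek content_inc c.
have := g i r er; rewrite ek /inc; have [e|_] := eqVneq (i, r) q; last by rewrite addn0.
move: h; rewrite /cre ek /amp /fermionic -e er inc_same.
by case: (k' (i, r)) => [|[|//]]; rewrite // !mul0r eqxx.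
Qed.

Lemma wvec_ann m q f : wvec m f -> wvec (md m q.2) (ann q f).
Proof.
move=> hf k /ann_config_neq0 /hf [c g]; split=> [r|i r er].
  by rewrite /md -c content_inc addnK.
by have := g i r er; apply: leq_trans; rewrite /inc leq_addr.
Qed.

Definition m_st (m : int -> nat) r := if 0 < r then mi m r else md m r.
Definition m_de (m : int -> nat) r := if 0 < r then md m r else mi m r.

Lemma wvec_st m q f : wvec m f -> wvec (m_st m q.2) (st q f).
Proof.
rewrite /m_st /st; case: ifP => _ hf; first exact: wvec_cre.
by apply/wvecZ/wvec_ann.
Qed.

Lemma wvec_de m q f : wvec m f -> wvec (m_de m q.2) (de q f).
Proof. by rewrite /m_de /de; case: ifP => _ hf; [exact: wvec_ann|exact: wvec_cre]. Qed.

Definition m_act r s (m : int -> nat) := m_st (m_de m s) r.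

Lemma wvec_bil m r s f : wvec m f -> wvec (m_act r s m) (bil r s f).
Proof. by move=> hf; apply: wvec_sum => i; apply: (wvec_st (q := (i, r))); exact: (wvec_de (q := (i, s))). Qed.

Lemma fin_supp_sum (I : Type) (l : seq I) (F : I -> H) :
  (forall x, fin_supp (F x)) -> fin_supp (\sum_(x <- l) F x).
Proof.
move=> h; elim/big_rec: _ => [|x f _ hf]; first exact: fin_supp0.
by rewrite -[F x]scale1r; exact: fin_suppZD.
Qed.

Lemma fin_suppZ a f : fin_supp f -> fin_supp (a *: f).
Proof. by move=> h; rewrite -[_ *: _]addr0; apply: fin_suppZD => //; exact: fin_supp0. Qed.

Lemma fin_supp_st q f : fin_supp f -> fin_supp (st q f).
Proof.
by rewrite /st; case: ifP => _ hf; [exact: fin_supp_cre|apply/fin_suppZ/fin_supp_ann].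
Qed.

Lemma fin_supp_de q f : fin_supp f -> fin_supp (de q f).
Proof. by rewrite /de; case: ifP => _ hf; [exact: fin_supp_ann|exact: fin_supp_cre]. Qed.

Lemma fin_supp_fE r s f : fin_supp f -> fin_supp (fE r s f).
Proof.
move=> hf; rewrite /Submission.fE addrC -scaleNr; apply: fin_suppZD => //.
by apply: fin_supp_sum => i; apply/fin_supp_st/fin_supp_de.
Qed.

Lemma cre_ann_diag q f k : cre q (ann q f) k = amp q k * amp q k * f k.
Proof.
rewrite /cre /ann; have [k0|[k' ->]] := config_case k q; first by rewrite amp0// !mul0r.
by rewrite incK mulrA.
Qed.

Lemma ann_cre_diag q f k : ann q (cre q f) k = amp q (inc k q) * amp q (inc k q) * f k.
Proof. by rewrite /cre /ann incK mulrA. Qed.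

Lemma amp_sq q k : good k -> amp q k * amp q k = (k q)%:R.
Proof.
move=> g; rewrite /Submission.amp; case: ifP => hq; last by rewrite -expr2 sqrtCK.
have e : (-1) ^+ jw fermionic q k * (-1) ^+ jw fermionic q k = 1 :> C.
  by rewrite -expr2 sqrr_sign.
have : (k q <= 1)%N by case: q hq {e} => i r; exact: g.
by case: (k q) => [|[|//]] _; rewrite /= ?mul0r ?mul1r ?e.
Qed.

Lemma amp_inc_sq q k : good k ->
  amp q (inc k q) * amp q (inc k q) = 1 - (-1) ^+ oddz q.2 * (k q)%:R.
Proof.
move=> g; have := amp_sqr C fermionic q k; rewrite (amp_sq q g) exch_diag => e.
by rewrite -[LHS](subrK (- (-1) ^+ oddz q.2 * (k q)%:R)) e mulNr.
Qed.

Definition sg r : C := if 0 < r then 1 else -1.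

Lemma st_de_diag q f k : good k -> st q (de q f) k =
  (sg q.2 * (k q)%:R + (q.2 <= 0)%R%:R * (-1) ^+ oddz q.2) * f k.
Proof.
move=> g; rewrite /st /de /sg; case: ltP => hq.
  by rewrite cre_ann_diag amp_sq// mul1r mul0r addr0.
rewrite scalefE ann_cre_diag amp_inc_sq// mul1r.
have e : (-1) ^+ oddz q.2 * (-1) ^+ oddz q.2 = 1 :> C by rewrite -expr2 sqrr_sign.
rewrite mulrA mulrBr mulr1 [_ * (_ * _)]mulrA e mulN1r mul1r addrC//.
Qed.

Definition oc r : C := (r <= 0)%R%:R * (-1) ^+ oddz r.

Lemma sum_diag (I : Type) (l : seq I) (F : I -> H) k (c : I -> C) f :
  (forall x, F x k = c x * f k) -> (\sum_(x <- l) F x) k = (\sum_(x <- l) c x) * f k.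
Proof.
move=> h; elim: l => [|x l IH]; first by rewrite !big_nil mul0r.
by rewrite !big_cons addfE h IH mulrDl.
Qed.

Lemma wvec_weight m f r : wvec m f -> fE r r f = (sg r * (m r)%:R) *: f.
Proof.
move=> hf; apply/funext => k; rewrite scalefE /Submission.fE addfE oppfE scalefE /bil.
have [fk|/hf [c g]] := eqVneq (f k) 0.
  rewrite (_ : (\sum_(i < n) _) k = 0) ?fk ?mulr0 ?subrr//.
  elim/big_rec: _ => // i x _ e; rewrite addfE e addr0.
  rewrite /st /de /=; case: ltP => _; first by rewrite cre_ann_diag fk mulr0.
  by rewrite scalefE ann_cre_diag fk !mulr0.
rewrite (sum_diag _ (c := fun i => sg r * (k (i, r))%:R + oc r) (f := f)); last first.
  by move=> i; exact: st_de_diag.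
rewrite -mulrBl; congr (_ * _); rewrite big_split /= -mulr_sumr -natr_sum -/(content k r) c.
rewrite sumr_const card_ord /order_const eqxx /oc -mulr_natl; ring.
Qed.

Definition charge (l : seq int) i k : int :=
  \sum_(r <- l) (if 0 < r then (k (i, r))%:Z else - (k (i, r))%:Z).

Definition ocs (l : seq int) : C := \sum_(r <- l) oc r.

Lemma row_op_diag l i f k : good k ->
  row_op l i i f k = ((charge l i k)%:~R + ocs l) * f k.
Proof.
move=> g; rewrite /row_op (sum_diag _ (c := fun r => sg r * (k (i, r))%:R + oc r) (f := f)); last first.
  by move=> r; exact: st_de_diag.
congr (_ * _); rewrite big_split /=; congr (_ + _).
rewrite /charge rmorph_sum; apply: eq_bigr => r _.
by rewrite /sg; case: ifP => _ /=; rewrite ?mul1r// mulN1r rmorphN.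
Qed.

(** Singularity for gl_n, tested in all large windows: [fE r s] commutes with a row operator only
    when its window contains [r] and [s], and this form makes the condition stable under every
    [fE r s]. The constant [ocs] undoes the missing normal ordering. *)
Definition hwm (lam : 'I_n -> int) f := exists Q0 : nat, forall Q : nat, (Q0 <= Q)%N ->
  (forall i j, (i < j)%N -> row_op (win Q) i j f = 0) /\
  (forall i, row_op (win Q) i i f = ((lam i)%:~R + ocs (win Q)) *: f).

Lemma hwm_fE lam r s f : hwm lam f -> hwm lam (fE r s f).
Proof.
move=> [Q0 h]; exists (Q0 + `|r| + `|s|)%N => Q hQ.
have [] := h Q; first by lia.
move=> h1 h2; split=> [i j ij|i]; rewrite row_op_fE ?win_uniq ?mem_win//; try by lia.
  by rewrite h1// linear0.
by rewrite h2 linearZ.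
Qed.

Lemma hwmP lam a f g : hwm lam f -> hwm lam g -> hwm lam (a *: f + g).
Proof.
move=> [Q0 h] [Q1 h']; exists (Q0 + Q1)%N => Q hQ.
have [h1 h2] := h Q (leq_trans (leq_addr _ _) hQ).
have [h1' h2'] := h' Q (leq_trans (leq_addl _ _) hQ).
split=> [i j ij|i]; first by rewrite linearP /= h1// h1'// scaler0 addr0.
by rewrite linearP /= h2 h2' [RHS]scalerDr !scalerA [a * _]mulrC.
Qed.

Lemma wvec_charge lam f Q k : (forall i, row_op (win Q) i i f = ((lam i)%:~R + ocs (win Q)) *: f) ->
  f k != 0 -> good k -> forall i, charge (win Q) i k = lam i.
Proof.
move=> h fk g i; have := congr1 (fun x : H => x k) (h i).
rewrite row_op_diag// scalefE => /(mulIf fk) /addIr /eqP.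
by rewrite eqr_int => /eqP.
Qed.

(** The sign up to which [st] and [de] are adjoint, equal to -1 at bosonic modes of nonpositive
    index. Hence [fE r s] and [fE s r] are adjoint up to a sign, which is harmless for
    orthogonality, while the form itself stays definite. *)
Definition nu r : C := if 0 < r then 1 else (-1) ^+ oddz r.

Lemma nuK r : nu r * nu r = 1.
Proof. by rewrite /nu; case: ifP => _; rewrite ?mulr1// -expr2 sqrr_sign. Qed.

Lemma formZl a f g : fin_supp f -> form (a *: f) g = a * form f g.
Proof.
move=> hf; have := form_linearl a g hf (fin_supp0 _ _); rewrite addr0 => ->.
by rewrite /form [X in _ + X]fsbig1 ?addr0// => k _; rewrite mul0r.
Qed.

Lemma nu_conj r : (nu r)^* = nu r.
Proof. by rewrite /nu; case: ifP => _; rewrite ?rmorph1// rmorphXn rmorphN rmorph1. Qed.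

Lemma formZr a f g : fin_supp f -> fin_supp g -> form f (a *: g) = a^* * form f g.
Proof. by move=> hf hg; rewrite formC ?formZl// ?rmorphM /= -?formC//; exact: fin_suppZ. Qed.

Lemma form_st q f g : fin_supp f -> fin_supp g -> form (st q f) g = nu q.2 * form f (de q g).
Proof.
move=> hf hg; rewrite /st /de /nu; case: ifP => _; first by rewrite mul1r form_cre.
by rewrite formZl ?form_ann//; exact: fin_supp_ann.
Qed.

Lemma form_de q f g : fin_supp f -> fin_supp g -> form (de q f) g = nu q.2 * form f (st q g).
Proof.
move=> hf hg; rewrite (formC (fin_supp_st q hg) hf) form_st//.
by rewrite rmorphM /= nu_conj mulrA nuK mul1r -formC//; exact: fin_supp_de.
Qed.

Lemma form_suml (I : Type) (l : seq I) (F : I -> H) g : (forall x, fin_supp (F x)) ->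
  form (\sum_(x <- l) F x) g = \sum_(x <- l) form (F x) g.
Proof.
move=> hF; elim: l => [|x l IH].
  by rewrite !big_nil /form fsbig1// => k _; rewrite mul0r.
rewrite !big_cons -IH -[F x in LHS]scale1r form_linearl ?mul1r//.
exact: fin_supp_sum.
Qed.

Lemma form_bil r s f g : fin_supp f -> fin_supp g ->
  form (bil r s f) g = nu r * nu s * form f (bil s r g).
Proof.
move=> hf hg.
have h1 q p (f' : H) : fin_supp f' -> fin_supp (st q (de p f')).
  by move=> h; exact/fin_supp_st/fin_supp_de.
rewrite form_suml => [|i]; last exact: h1.
rewrite (formC _ hf); last by apply: fin_supp_sum => i; exact: h1.
rewrite form_suml => [|i]; last exact: h1.
rewrite rmorph_sum mulr_sumr; apply: eq_bigr => i _ /=.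
rewrite -formC//; last exact: h1.
rewrite form_st//; last exact: fin_supp_de.
by rewrite form_de// ?mulrA//; exact: fin_supp_de.
Qed.

Lemma fin_supp_bil r s f : fin_supp f -> fin_supp (bil r s f).
Proof. by move=> hf; apply: fin_supp_sum => i; apply/fin_supp_st/fin_supp_de. Qed.

Lemma form_fE r s f g : fin_supp f -> fin_supp g ->
  form (fE r s f) g = nu r * nu s * form f (fE s r g).
Proof.
move=> hf hg; have [<-|rs] := eqVneq r s; last by rewrite !bil_neq// 1?eq_sym// form_bil.
rewrite /Submission.fE nuK mul1r addrC -scaleNr form_linearl//; last exact: fin_supp_bil.
rewrite [in RHS]addrC -scaleNr form_linearr//; last exact: fin_supp_bil.
rewrite form_bil// nuK mul1r; congr (_ * _ + _).
by rewrite rmorphN /order_const !rmorphM /= !conjC_nat rmorphXn rmorphN rmorph1.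
Qed.

End FockWeights.

(** * Removal of the bosons *)

Section FockGeneration.
Variables (C : numClosedFieldType) (n : nat).
Notation mode := (mode n).
Notation H := (fock C mode).
Notation fermionic := (@fermionic n).
Notation cre := (cre (C := C) fermionic).
Notation ann := (ann (C := C) fermionic).
Notation amp := (amp C fermionic).
Notation fE := (@fE C n).
Notation gen := (gen (fun r s => fE r s)).
Implicit Types (p q : mode) (f g : H) (i j : 'I_n) (r s t u : int) (k : config mode).

Lemma ann_empty m q f : wvec m f -> m q.2 = 0%N -> ann q f = 0.
Proof.
move=> hf m0; apply/funext => k; apply/eqP; apply: contraT => /ann_config_neq0/hf[c _].
by have := c q.2; rewrite content_inc eqxx m0 addn1.
Qed.

Lemma bil_empty m r s f : wvec m f -> r != s ->
  (0 < s) && (m s == 0%N) || (r <= 0) && (m r == 0%N) -> bil r s f = 0.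
Proof.
move=> hf rs h; rewrite /bil big1// => i _; case/orP: h => /andP[h /eqP m0].
  by rewrite /de /= h (ann_empty hf)// linear0.
rewrite /st /= ltNge h /= (ann_empty (q := (i, r)) (wvec_de (q := (i, s)) hf)) ?scaler0//=.
by rewrite /m_de /md /mi; case: ifP => _; rewrite m0 (negPf rs).
Qed.

Lemma fE_empty m r s f : wvec m f -> r != s ->
  (0 < s) && (m s == 0%N) || (r <= 0) && (m r == 0%N) -> fE r s f = 0.
Proof. by move=> hf rs h; rewrite bil_neq// (bil_empty hf). Qed.

Lemma fE_wvec m r s f : wvec m f -> r != s -> wvec (m_act r s m) (fE r s f).
Proof. by move=> hf rs; rewrite bil_neq//; exact: wvec_bil. Qed.

Lemma neq0_config f : f != 0 -> exists k, f k != 0.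
Proof.
move=> f0; apply: contrapT => h; case/eqP: f0; apply/funext => k; apply/eqP.
by apply: contraT => fk; case: h; exists k.
Qed.

Definition transfer s r f : H := \sum_(i < n) cre (i, s) (ann (i, r) f).

(** In a configuration of the support, replace a boson at [(i, r)] by a fermion at [(i, s)]. Level
    [s] was empty, so at the new configuration only the colour [i] contributes and nothing
    cancels. *)
Lemma transfer_neq0 m s r f : wvec m f -> f != 0 -> oddz r -> ~~ oddz s ->
  (0 < m r)%N -> m s = 0%N -> transfer s r f != 0.
Proof.
move=> hf f0 ro se mr ms; have [k fk] := neq0_config f0; have [ck gk] := hf k fk.
have [i ki] : exists i, (0 < k (i, r))%N.
  apply: contrapT => h; move: mr; rewrite -ck /content big1// => i _.
  by apply/eqP; rewrite -leqn0 leqNgt; apply/negP => ki; apply: h; exists i.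
have ks j : k (j, s) = 0%N.
  by apply/eqP; rewrite -leqn0 -ms -ck /content (bigD1 j)//= leq_addr.
have rs : (i, r) != (i, s) by rewrite xpair_eqE eqxx /=; apply: contraTneq ro => ->.
pose k' := inc (dec k (i, r)) (i, s).
apply/eqP => /(congr1 (fun x : H => x k')); apply/eqP.
have k's j : j != i -> k' (j, s) = 0%N.
  by move=> ji; rewrite /k' inc_other ?xpair_eqE ?(negPf ji)// /dec ks.
rewrite /transfer (bigD1 i)//= addfE [X in _ + X](_ : _ = 0) ?addr0; last first.
  rewrite (_ : (\sum_(j < n | j != i) _) k' = \sum_(j < n | j != i) (cre (j, s) (ann (j, r) f) k')).
    by rewrite big1// => j ji; rewrite /Submission.cre amp0 ?mul0r// k's.
  by elim/big_rec2: _ => // j x y _ <-.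
rewrite /Submission.cre /Submission.ann /k' incK decK// !mulf_neq0//.
  rewrite /Submission.amp /Submission.fermionic /= se inc_same /dec ks /= mul1r.
  by rewrite expf_neq0// oppr_eq0 oner_neq0.
by rewrite /Submission.amp /Submission.fermionic /= ro /= sqrtC_eq0 pnatr_eq0 -lt0n.
Qed.

Lemma fE_transfer_pos s r f : 0 < s -> 0 < r -> r != s -> fE s r f = transfer s r f.
Proof.
move=> s0 r0 rs; rewrite bil_neq 1?eq_sym//; apply: eq_bigr => i _.
by rewrite /st /de /= s0 r0.
Qed.

Lemma fE_transfer_neg s r f : s <= 0 -> r <= 0 -> oddz r -> r != s ->
  fE r s f = - transfer s r f.
Proof.
move=> s0 r0 ro rs; rewrite bil_neq// -sumrN; apply: eq_bigr => i _.
rewrite /st /de /= !ltNge s0 r0 /= ann_cre xpair_eqE eqxx (negPf rs) scale0r addr0.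
by rewrite /exch /Submission.fermionic /= ro /= scale1r expr1 scaleN1r.
Qed.

Definition finw (W : nat) (m : int -> nat) := forall r, (W < `|r|)%N -> m r = 0%N.
Definition wsum (W : nat) (w m : int -> nat) : nat := (\sum_(t <- win W) w t * m t)%N.

Lemma wsum_mi W w m r : (`|r| <= W)%N -> wsum W w (mi m r) = (wsum W w m + w r)%N.
Proof.
move=> hr; rewrite /wsum /mi; under eq_bigr => t _ do rewrite mulnDr.
rewrite big_split /=; congr addn; rewrite (bigD1_seq r) ?mem_win ?win_uniq//=.
by rewrite eqxx muln1 big1 ?addn0// => t /negPf->; rewrite muln0.
Qed.

Lemma wsum_md W w m r : (`|r| <= W)%N -> (0 < m r)%N ->
  (wsum W w (md m r) + w r = wsum W w m)%N.
Proof.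
move=> hr mr; rewrite -wsum_mi//; apply: eq_bigr => t _; congr muln.
by rewrite /mi /md; case: eqP => [->|]; lia.
Qed.

Lemma wsum_widen W W' w m : finw W m -> (W <= W')%N -> wsum W' w m = wsum W w m.
Proof.
move=> hm /subnK <-; elim: (W' - W)%N => // d IH.
by rewrite addSn /wsum /= !big_cons -/(wsum _ _ _) IH !hm ?muln0//; lia.
Qed.

Lemma wvec_extm m m' f : m =1 m' -> wvec m f -> wvec m' f.
Proof. by move=> e hf k /hf [c g]; split=> // r; rewrite c e. Qed.

Lemma bosonless lam m f W : finw W m -> wvec m f -> fin_supp f -> f != 0 -> hwm lam f ->
  exists (m' : int -> nat) (g : H) (W' : nat),
    [/\ finw W' m', wvec m' g, fin_supp g /\ gen f g, g != 0
      & hwm lam g /\ forall r, oddz r -> m' r = 0%N].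
Proof.
pose w (r : int) : nat := oddz r.
have [N] := ubnP (wsum W w m); elim: N W m f => // N IH W m f hN hW hf ff f0 hl.
have [[r [ro mr]]|h] := pselect (exists r, oddz r /\ (0 < m r)%N); last first.
  exists m, f, W; split=> //; first by split=> //; exact: gen_base.
  by split=> // r ro; apply/eqP; rewrite -leqn0 leqNgt; apply/negP => mr; case: h; exists r.
have rW : (`|r| <= W)%N by rewrite leqNgt; apply/negP => /hW e; rewrite e in mr.
(* An even index beyond the window, hence an empty level; being on the same side as [r], it lets one
   elementary matrix act as [transfer] up to sign, with one boson fewer. *)
pose s : int := if 0 < r then (2 * (W.+1))%N%:Z else - (2 * (W.+1))%N%:Z.
have sW : (W < `|s|)%N by rewrite /s; case: ifP => _; lia.
have se : ~~ oddz s by rewrite /oddz /s; case: ifP => _; lia.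
have rs : r != s by apply: contraTneq ro => ->.
have sr : (0 < s) = (0 < r) by rewrite /s; case: ifP => _; lia.
have nz := transfer_neq0 hf f0 ro se mr (hW s sW).
pose g := if 0 < r then fE s r f else fE r s f.
have eg : g = transfer s r f \/ g = - transfer s r f.
  rewrite /g; case: ifP => r0; [left|right].
    by rewrite fE_transfer_pos// sr.
  by rewrite fE_transfer_neg//; [move: sr; rewrite r0; lia|lia].
have mg : wvec (mi (md m r) s) g.
  rewrite /g; case: ifP => r0.
    by have := fE_wvec hf (negbT (introF eqP (fun e : s = r => negP rs (introT eqP (esym e)))));
       rewrite /m_act /m_st /m_de sr r0.
  have := fE_wvec hf rs; rewrite /m_act /m_st /m_de sr r0; apply: wvec_extm => t.
  by rewrite /mi /md; case: (eqVneq t r) => [->|_]; rewrite ?(negPf rs); lia.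
have hW' : finw `|s| (mi (md m r) s).
  by move=> t ht; rewrite /mi /md hW; [case: eqP; lia|lia].
have [||||||m' [g' [W' [h1 h2 [h3 h3'] h4 h5]]]] := IH `|s|%N (mi (md m r) s) g.
- have := wsum_md w rW mr; rewrite wsum_mi// [w s](_ : _ = 0%N) ?addn0; last by rewrite /w (negPf se).
  rewrite (@wsum_widen W `|s|); [|by move=> t ht; rewrite /md hW|exact: ltnW].
  by rewrite [w r](_ : _ = 1%N); [lia|rewrite /w ro].
- exact: hW'.
- exact: mg.
- by rewrite /g; case: ifP => _; exact: fin_supp_fE.
- by case: eg => ->; rewrite ?oppr_eq0.
- by rewrite /g; case: ifP => _; exact: hwm_fE.
exists m', g', W'; split=> //; split=> //; apply: gen_trans h3'.
by rewrite /g; case: ifP => _; apply: (@gen_act _ _ (fun r s => fE r s)); exact: gen_base.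
Qed.

End FockGeneration.

(** * Singular vectors in Fock space *)

Section FermionicDuality.
Variables (C : numClosedFieldType) (n : nat).
Notation mode := (mode n).
Notation H := (fock C mode).
Notation fermionic := (@fermionic n).
Notation cre := (cre (C := C) fermionic).
Notation ann := (ann (C := C) fermionic).
Notation amp := (amp C fermionic).
Notation fE := (@fE C n).
Notation gen := (gen (fun r s => fE r s)).
Implicit Types (p q : mode) (f g : H) (i j : 'I_n) (r s t u : int) (k : config mode).

(** Induction on the total of the absolute values of the occupied indices: an even raising operator
    moves a particle towards zero, or removes one particle at a positive and one at a nonpositive
    index, and so lowers this total. *)
Lemma singular_fermions lam m f W : finw W m -> wvec m f -> fin_supp f -> f != 0 ->
  hwm lam f -> (forall r, oddz r -> m r = 0%N) ->
  exists (m' : int -> nat) (g : H),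
    [/\ finw W m', wvec m' g, fin_supp g /\ gen f g, g != 0
      & [/\ hwm lam g, forall r, oddz r -> m' r = 0%N
          & forall r s, ~~ oddz r -> ~~ oddz s -> r < s -> fE r s g = 0]].
Proof.
pose w (r : int) : nat := `|r|%N.
have [N] := ubnP (wsum W w m); elim: N m f => // N IH m f hN hW hf ff f0 hl ho.
have [[r [s [ro so rs fn]]]|h] := pselect (exists r s,
    [/\ ~~ oddz r, ~~ oddz s, r < s & fE r s f != 0]); last first.
  exists m, f; split=> //; first by split=> //; exact: gen_base.
  split=> // r s ro so rs; apply/eqP; apply: contraT => fn.
  by case: h; exists r, s.
have rs' : r != s by rewrite lt_eqF.
have ms : 0 < s -> (0 < m s)%N.
  move=> s0; rewrite lt0n; apply: contra fn => ms; apply/eqP.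
  by apply: (fE_empty hf rs'); rewrite s0 ms.
have mr : r <= 0 -> (0 < m r)%N.
  move=> r0; rewrite lt0n; apply: contra fn => ms'; apply/eqP.
  by apply: (fE_empty hf rs'); rewrite r0 ms' orbT.
have inW t : (0 < m t)%N -> (`|t| <= W)%N.
  by move=> mt; rewrite leqNgt; apply/negP => /hW e; rewrite e in mt.
have sW : (`|s| <= W)%N.
  have [s0|s0] := ltP 0 s; first exact/inW/ms.
  by have := inW r (mr (ltW (lt_le_trans rs s0))); lia.
have rW : (`|r| <= W)%N.
  have [r0|r0] := ltP 0 r; last exact/inW/mr.
  by have := inW s (ms (lt_trans r0 rs)); lia.
have mg := fE_wvec hf rs'.
have hW' : finw W (m_act r s m).
  move=> t ht; have mt := hW t ht; rewrite /m_act /m_st /m_de /mi /md.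
  by case: ifP => _; case: ifP => _; rewrite mt; lia.
have lt : (wsum W w (m_act r s m) < wsum W w m)%N.
  rewrite /m_act /m_st /m_de; case: ifP => r0; case: ifP => s0.
  - have := wsum_md w sW (ms s0); rewrite wsum_mi// /w; lia.
  - lia.
  - have e : (0 < md m s r)%N by rewrite /md (negPf rs') subn0 mr// leNgt r0.
    have := wsum_md w rW e; have := wsum_md w sW (ms s0); rewrite /w; lia.
  - have e : (0 < mi m s r)%N by rewrite /mi (negPf rs') addn0 mr// leNgt r0.
    have := wsum_md w rW e; rewrite wsum_mi// /w; lia.
have [|||||||m' [g [h1 h2 [h3 h3'] h4 h5]]] := IH (m_act r s m) (fE r s f).
- lia.
- by [].
- by [].
- exact: fin_supp_fE.
- by [].
- exact: hwm_fE.
- move=> t to; rewrite /m_act /m_st /m_de /mi /md.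
  have tr : (t == r) = false by apply: contraNF ro => /eqP <-.
  have ts : (t == s) = false by apply: contraNF so => /eqP <-.
  by case: ifP => _; case: ifP => _; rewrite tr ts ?addn0 ?subn0 ho.
exists m', g; split=> //; split=> //; apply: gen_trans h3'.
by apply: (@gen_act _ _ (fun r s => fE r s)); exact: gen_base.
Qed.

(** Occupation in the picture of a filled sea: at nonpositive indices the particles of a
    configuration are holes. *)
Definition occ q k : bool := if 0 < q.2 then odd (k q) else ~~ odd (k q).

Lemma exch_ff p q : ~~ oddz p.2 -> ~~ oddz q.2 -> exch C fermionic p q = -1.
Proof. by move=> hp hq; rewrite /exch /Submission.fermionic hp hq expr1. Qed.

Lemma st_de_occ q f k : ~~ oddz q.2 -> st q (de q f) k = (occ q k)%:R * f k.
Proof.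
move=> hq; rewrite /st /de /occ.
have e : (-1) ^+ jw fermionic q k * (-1) ^+ jw fermionic q k = 1 :> C.
  by rewrite -expr2 sqrr_sign.
case: ltP => _.
  rewrite cre_ann_diag /Submission.amp /Submission.fermionic hq; congr (_ * _).
  by case: (odd _); rewrite ?mul0r ?mul1r.
rewrite scalefE (negPf hq) mul1r ann_cre_diag /Submission.amp /Submission.fermionic hq; congr (_ * _).
rewrite jw_inc ltnn andbF addn0 inc_same /=.
by case: (odd _); rewrite /= ?mul0r ?mul1r.
Qed.

Lemma de_st_occ q f k : ~~ oddz q.2 -> de q (st q f) k = (~~ occ q k)%:R * f k.
Proof.
move=> hq; rewrite de_st eqxx exch_ff// addfE !scalefE st_de_occ//.
by case: occ; rewrite /=; ring.
Qed.

Section Identity.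
Variables (l : seq int) (f : H) (k : config mode).
Hypothesis ul : uniq l.
Hypothesis el : forall r, r \in l -> ~~ oddz r.

Let nf i j r s : C := st (j, r) (st (i, s) (de (i, r) (de (j, s) f))) k.

Lemma de_st_neq p q g : ~~ oddz p.2 -> ~~ oddz q.2 -> p != q ->
  de p (st q g) = - st q (de p g).
Proof. by move=> hp hq pq; rewrite de_st (negPf pq) scale0r addr0 exch_ff// scaleN1r. Qed.

Lemma row_pair_off i j r s : r \in l -> s \in l -> i != j -> r != s ->
  st (j, r) (de (i, r) (st (i, s) (de (j, s) f))) k = - nf i j r s.
Proof.
move=> /el hr /el hs ij rs; rewrite [de (i, r) _]de_st_neq ?xpair_eqE ?eqxx//.
by rewrite linearN.
Qed.

Lemma col_pair_off i j r s : r \in l -> s \in l -> i != j -> r != s ->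
  st (i, s) (de (i, r) (st (j, r) (de (j, s) f))) k = nf i j r s.
Proof.
move=> /el hr /el hs ij rs; rewrite [de (i, r) _]de_st_neq ?xpair_eqE ?(negPf ij)//.
by rewrite [st _ (- _)]linearN /= st_st exch_ff// scaleN1r opprK.
Qed.

Lemma nf_swap i j r s : r \in l -> s \in l -> nf j i s r = nf i j r s.
Proof.
move=> /el hr /el hs; rewrite /nf st_st exch_ff// scaleN1r [de (j, s) _]de_de exch_ff//.
by rewrite scaleN1r !linearN opprK.
Qed.

Lemma row_pair_diag i j r : r \in l -> i != j ->
  st (j, r) (de (i, r) (st (i, r) (de (j, r) f))) k
  = (occ (j, r) k && ~~ occ (i, r) k)%:R * f k.
Proof.
move=> /el hr ij.
have -> : de (i, r) (st (i, r) (de (j, r) f)) = de (j, r) (de (i, r) (st (i, r) f)).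
  rewrite [in RHS]de_de exch_ff// scaleN1r [de (j, r) (st _ _)]de_st_neq ?linearN ?opprK//.
  by rewrite xpair_eqE eq_sym (negPf ij).
by rewrite st_de_occ// de_st_occ// mulrA -natrM mulnb.
Qed.

Lemma col_pair_diag i r s : r \in l -> s \in l -> r != s ->
  st (i, s) (de (i, r) (st (i, r) (de (i, s) f))) k
  = (occ (i, s) k && ~~ occ (i, r) k)%:R * f k.
Proof.
move=> /el hr /el hs rs.
have -> : de (i, r) (st (i, r) (de (i, s) f)) = de (i, s) (de (i, r) (st (i, r) f)).
  rewrite [in RHS]de_de exch_ff// scaleN1r [de (i, s) (st _ _)]de_st_neq ?linearN ?opprK//.
  by rewrite xpair_eqE eq_sym (negPf rs) andbF.
by rewrite st_de_occ// de_st_occ// mulrA -natrM mulnb.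
Qed.

Lemma sumfE (I : Type) (x : seq I) (P : pred I) (F : I -> H) :
  (\sum_(a <- x | P a) F a) k = \sum_(a <- x | P a) F a k.
Proof. by elim/big_rec2: _ => // a y z _ <-. Qed.

(** A comparison of Casimir elements as in skew Howe duality: the quartic parts of the row sum and
    of the column sum are opposite, and what is left is diagonal with nonnegative entries. For a
    vector killed by the raising operators of both algebras the left side is zero, hence so is each
    count on its support. *)
Lemma fermionic_identity :
  (\sum_(i < n) \sum_(j < n | (i < j)%N) row_op l j i (row_op l i j f) k)
  + (\sum_(r <- l) \sum_(s <- l | r < s) bil s r (bil r s f) k)
  = ((\sum_(i < n) \sum_(j < n | (i < j)%N) \sum_(r <- l) (occ (j, r) k && ~~ occ (i, r) k)%:R)
    + \sum_(r <- l) \sum_(s <- l | r < s) \sum_(i < n) (occ (i, s) k && ~~ occ (i, r) k)%:R) * f k.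
Proof.
pose S (c : 'I_n -> 'I_n -> int -> int -> bool) : C :=
  \sum_(i < n) \sum_(j < n) \sum_(r <- l) \sum_(s <- l) (c i j r s)%:R * nf i j r s.
have e1 : \sum_(i < n) \sum_(j < n | (i < j)%N) row_op l j i (row_op l i j f) k =
  (\sum_(i < n) \sum_(j < n | (i < j)%N) \sum_(r <- l) (occ (j, r) k && ~~ occ (i, r) k)%:R) * f k
  - S (fun i j r s => (i < j)%N && (r != s)).
  rewrite mulr_suml -sumrB; apply: eq_bigr => i _.
  rewrite mulr_suml [X in X - _]big_mkcond -sumrB big_mkcond; apply: eq_bigr => j _.
  case: ifP => ij; last first.
    by rewrite big1 ?subr0// => r _; rewrite big1// => s _; rewrite mul0r.
  rewrite mulr_suml -sumrB /row_op sumfE big_seq [RHS]big_seq; apply: eq_bigr => r rl.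
  rewrite linear_sum linear_sum sumfE (bigD1_seq r)//= [in RHS](bigD1_seq r)//=.
  have ji : i != j by rewrite neq_ltn ij.
  rewrite row_pair_diag// eqxx mul0r add0r; congr (_ + _).
  rewrite -sumrN big_seq_cond [RHS]big_seq_cond; apply: eq_bigr => s /andP[sl sr].
  by rewrite row_pair_off// 1?eq_sym// sr mul1r.
have e2 : \sum_(r <- l) \sum_(s <- l | r < s) bil s r (bil r s f) k =
  (\sum_(r <- l) \sum_(s <- l | r < s) \sum_(i < n) (occ (i, s) k && ~~ occ (i, r) k)%:R) * f k
  + S (fun i j r s => (i != j) && (r < s)).
  have -> : S (fun i j r s => (i != j) && (r < s)) =
      \sum_(r <- l) \sum_(s <- l) \sum_(i < n) \sum_(j < n) ((i != j) && (r < s))%:R * nf i j r s.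
    rewrite /S; under eq_bigr => i _ do rewrite exchange_big /=.
    rewrite exchange_big; apply: eq_bigr => r _ /=.
    under eq_bigr => i _ do rewrite exchange_big /=.
    by rewrite exchange_big.
  rewrite mulr_suml -big_split big_seq [RHS]big_seq; apply: eq_bigr => r rl /=.
  rewrite mulr_suml [X in X + _]big_mkcond -big_split big_mkcond big_seq [RHS]big_seq.
  apply: eq_bigr => s sl /=; case: ifP => rs; last first.
    by rewrite big1 ?addr0// => i _; rewrite big1// => j _; rewrite andbF mul0r.
  rewrite mulr_suml -big_split /bil sumfE; apply: eq_bigr => i _ /=.
  have rs' : r != s by rewrite lt_eqF.
  rewrite linear_sum linear_sum sumfE (bigD1 i)//= [in RHS](bigD1 i)//=.
  rewrite col_pair_diag// eqxx mul0r add0r; congr (_ + _); apply: eq_bigr => j ji.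
  by rewrite col_pair_off// 1?eq_sym// ji mul1r.
(* By [nf_swap] exchanging both pairs of indices fixes [nf], so the range i < j with r, s distinct
   and the range r < s with i, j distinct give equal sums. *)
have e3 : S (fun i j r s => (i < j)%N && (r != s)) = S (fun i j r s => (i != j) && (r < s)).
  have split2 (c d e : 'I_n -> 'I_n -> int -> int -> bool) :
      (forall i j r s, c i j r s = (d i j r s + e i j r s)%N :> nat) ->
      S c = S d + S e.
    move=> h; rewrite /S -big_split; apply: eq_bigr => i _ /=; rewrite -big_split.
    apply: eq_bigr => j _ /=; rewrite -big_split; apply: eq_bigr => r _ /=.
    by rewrite -big_split; apply: eq_bigr => s _ /=; rewrite h natrD mulrDl.
  rewrite (split2 _ (fun i j r s => (i < j)%N && (r < s)) (fun i j r s => (i < j)%N && (s < r))).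
    rewrite (split2 (fun i j r s => (i != j) && (r < s)) (fun i j r s => (i < j)%N && (r < s))
      (fun i j r s => (j < i)%N && (r < s))).
      congr (_ + _); rewrite /S exchange_big; apply: eq_bigr => j _.
      apply: eq_bigr => i _ /=; rewrite exchange_big big_seq [RHS]big_seq /=.
      apply: eq_bigr => s sl; rewrite big_seq [RHS]big_seq; apply: eq_bigr => r rl.
      by rewrite nf_swap.
    by move=> i j r s; rewrite -(inj_eq val_inj) /=; lia.
  by move=> i j r s; lia.
by rewrite e1 e2 e3 mulrDl addrACA addNr addr0.
Qed.

End Identity.
End FermionicDuality.

(* The charge of a row whose even modes are filled exactly up to 2 * a. *)
Lemma threshold_charge (a : int) (Q : nat) : (2 * `|a| <= Q)%N ->
  \sum_(r <- win Q | ~~ oddz r) ((r <= 2 * a)%R%:Z - (r <= 0)%R%:Z) = a.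
Proof.
have gen_case R : \sum_(r <- win R | ~~ oddz r) ((r <= 2 * a)%R%:Z - (r <= 0)%R%:Z)
    = if 0 <= a then (minn `|a| (R %/ 2))%:Z else - (minn `|a| (R %/ 2).+1)%:Z.
  elim: R => [|R IH].
    rewrite /= big_cons big_nil /oddz /= addr0; case: ifP => h; lia.
  rewrite [win _]/= !big_cons IH oddzN /oddz absz_nat.
  by case o1: (odd R.+1) => /=; case: (lerP 0 a) => a0; lia.
by move=> h; rewrite gen_case; case: ifP; lia.
Qed.

(** * The fermionic configuration attached to lam *)

Section Kappa.
Variables (C : numClosedFieldType) (n : nat) (lam : 'I_n -> int).
Notation mode := (mode n).
Notation H := (fock C mode).
Notation fermionic := (@fermionic n).
Notation fE := (@fE C n).
Notation gen := (gen (fun r s => fE r s)).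
Implicit Types (p q : mode) (f g : H) (i j : 'I_n) (r s t u : int) (k : config mode).

(** Row [i] of the sea is filled exactly at the even indices up to [2 * lam i], recorded as
    particles above zero and as holes below. *)
Definition kap : config mode := fun q =>
  if oddz q.2 then 0%N else
  if 0 < q.2 then nat_of_bool (q.2 <= 2 * lam q.1) else nat_of_bool (2 * lam q.1 < q.2).

Lemma kap_good : good kap.
Proof. by move=> i r re; rewrite /kap /= (negPf re); case: ifP => _; exact: leq_b1. Qed.

Lemma occ_kap i r : ~~ oddz r -> occ (i, r) kap = (r <= 2 * lam i).
Proof.
move=> re; rewrite /occ /kap /= (negPf re); case: ltP => _; first by rewrite oddb.
by rewrite oddb -leNgt.
Qed.

Lemma content0 k r i : content k r = 0%N -> k (i, r) = 0%N.
Proof. by move=> c; apply/eqP; rewrite -leqn0 -c /content (bigD1 i)//= leq_addr. Qed.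

Lemma charge_occ Q k i : good k -> (forall r, oddz r -> content k r = 0%N) ->
  charge (win Q) i k = \sum_(r <- win Q | ~~ oddz r) ((occ (i, r) k)%:Z - (r <= 0)%R%:Z).
Proof.
move=> g co; rewrite /charge [RHS]big_mkcond; apply: eq_bigr => r _.
case: (boolP (oddz r)) => re /=; first by rewrite (content0 i (co r re)) oppr0 if_same.
have := g i r re; rewrite /occ /=.
by case: (k _) => [|[|//]] _; case: ltP => h /=; rewrite ?(negPf (lt_geF h)) ?subr0 ?subrr ?sub0r//; lia.
Qed.

Lemma kap_odd r : oddz r -> content kap r = 0%N.
Proof. by move=> ro; rewrite /content big1// => i _; rewrite /kap /= ro. Qed.

Definition lam_bound : nat := \max_(i < n) `|lam i|%N.

Lemma lam_bound_ge i : (`|lam i| <= lam_bound)%N.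
Proof. exact: leq_bigmax. Qed.

Lemma charge_kap Q i : (2 * lam_bound <= Q)%N -> charge (win Q) i kap = lam i.
Proof.
move=> hQ; rewrite charge_occ; [|exact: kap_good|exact: kap_odd].
rewrite -[RHS](@threshold_charge (lam i) Q); last by have := lam_bound_ge i; lia.
by apply: eq_bigr => r re; rewrite occ_kap.
Qed.

(** Nesting makes the occupied even indices of each row an initial segment, and the charge of the
    row fixes where it ends. *)
Lemma kap_unique k Q W : (W <= Q)%N -> (2 * lam_bound <= Q)%N -> good k ->
  (forall r, (W < `|r|)%N || oddz r -> content k r = 0%N) ->
  (forall i, charge (win Q) i k = lam i) ->
  (forall i r s, (`|r| <= Q)%N -> (`|s| <= Q)%N -> ~~ oddz r -> ~~ oddz s -> r < s ->
     occ (i, s) k -> occ (i, r) k) ->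
  k = kap.
Proof.
move=> WQ lQ g co ch nest; apply/funext => -[i r].
have k0 t : content k t = 0%N -> k (i, t) = 0%N by exact: content0.
have lami := lam_bound_ge i.
have [ro|re] := boolP (oddz r); first by rewrite k0 ?co ?ro ?orbT// /kap /= ro.
have [rQ|rQ] := ltnP Q `|r|%N.
  rewrite k0; last by apply: co; lia.
  by rewrite /kap /= (negPf re); case: ifP; lia.
have occE t : (`|t| <= Q)%N -> ~~ oddz t -> occ (i, t) k = (t <= 2 * lam i).
  pose l := [seq s <- win Q | ~~ oddz s].
  have uniql : uniq l by rewrite filter_uniq ?win_uniq.
  have ml u : (u \in l) = ~~ oddz u && (`|u| <= Q)%N by rewrite mem_filter mem_win.
  have hs : \sum_(s <- l) ((occ (i, s) k)%:Z - (s <= 2 * lam i)%R%:Z) = 0.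
    rewrite big_filter; have := ch i; rewrite charge_occ//; last by move=> s so; apply: co; rewrite so orbT.
    rewrite -[X in _ = X](@threshold_charge (lam i) Q); last by lia.
    move=> /eqP; rewrite -subr_eq0 -sumrB => /eqP e; rewrite -[RHS]e; apply: eq_bigr => s _.
    by rewrite opprB addrA subrK.
  (* An occupied index above the threshold makes, by nesting, every term of the zero sum [hs]
     nonnegative and one of them positive. *)
  have [[s [sQ se so sl]]|h1] := pselect (exists s, [/\ (`|s| <= Q)%N, ~~ oddz s,
      occ (i, s) k & 2 * lam i < s]).
    have ge0 u : (`|u| <= Q)%N -> ~~ oddz u ->
        0 <= (occ (i, u) k)%:Z - (u <= 2 * lam i)%R%:Z.
      move=> uQ ue; case: (leP u) => ul; last by lia.
      by rewrite (nest i u s)// ?subrr//; lia.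
    have : 0 < \sum_(s <- l) ((occ (i, s) k)%:Z - (s <= 2 * lam i)%R%:Z).
      rewrite (bigD1_seq s) ?ml ?se//= so ltr_wpDr//; last by lia.
      rewrite big_seq_cond sumr_ge0// => u /andP[]; rewrite ml => /andP[ue uQ] _.
      exact: ge0.
    by rewrite hs ltxx.
  (* With nothing occupied above the threshold all terms are nonpositive, so each of them
     vanishes. *)
  have le0 u : (`|u| <= Q)%N -> ~~ oddz u ->
      (occ (i, u) k)%:Z - (u <= 2 * lam i)%R%:Z <= 0.
    move=> uQ ue; case: (leP u) => ul; first by case: occ; lia.
    by case ou: (occ _ _) => //; case: h1; exists u.
  move=> tQ te; move: hs; rewrite (bigD1_seq t) ?ml ?te//= => hs.
  have : \sum_(u <- l | u != t)
      ((occ (i, u) k)%:Z - (u <= 2 * lam i)%R%:Z) <= 0.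
    rewrite big_seq_cond -oppr_ge0 -sumrN sumr_ge0// => u /andP[].
    by rewrite ml oppr_ge0 => /andP[ue uQ] _; exact: le0.
  move: hs (le0 t tQ te); set X := \sum_(u <- _ | _) _.
  by case: occ; case: (t <= _); lia.
have := occE r rQ re; have := g i r re; rewrite /occ /kap /= (negPf re).
by case: (k _) => [|[|//]] _; case: ifP => _ /=; rewrite ?ltNge => <-.
Qed.

Definition kapf : H := fun k => (k == kap)%:R.

Lemma kapf_neq0 : kapf != 0.
Proof.
apply/eqP => e; have := congr1 (fun x : H => x kap) e.
by rewrite /= /kapf eqxx => /eqP; rewrite oner_eq0.
Qed.

Lemma kapf_supp k : kapf k != 0 -> k = kap.
Proof. by move=> h; apply/eqP; apply: contraNT h => /negPf h; apply/eqP; rewrite /kapf h. Qed.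

Lemma wvec_kapf : wvec (content kap) kapf.
Proof. by move=> k /kapf_supp ->; split=> //; exact: kap_good. Qed.

Lemma fin_supp_kapf : fin_supp kapf.
Proof. by apply: sub_finite_set (finite_set1 kap) => k /= /kapf_supp. Qed.

Lemma reach_kapf m f W : finw W m -> wvec m f -> fin_supp f -> f != 0 -> hwm lam f ->
  gen f kapf.
Proof.
move=> hW hf ff f0 hl.
have [m1 [f1 [W1 [hW1 hf1 [ff1 g1] f10 [hl1 ho1]]]]] := bosonless hW hf ff f0 hl.
have [m2 [f2 [hW2 hf2 [ff2 g2] f20 [hl2 ho2 sing]]]] := singular_fermions hW1 hf1 ff1 f10 hl1 ho1.
suff : gen f2 kapf by move=> h; exact: gen_trans g1 (gen_trans g2 h).
have supp k : f2 k != 0 -> k = kap.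
  move=> fk; have [Q0 hQ] := hl2; pose Q := (Q0 + W1 + 2 * lam_bound)%N.
  have [h1 h2] : _ := hQ Q (leq_trans (leq_addr _ _) (leq_addr _ _)).
  have [ck gk] := hf2 k fk.
  pose l := [seq t <- win Q | ~~ oddz t].
  have ul : uniq l by rewrite filter_uniq ?win_uniq.
  have el r : r \in l -> ~~ oddz r by rewrite mem_filter => /andP[].
  (* In the absence of bosons the odd columns contribute nothing, so the row operators may be
     restricted to the even columns, where the identity applies. *)
  have z1 i j : (i < j)%N -> row_op l i j f2 = 0.
    move=> ij; rewrite -[RHS](h1 i j ij) /row_op big_filter big_mkcond; apply: eq_bigr => t _.
    case: ifP => // /negbFE to; have mt := ho2 t to.
    rewrite /st /de /=; case: ltP => _; first by rewrite (ann_empty (q := (j, t)) hf2)// linear0.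
    rewrite ann_cre (ann_empty (q := (i, t)) hf2)// linear0 scaler0 add0r.
    have ji : i != j by rewrite neq_ltn ij.
    by rewrite xpair_eqE (negPf ji) scale0r scaler0.
  have z2 r s : r \in l -> s \in l -> r < s -> bil r s f2 = 0.
    move=> /el re /el se rs; rewrite -[RHS](sing r s re se rs) bil_neq//.
    by rewrite lt_eqF.
  have e1 : \sum_(i < n) \sum_(j < n | (i < j)%N) row_op l j i (row_op l i j f2) k = 0.
    by apply: big1 => i _; apply: big1 => j ij; rewrite z1// linear0.
  have e2 : \sum_(r <- l) \sum_(s <- l | r < s) bil s r (bil r s f2) k = 0.
    rewrite big_seq; apply: big1 => r rl; rewrite big_seq_cond; apply: big1 => s /andP[sl rs].
    by rewrite z2// linear0.
  have := fermionic_identity f2 k ul el; rewrite e1 e2 addr0.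
  move=> /esym/eqP; rewrite mulf_eq0 (negPf fk) orbF.
  have ge1 : 0 <= \sum_(i < n) \sum_(j < n | (i < j)%N)
      \sum_(r <- l) (occ (j, r) k && ~~ occ (i, r) k)%:R :> C.
    by apply: sumr_ge0 => i _; apply: sumr_ge0 => j _; apply: sumr_ge0 => r _; rewrite ler0n.
  have ge2 r s : 0 <= \sum_(i < n) (occ (i, s) k && ~~ occ (i, r) k)%:R :> C.
    by apply: sumr_ge0 => i _; rewrite ler0n.
  rewrite paddr_eq0//; last by apply: sumr_ge0 => r _; apply: sumr_ge0.
  (* Of the two vanishing counts the one over columns is kept: it says that the occupation of each
     row is nested. *)
  move=> /andP[_]; rewrite psumr_eq0 => [/allP h3|r _]; last exact: sumr_ge0.
  apply: (@kap_unique k Q W1); rewrite ?/Q.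
  - by rewrite addnAC leq_addl.
  - by rewrite leq_addl.
  - by [].
  - by move=> r /orP[/hW2 e|/ho2 e]; rewrite ck.
  - by move=> i; exact: wvec_charge h2 fk gk i.
  - move=> i r s rQ sQ re se rs os; have rl : r \in l by rewrite mem_filter re mem_win.
    have := h3 r rl => /=; rewrite psumr_eq0 => [/allP h4|t _]; last exact: ge2.
    have sl : s \in l by rewrite mem_filter se mem_win.
    have := h4 s sl; rewrite rs /= psumr_eq0 => [/allP h5|t _]; last by rewrite ler0n.
    have := h5 i (mem_index_enum i); rewrite os /= pnatr_eq0.
    by case: (occ _ _).
have [k fk] := neq0_config f20; have ek := supp k fk; rewrite ek in fk.
suff -> : kapf = (f2 kap)^-1 *: f2 by apply: genZ; exact: gen_base.
apply/funext => k'; rewrite scalefE /kapf; have [->|nk] := eqVneq k' kap.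
  by rewrite mulVf.
have -> : f2 k' = 0 by apply/eqP; apply: contraNT nk => /supp ->.
by rewrite mulr0.
Qed.

Lemma st_de_zero q f k : f k = 0 -> st q (de q f) k = 0.
Proof.
move=> fk; rewrite /st /de; case: ltP => _; first by rewrite cre_ann_diag fk mulr0.
by rewrite scalefE ann_cre_diag fk !mulr0.
Qed.

Lemma kapf_off k : k != kap -> kapf k = 0.
Proof. by move=> nk; apply/eqP; apply: contraNT nk => /kapf_supp ->. Qed.

(** The squared norm is expressed through [de q (st q kapf)], which is diagonal with coefficient
    zero at [kap]; definiteness of the form concludes. *)
Lemma st_kapf q : ~~ oddz q.2 -> occ q kap -> st q kapf = 0.
Proof.
move=> hq ho; apply: form_eq0; first exact/fin_supp_st/fin_supp_kapf.
rewrite form_st; [|exact: fin_supp_kapf|exact/fin_supp_st/fin_supp_kapf].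
rewrite /form fsbig1 ?mulr0// => k _; rewrite de_st_occ//.
have [->|/kapf_off->] := eqVneq k kap; last by rewrite mul0r.
by rewrite ho mul0r conjC0 mulr0.
Qed.

Lemma de_kapf q : ~~ oddz q.2 -> ~~ occ q kap -> de q kapf = 0.
Proof.
move=> hq ho; apply: form_eq0; first exact/fin_supp_de/fin_supp_kapf.
rewrite form_de; [|exact: fin_supp_kapf|exact/fin_supp_de/fin_supp_kapf].
rewrite /form fsbig1 ?mulr0// => k _; rewrite st_de_occ//.
have [->|/kapf_off->] := eqVneq k kap; last by rewrite mul0r.
by rewrite (negPf ho) mul0r conjC0 mulr0.
Qed.

Lemma hwm_kapf : genpart lam -> hwm lam kapf.
Proof.
move=> hlam; exists (2 * lam_bound)%N => Q hQ; split=> [i j ij|i]; last first.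
  apply/funext => k; rewrite scalefE; have [->|nk] := eqVneq k kap.
    by rewrite row_op_diag ?charge_kap//; exact: kap_good.
  rewrite (kapf_off nk) mulr0 /row_op sumfE big1// => t _.
  by apply: st_de_zero; exact: kapf_off.
rewrite /row_op big1// => t _; have ji : i != j by rewrite neq_ltn ij.
have [to|te] := boolP (oddz t).
  rewrite /st /de /=; have c0 := kap_odd to; case: ltP => _.
    by rewrite (ann_empty (q := (j, t)) wvec_kapf)// linear0.
  rewrite ann_cre (ann_empty (q := (i, t)) wvec_kapf)// linear0 scaler0 add0r.
  by rewrite xpair_eqE (negPf ji) scale0r scaler0.
have [oj|oj] := boolP (occ (j, t) kap); last by rewrite de_kapf// linear0.
(* Dominance of [lam]: row [i] is filled at least as far as row [j]. *)
have oi : occ (i, t) kap.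
  by move: oj; rewrite !occ_kap//; have := hlam i j (ltnW ij); lia.
apply/eqP; rewrite -oppr_eq0 -de_st_neq ?xpair_eqE ?(negPf ji)// 1?eq_sym ?(negPf ji)//.
by rewrite st_kapf// linear0.
Qed.

End Kappa.

(** * Odd reflections from a fermionic order to the standard order *)

Section OddReflections.
Variables (C : numClosedFieldType) (n : nat).
Notation mode := (mode n).
Notation H := (fock C mode).
Notation fE := (@fE C n).
Notation gen := (gen (fun r s => fE r s)).
Implicit Types (f g : H) (i j : 'I_n) (r s t u : int).

Definition singular (prec : int -> int -> bool) f := forall r s, prec r s -> fE r s f = 0.

(** Here [y] comes right after [x]. As [x] and [y] are on one side of zero there is no central term,
    and E_xy E_yx f = (E_xx + E_yy) f is (m x + m y) f up to sign, so E_yx f is nonzero once one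
    level is occupied. The odd operator E_yx has square zero, and adjacency makes its commutators
    with the other positive operators positive again. *)
Lemma odd_reflection (prec : int -> int -> bool) x y m f :
  (forall t u, prec t u -> t != u) ->
  (forall t, prec t y -> t != x -> prec t x) ->
  (forall u, prec x u -> u != y -> prec y u) ->
  prec x y -> (0 < x) = (0 < y) -> oddz x != oddz y ->
  wvec m f -> fin_supp f -> f != 0 -> singular prec f ->
  exists g, [/\ gen f g, fin_supp g, g != 0,
    wvec (if (0 < m x + m y)%N then m_act y x m else m) g &
    forall t u, ((t == y) && (u == x)) || prec t u && ~~ ((t == x) && (u == y)) ->
      fE t u g = 0].
Proof.
move=> irr px py pxy side pari hf ff f0 sf.
have xy : x != y by exact: irr.
have yx : y != x by rewrite eq_sym.
have pyx : par y x by move: pari; rewrite /par oddzD; case: (oddz x); case: (oddz y).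
have rel := @fE_rel C n; rewrite /gl_rel /= in rel.
case: posnP => [m0|mpos].
  exists f; split=> //; first exact: gen_base.
  move=> t u /orP[/andP[/eqP-> /eqP->]|/andP[/sf//]].
  by apply: (fE_empty hf yx); case: (ltP 0 x) => hx /=; lia.
exists (fE y x f); split.
- by apply: (@gen_act _ _ (fun r s => fE r s)); exact: gen_base.
- exact: fin_supp_fE.
- apply/eqP => e; have := rel x y y x f; rewrite e linear0 (sf x y pxy) linear0 scaler0 add0r.
  rewrite !eqxx scale1r mulr1 /central_coef !eqxx /= mul1r.
  have -> : (x <= 0) = (y <= 0) by rewrite !leNgt side.
  rewrite subrr mulr0 mul0r scale0r addr0 /par [x + y]addrC -/(par y x) pyx /= expr1 scaleN1r opprK.
  rewrite !(wvec_weight _ hf) -scalerDl => /esym/eqP; rewrite scaler_eq0 (negPf f0) orbF.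
  have -> : sg C y = sg C x by rewrite /sg side.
  by rewrite -mulrDr -natrD mulf_eq0 pnatr_eq0 eqn0Ngt mpos orbF /sg; case: ifP => _; rewrite ?oppr_eq0 oner_eq0.
- exact: fE_wvec.
move=> t u /orP[/andP[/eqP-> /eqP->]|/andP[ptu ntu]].
  have := rel y x y x f; rewrite (negPf xy) pyx /central_coef (negPf xy) /=.
  rewrite !mul0r mulr0 !scale0r subr0 !addr0 expr1 scaleN1r => /eqP.
  by rewrite -addr_eq0 -mulr2n -scaler_nat scaler_eq0 pnatr_eq0 => /eqP.
rewrite rel (sf t u ptu) linear0 scaler0 add0r.
have -> : central_coef C n t u y x = 0.
  by rewrite /central_coef andbC [x == t]eq_sym (negPf ntu) !mul0r.
rewrite scale0r addr0; have [uy|uy] := eqVneq u y.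
  have tx : t != x by move: ntu; rewrite uy eqxx andbT.
  by rewrite eq_sym (negPf tx) mulr0 scale0r subr0 sf ?scaler0//; apply: px => //; rewrite -uy.
rewrite scale0r add0r; have [xt|xt] := eqVneq x t; last by rewrite mulr0 scale0r oppr0.
by rewrite sf ?scaler0 ?oppr0//; apply: py => //; rewrite xt.
Qed.

(** Levels are numbered from 1 outward on each side, separately for fermions and bosons; [fer] and
    [bos] are the inverse maps. *)
Definition idx t : nat := (uphalf `|t|%N + ((t <= 0)%R && ~~ oddz t))%N.

(** The interpolating orders: [cr sd b l] means that boson [b] has passed fermion [l] on the side
    [sd]. When none has passed, the order is nonpositive bosons, nonpositive fermions, positive
    fermions, positive bosons. *)
Definition bef (cr : bool -> nat -> nat -> bool) t u : bool :=
  if t <= 0 then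
    if 0 < u then true else
    if oddz t == oddz u then t < u else
    if oddz t then ~~ cr false (idx t) (idx u) else cr false (idx u) (idx t)
  else
    if u <= 0 then false else
    if oddz t == oddz u then t < u else
    if oddz t then cr true (idx t) (idx u) else ~~ cr true (idx u) (idx t).

Definition fer (sd : bool) (l : nat) : int := if sd then (2 * l)%N%:Z else 2 - (2 * l)%N%:Z.
Definition bos (sd : bool) (b : nat) : int := if sd then (2 * b)%N%:Z - 1 else 1 - (2 * b)%N%:Z.

Arguments fer : simpl never.
Arguments bos : simpl never.

Lemma oddz_fer sd l : oddz (fer sd l) = false.
Proof. rewrite /oddz /fer; case: sd; lia. Qed.
Lemma oddz_bos sd b : oddz (bos sd b) = true.
Proof. rewrite /oddz /bos; case: sd; lia. Qed.
Lemma idx_fer sd l : (0 < l)%N -> idx (fer sd l) = l.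
Proof. rewrite /idx oddz_fer /fer; case: sd => l0; case: leP; lia. Qed.
Lemma idx_bos sd b : (0 < b)%N -> idx (bos sd b) = b.
Proof. rewrite /idx oddz_bos /bos; case: sd => l0; case: leP; lia. Qed.
Lemma side_fer sd l : (0 < l)%N -> (0 < fer sd l) = sd.
Proof. rewrite /fer; case: sd; lia. Qed.
Lemma side_bos sd b : (0 < b)%N -> (0 < bos sd b) = sd.
Proof. rewrite /bos; case: sd; lia. Qed.

Lemma fer_or_bos t : exists sd k, (0 < k)%N /\ (t = fer sd k \/ t = bos sd k).
Proof.
exists (0 < t), (idx t); rewrite /idx /fer /bos /oddz.
by case: (ltP 0 t) => t0; case o: (odd `|t|); rewrite /=; split; lia.
Qed.

Lemma fer_inj sd k k' : (fer sd k == fer sd k') = (k == k').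
Proof. rewrite /fer; case: sd; lia. Qed.
Lemma bos_inj sd k k' : (bos sd k == bos sd k') = (k == k').
Proof. rewrite /bos; case: sd; lia. Qed.
Lemma fer_bos sd sd' k k' : (fer sd k == bos sd' k') = false.
Proof. by apply/eqP => e; have := oddz_fer sd k; rewrite e oddz_bos. Qed.
Lemma bos_fer sd sd' k k' : (bos sd k == fer sd' k') = false.
Proof. by rewrite eq_sym fer_bos. Qed.

Variables (c Cj : bool -> nat -> nat) (Q : nat).
Hypothesis galois : forall sd b l, (0 < b)%N -> (0 < l)%N -> (b <= c sd l)%N = (l <= Cj sd b)%N.
Hypothesis CjQ : forall sd b, (0 < b)%N -> (Cj sd b <= Q)%N.

(** Bosons pass one at a time, each through the fermions in decreasing number: those before [p] are
    done, and [p] has passed the fermions beyond [q]. The bound [b + ~~ sd <= l] is the standard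
    order, 2b - 1 < 2l on one side and 2 - 2l < 1 - 2b on the other. *)
Definition cr (p q : bool -> nat) (sd : bool) (b l : nat) : bool :=
  (b < p sd)%N && (b + ~~ sd <= l)%N || (b == p sd) && (q sd < l)%N.

(** A passage of boson [b] through fermion [l] moves a particle exactly when (b, l) is a box of the
    diagram, whose columns are [c] and rows [Cj]; this is the role of [galois]. So a fermion level
    loses one particle to each boson that passed it, while any remain, and a boson gains the boxes
    passed in its row. *)
Definition mm (p q : bool -> nat) t : nat :=
  let sd := 0 < t in let k := idx t in
  if oddz t then
    if (k < p sd)%N then (Cj sd k - (k + ~~ sd).-1)%N
    else if k == p sd then (Cj sd k - q sd)%N else 0%N
  else (c sd k - (minn (p sd).-1 (k - ~~ sd) + (q sd < k)%N))%N.

Variable f0 : H.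
Definition stage (p q : bool -> nat) := exists f,
  [/\ wvec (mm p q) f, fin_supp f, f != 0, gen f0 f
    & forall t u, bef (cr p q) t u -> fE t u f = 0].

Definition upd (q : bool -> nat) sd v : bool -> nat := fun z => if z == sd then v else q z.

Lemma bef_cross cr0 t u : (0 < t) != (0 < u) -> bef cr0 t u = (t <= 0).
Proof. by rewrite /bef; case: (ltP 0 t) => ht; case: (ltP 0 u). Qed.

Lemma bef_bf cr0 sd b l : (0 < b)%N -> (0 < l)%N ->
  bef cr0 (bos sd b) (fer sd l) = if sd then cr0 true b l else ~~ cr0 false b l.
Proof.
move=> hb hl; rewrite /bef oddz_bos oddz_fer !leNgt side_bos// side_fer//.
by rewrite idx_bos// idx_fer//; case: sd.
Qed.
Lemma bef_fb cr0 sd b l : (0 < b)%N -> (0 < l)%N ->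
  bef cr0 (fer sd l) (bos sd b) = if sd then ~~ cr0 true b l else cr0 false b l.
Proof.
move=> hb hl; rewrite /bef oddz_bos oddz_fer !leNgt side_bos// side_fer//.
by rewrite idx_bos// idx_fer//; case: sd.
Qed.
Lemma bef_ff cr0 sd k l : (0 < k)%N -> (0 < l)%N ->
  bef cr0 (fer sd k) (fer sd l) = if sd then (k < l)%N else (l < k)%N.
Proof.
move=> hb hl; rewrite /bef !oddz_fer !leNgt !side_fer//=.
by rewrite /fer; case: sd => /=; lia.
Qed.
Lemma bef_bb cr0 sd k l : (0 < k)%N -> (0 < l)%N ->
  bef cr0 (bos sd k) (bos sd l) = if sd then (k < l)%N else (l < k)%N.
Proof.
move=> hb hl; rewrite /bef !oddz_bos !leNgt !side_bos//=.
by rewrite /bos; case: sd => /=; lia.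
Qed.

Lemma bef_irr cr0 t u : bef cr0 t u -> t != u.
Proof. by apply: contraTneq => ->; rewrite /bef; case: ltP => //; rewrite eqxx ltxx. Qed.

Lemma bef_ext cr1 cr2 t u : (forall b l, cr1 (0 < t) b l = cr2 (0 < t) b l) ->
  bef cr1 t u = bef cr2 t u.
Proof. by rewrite /bef; case: (ltP 0 t) => _ h; rewrite !h. Qed.

Lemma mm_fer p q sd l : (0 < l)%N ->
  mm p q (fer sd l) = (c sd l - (minn (p sd).-1 (l - ~~ sd) + (q sd < l)%N))%N.
Proof. by move=> l0; rewrite /mm oddz_fer side_fer// idx_fer. Qed.
Lemma mm_bos p q sd b : (0 < b)%N -> mm p q (bos sd b) =
  if (b < p sd)%N then (Cj sd b - (b + ~~ sd).-1)%N
    else if b == p sd then (Cj sd b - q sd)%N else 0%N.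
Proof. by move=> l0; rewrite /mm oddz_bos side_bos// idx_bos. Qed.

Lemma m_act_side sd x y m t : (0 < x) = sd -> (0 < y) = sd -> x != y ->
  m_act y x m t = (if t == (if sd then y else x) then (m t).+1 else
    if t == (if sd then x else y) then (m t).-1 else m t)%N.
Proof.
move=> sx sy xy; rewrite /m_act /m_st /m_de /mi /md sx sy; case: sd {sx sy}.
  by have [->|ty] := eqVneq t y; [rewrite eq_sym (negPf xy); lia|case: eqP; lia].
by have [->|tx] := eqVneq t x; [rewrite (negPf xy); lia|case: eqP; lia].
Qed.

Lemma stage_step p q sd : (0 < p sd)%N -> (p sd + ~~ sd <= q sd)%N -> stage p q ->
  stage p (upd q sd (q sd).-1).
Proof.
move=> p0 pq [f [hf ff fn0 gf sf]].
have q0 : (0 < q sd)%N by lia.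
(* [x] is the earlier of the two levels: before their passage the fermion comes first on the
   positive side and the boson on the other. *)
pose x := if sd then fer sd (q sd) else bos sd (p sd).
pose y := if sd then bos sd (p sd) else fer sd (q sd).
have sx : (0 < x) = sd by rewrite /x; case: (sd) p0 q0 => *; rewrite ?side_fer ?side_bos.
have sy : (0 < y) = sd by rewrite /y; case: (sd) p0 q0 => *; rewrite ?side_fer ?side_bos.
have cr_pq : cr p q sd (p sd) (q sd) = false by rewrite /cr; lia.
have decode t : (0 < t) = sd -> exists k, (0 < k)%N /\ (t = fer sd k \/ t = bos sd k).
  move=> st; have [sd' [k [k0 et]]] := fer_or_bos t; exists k.
  by case: et st => ->; rewrite ?side_fer ?side_bos// => <-; split=> //; [left|right].
have [|||||g [gg fg g0 wg sg]] :=
  @odd_reflection (bef (cr p q)) x y (mm p q) f (@bef_irr _) _ _ _ _ _ hf ff fn0 sf.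
- move=> t hty tx; have [st|st] := eqVneq (0 < t) sd; last first.
    by move: hty; rewrite !bef_cross ?sx ?sy.
  have [k [k0 et]] := decode t st; clear st sx sy decode sf hf.
  case: et tx hty => ->; rewrite /x /y; case: (sd) p0 pq q0 cr_pq => p0 pq q0 cr_pq;
    rewrite ?(bef_bf, bef_fb, bef_ff, bef_bb)// ?fer_inj ?bos_inj ?fer_bos ?bos_fer /cr; lia.
- move=> t hxt ty; have [st|st] := eqVneq (0 < t) sd; last first.
    by move: hxt; rewrite !bef_cross ?sx ?sy 1?eq_sym// !leNgt sx sy.
  have [k [k0 et]] := decode t st; clear st sx sy decode sf hf.
  case: et ty hxt => ->; rewrite /x /y; case: (sd) p0 pq q0 cr_pq => p0 pq q0 cr_pq;
    rewrite ?(bef_bf, bef_fb, bef_ff, bef_bb)// ?fer_inj ?bos_inj ?fer_bos ?bos_fer /cr; lia.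
- by rewrite /x /y; case: (sd) p0 pq q0 cr_pq => p0 pq q0 cr_pq; rewrite ?(bef_bf, bef_fb)// cr_pq.
- by rewrite sx sy.
- by rewrite /x /y; case: (sd); rewrite oddz_fer oddz_bos.
exists g; split=> //; last first.
- move=> t u htu; apply: sg.
  have [st|st] := eqVneq (0 < t) sd; have [su|su] := eqVneq (0 < u) sd.
  + have [k [k0 et]] := decode t st; have [k' [k'0 eu]] := decode u su.
    clear st su sx sy decode sf hf wg gg.
    move: htu; case: et => ->; case: eu => ->; rewrite /x /y;
      case: (sd) p0 pq q0 cr_pq => p0 pq q0 cr_pq;
      rewrite ?(bef_bf, bef_fb, bef_ff, bef_bb)// ?fer_inj ?bos_inj ?fer_bos ?bos_fer ?andbF ?andbT ?orbF //=;
      rewrite /cr /upd ?eqxx /=; lia.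
  + by move: htu; rewrite !bef_cross ?st ?[sd == _]eq_sym// => ->; rewrite (_ : u == y = false) ?andbF ?orbT//;
      apply: contraNF su => /eqP ->; rewrite sy.
  + rewrite -(@bef_ext (cr p (upd q sd (q sd).-1))) ?htu => [|b l]; last first.
      by rewrite /cr /upd (negPf st).
    by rewrite (_ : t == x = false) ?orbT//; apply: contraNF st => /eqP ->; rewrite sx.
  + rewrite -(@bef_ext (cr p (upd q sd (q sd).-1))) ?htu => [|b l]; last first.
      by rewrite /cr /upd (negPf st).
    by rewrite (_ : t == x = false) ?orbT//; apply: contraNF st => /eqP ->; rewrite sx.
- exact: gen_trans gf gg.
apply: wvec_extm wg => t.
have [st|st] := eqVneq (0 < t) sd; last first.
  have tx : (t == x) = false by apply: contraNF st => /eqP ->; rewrite sx.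
  have ty : (t == y) = false by apply: contraNF st => /eqP ->; rewrite sy.
  have -> : mm p (upd q sd (q sd).-1) t = mm p q t by rewrite /mm /upd (negPf st).
  case: ifP => // _; rewrite /m_act /m_st /m_de /mi /md.
  by case: ifP => _; case: ifP => _; rewrite tx ty ?addn0 ?subn0.
have [k [k0 et]] := decode t st; clear st decode sf hf gg sg.
(* Whether the box (p, q) lies in the diagram decides whether a particle moves. *)
have g1 := galois sd p0 q0.
have eact : (if (0 < mm p q x + mm p q y)%N then m_act y x (mm p q) else mm p q) t =
    if (0 < mm p q x + mm p q y)%N then
      (if t == (if sd then y else x) then (mm p q t).+1 else
        if t == (if sd then x else y) then (mm p q t).-1 else mm p q t)%N else mm p q t.
  case: ifP => // _; apply: m_act_side => //.
  by rewrite /x /y; case: (sd); rewrite ?fer_bos ?bos_fer.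
rewrite eact /x /y; clear eact sx sy x y cr_pq.
case: et => ->; case: (sd) p0 pq q0 g1 => p0 pq q0 g1;
  rewrite !mm_fer// !mm_bos// ?fer_inj ?bos_inj ?fer_bos ?bos_fer /upd ?eqxx !ltnn /=.
- by have [->|kq] := eqVneq k (q true); do ?[case: ifP => ?]; lia.
- by have [->|kq] := eqVneq k (q false); do ?[case: ifP => ?]; lia.
- by have [->|kq] := eqVneq k (p true); do ?[case: ifP => ?]; lia.
- by have [->|kq] := eqVneq k (p false); do ?[case: ifP => ?]; lia.
Qed.

Lemma stage_ext p q p' q' : p =1 p' -> q =1 q' -> stage p q -> stage p' q'.
Proof. by move=> /funext -> /funext ->. Qed.

Lemma stage_descend p q sd k : (0 < p sd)%N -> (p sd + ~~ sd + k <= (q sd).+1)%N ->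
  stage p q -> stage p (upd q sd (q sd - k)).
Proof.
move=> p0; elim: k => [|k IH] hk hs.
  by apply: stage_ext hs => // z; rewrite /upd; case: eqP => [->|]; rewrite ?subn0.
have e : upd q sd (q sd - k) sd = (q sd - k)%N by rewrite /upd eqxx.
have := @stage_step p (upd q sd (q sd - k)) sd p0; rewrite e => h.
have : stage p (upd (upd q sd (q sd - k)) sd (q sd - k).-1).
  by apply: h; [lia|apply: IH => //; lia].
by apply: stage_ext => // z; rewrite /upd; case: eqP => // _; lia.
Qed.

(** Boson [p] is done, and boson [p + 1] is declared to have passed all fermions beyond [Q]. Those
    levels are empty, so the new conditions hold by [fE_empty] and the content does not change. *)
Lemma stage_next p q sd : (0 < p sd)%N -> (q sd).+1 = (p sd + ~~ sd)%N -> (p sd <= Q)%N ->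
  stage p q -> stage (upd p sd (p sd).+1) (upd q sd Q).
Proof.
move=> p0 pq pQ [f [hf ff fn0 gf sf]].
have c0 sd' l : (Q < l)%N -> c sd' l = 0%N.
  move=> Ql; apply/eqP; rewrite -leqn0 leqNgt; apply/negP => c0.
  have := @galois sd' 1 l isT; rewrite c0 => /(_ (leq_ltn_trans (leq0n _) Ql)).
  by have := CjQ sd' (b := 1) isT; lia.
have e t : mm p q t = mm (upd p sd (p sd).+1) (upd q sd Q) t.
  have [sd' [k [k0 et]]] := fer_or_bos t.
  have [ds|ds] := eqVneq sd' sd; last first.
    by case: et => ->; rewrite ?mm_fer ?mm_bos// /upd (negPf ds).
  subst sd'; case: et => ->; rewrite ?mm_fer ?mm_bos// /upd eqxx.
    have [kQ|kQ] := ltnP Q k; first by rewrite c0.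
    by have := leq_b1 (q sd < k)%N; case: (sd) pq p0 => pq p0; lia.
  have C0 := CjQ sd (ltn0Sn (p sd)).
  have [->|kp] := eqVneq k (p sd); first by rewrite ltnn ltnSn; lia.
  have [->|kp'] := eqVneq k (p sd).+1; first by rewrite ltnn ltnNge leqnSn /=; lia.
  by have -> : (k < (p sd).+1)%N = (k < p sd)%N by lia.
exists f; split=> //; first exact: wvec_extm hf.
move=> t u; have [h|h] := boolP (bef (cr p q) t u); first by move=> _; exact: sf.
have [st|st] := eqVneq (0 < t) sd; last first.
  rewrite -(@bef_ext (cr p q)) ?(negPf h)// => b l.
  by rewrite /cr /upd (negPf st).
have [su|su] := eqVneq (0 < u) (0 < t); last by move: h; rewrite !bef_cross 1?eq_sym// => /negPf ->.
move=> h'; have tu := bef_irr h'.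
have emp r : r = t \/ r = u -> ~~ oddz r -> (Q < idx r)%N -> mm p q r = 0%N.
  by move=> _ ro Qr; rewrite /mm (negPf ro) c0.
have [sd1 [k [k0 et]]] := fer_or_bos t; have [sd2 [k' [k'0 eu]]] := fer_or_bos u.
have e1 : sd1 = sd by case: et st => ->; rewrite ?side_fer ?side_bos.
have e2 : sd2 = sd by case: eu su => ->; rewrite ?side_fer ?side_bos// st.
subst sd1 sd2; apply: (fE_empty hf tu).
case: et eu h h' emp => -> [] -> h h' emp; move: h h'; clear st su tu sf hf e.
- by rewrite !bef_ff// => /negPf ->.
- rewrite !bef_fb// /cr /upd /=; case: (sd) pq p0 pQ emp => pq p0 pQ emp; rewrite ?eqxx /=; try lia.
  move=> h h'; suff hm : mm p q (fer false k) = 0%N by rewrite hm eqxx andbT orbC leNgt side_fer.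
  by apply: emp; rewrite ?oddz_fer ?idx_fer//; [left|lia].
- rewrite !bef_bf// /cr /upd /=; case: (sd) pq p0 pQ emp => pq p0 pQ emp; rewrite ?eqxx /=; try lia.
  move=> h h'; suff hm : mm p q (fer true k') = 0%N by rewrite hm eqxx andbT side_fer.
  by apply: emp; rewrite ?oddz_fer ?idx_fer//; [right|lia].
- by rewrite !bef_bb// => /negPf ->.
Qed.

Lemma stage_cycle p sd : (0 < p sd)%N -> (p sd <= Q)%N ->
  stage p (fun=> Q) -> stage (upd p sd (p sd).+1) (fun=> Q).
Proof.
move=> p0 pQ hs; have := @stage_descend p (fun=> Q) sd (Q.+1 - (p sd + ~~ sd))%N p0.
move=> /(_ _ hs) h; have {}h := h ltac:(lia).
have := @stage_next p _ sd p0 _ pQ h; rewrite {1}/upd eqxx => /(_ ltac:(lia)).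
by apply: stage_ext => // z; rewrite /upd; case: (z == sd).
Qed.

Lemma stage_cycles p sd k : p sd = 1%N -> (k <= Q)%N ->
  stage p (fun=> Q) -> stage (upd p sd k.+1) (fun=> Q).
Proof.
move=> p1; elim: k => [|k IH] kQ hs.
  by apply: stage_ext hs => // z; rewrite /upd; case: eqP => [->|].
have e : upd p sd k.+1 sd = k.+1 by rewrite /upd eqxx.
have := @stage_cycle (upd p sd k.+1) sd; rewrite e => h.
have {}h := h isT kQ (IH (ltnW kQ) hs).
by apply: stage_ext h => // z; rewrite /upd; case: (z == sd).
Qed.

(** After [Q] bosons on each side, the order reached differs from the standard one only at pairs
    whose operator is zero because a level is empty. *)
Lemma stage_final : stage (fun=> 1%N) (fun=> Q) -> exists f (m : int -> nat),
  [/\ wvec m f, fin_supp f, f != 0, gen f0 f & (forall t u, t < u -> fE t u f = 0) /\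
    (forall sd k, (0 < k)%N -> m (fer sd k) = (c sd k - (k - ~~ sd))%N /\
       m (bos sd k) = (Cj sd k - (k + ~~ sd).-1)%N)].
Proof.
move=> h0.
have h1 := stage_cycles (k := Q) (sd := true) (p := fun=> 1%N) erefl (leqnn _) h0.
have h2 := stage_cycles (k := Q) (sd := false) (p := upd (fun=> 1%N) true Q.+1) erefl (leqnn _) h1.
have [f [hf ff fn0 gf sf]] : stage (fun=> Q.+1) (fun=> Q).
  by apply: stage_ext h2 => // -[].
have c0 sd' l : (Q < l)%N -> c sd' l = 0%N.
  move=> Ql; apply/eqP; rewrite -leqn0 leqNgt; apply/negP => c0.
  have := @galois sd' 1 l isT; rewrite c0 => /(_ (leq_ltn_trans (leq0n _) Ql)).
  by have := CjQ sd' (b := 1) isT; lia.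
have mf sd k : (0 < k)%N -> mm (fun=> Q.+1) (fun=> Q) (fer sd k) = (c sd k - (k - ~~ sd))%N.
  move=> k0; rewrite mm_fer//; have [kQ|kQ] := ltnP Q k; first by rewrite c0.
  by case: (sd); lia.
have mb sd k : (0 < k)%N -> mm (fun=> Q.+1) (fun=> Q) (bos sd k) = (Cj sd k - (k + ~~ sd).-1)%N.
  move=> k0; rewrite mm_bos// ltnS; have := CjQ sd k0; case: (leqP k Q) => // kQ.
  by case: eqP; case: (sd); lia.
exists f, (mm (fun=> Q.+1) (fun=> Q)); split=> //; split=> [t u tu|sd k k0]; last by rewrite mf ?mb.
have ntu : t != u by rewrite lt_eqF.
have [h|h] := boolP (bef (cr (fun=> Q.+1) (fun=> Q)) t u); first exact: sf.
have [st|st] := eqVneq (0 < t) (0 < u); last first.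
  by move: h; rewrite bef_cross//; move: st; case: (ltP 0 t) => ht; case: (ltP 0 u) => //; lia.
have [sd [k [k0 et]]] := fer_or_bos t; have [sd' [k' [k'0 eu]]] := fer_or_bos u.
have es : sd' = sd by case: et eu st => -> [] ->; rewrite ?side_fer ?side_bos.
subst sd'; apply: (fE_empty hf ntu); clear st sf hf gf ntu h0 h1 h2.
case: et eu tu h => -> [] -> ; case: (sd); rewrite ?(bef_bf, bef_fb, bef_ff, bef_bb)// /cr.
- by rewrite /fer /=; lia.
- by rewrite /fer /=; lia.
- by rewrite /fer /bos /=; have := leq_trans; lia.
- move=> tu h; rewrite mf// c0 ?eqxx ?leNgt ?side_fer ?orbT//.
  by move: tu h; rewrite /fer /bos /=; lia.
- move=> tu h; rewrite mf// c0 ?eqxx ?side_fer//.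
  by move: tu h; rewrite /fer /bos /=; lia.
- move=> tu h; suff e : mm (fun=> Q.+1) (fun=> Q) (bos false k) = 0%N.
    by rewrite e eqxx andbT orbC leNgt side_bos.
  by rewrite mb//; have := CjQ false k0; move: tu h; rewrite /fer /bos /=; lia.
- by rewrite /bos /=; lia.
- by rewrite /bos /=; lia.
Qed.

End OddReflections.

(** * Generalized Young diagrams and the weight Lambda(lam) *)

Lemma card_below n b : (b <= n)%N -> #|[pred i : 'I_n | (i < b)%N]| = b.
Proof.
move=> bn; rewrite -sum1_card (eq_bigl (fun i : 'I_n => (i < b)%N)) ?(big_ord_narrow bn) //.
by rewrite sum_nat_const card_ord muln1.
Qed.

Lemma card_initial n (P : pred 'I_n) b : (forall i j : 'I_n, (i <= j)%N -> P j -> P i) ->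
  (b < #|P|)%N = [exists i : 'I_n, (i == b :> nat) && P i].
Proof.
move=> hP; apply/idP/existsP => [bP|[i /andP[/eqP <- Pi]]].
  apply: contrapT => h; move: bP; apply/negP; rewrite -leqNgt.
  have [nb|bn] := leqP n b; first by apply: leq_trans nb; rewrite -[X in (_ <= X)%N]card_ord max_card.
  have nP : ~~ P (Ordinal bn) by apply/negP => Pb; apply: h; exists (Ordinal bn); rewrite eqxx.
  rewrite -[X in (_ <= X)%N](card_below (ltnW bn)).
  apply: subset_leq_card; apply/fintype.subsetP => i Pi; rewrite inE ltnNge.
  by apply: contra nP => bi; exact: hP Pi.
rewrite -(card_below (ltn_ord i)).
apply: subset_leq_card; apply/fintype.subsetP => j; rewrite inE ltnS => ji.
exact: hP Pi.
Qed.

Arguments fer : simpl never.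
Arguments bos : simpl never.

Section HighestVector.
Variables (C : numClosedFieldType) (n : nat) (lam : 'I_n -> int).
Hypothesis hlam : genpart lam.
Notation mode := (mode n).
Notation H := (fock C mode).
Notation fE := (@fE C n).
Notation gen := (gen (fun r s => fE r s)).
Implicit Types (f g : H) (i j : 'I_n) (r s t u : int).

Definition col_fun (sd : bool) (l : nat) : nat :=
  #|[pred i | if sd then l%:Z <= lam i else lam i <= - l%:Z]|.

(** On the nonpositive side rows are counted from the bottom, since dominance puts the negative rows
    last; only the part of the row on the side [sd] is measured. *)
Definition row_fun (sd : bool) (b : nat) : nat :=
  if b is b'.+1 then
    if insub (if sd then b' else n - b'.+1)%N is Some i then
      if (b' < n)%N then (if sd then `|Num.max (lam i) 0|%N else `|Num.max (- lam i) 0|%N) else 0%N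
    else 0%N
  else 0%N.

(** Both sides say that row [b] and column [l] meet in a box: by dominance the rows reaching column
    [l] form an initial segment, counted from the top or from the bottom according to the side. *)
Lemma row_col_galois sd b l : (0 < b)%N -> (0 < l)%N ->
  (b <= col_fun sd l)%N = (l <= row_fun sd b)%N.
Proof.
case: b => // b _ l0; rewrite /col_fun; case: sd.
  rewrite card_initial; last by move=> i j ij /= /le_trans; apply; exact: hlam.
  apply/existsP/idP => [[i /andP[/eqP <- /=]]|]; rewrite /row_fun.
    by rewrite valK ltn_ord; lia.
  case: insubP => [i bn ib|_]; last by lia.
  by rewrite bn => h; exists i; rewrite ib eqxx /=; lia.
pose P := [pred i : 'I_n | lam (rev_ord i) <= - l%:Z].
have -> : #|[pred i | lam i <= - l%:Z]| = #|P|.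
  rewrite -[X in _ = X](fintype.card_image rev_ord_inj P); apply: eq_card => i; rewrite inE.
  apply/idP/fintype.imageP => [h|[j hj ->]]; last by move: hj; rewrite inE.
  by exists (rev_ord i); rewrite ?rev_ordK// inE rev_ordK.
rewrite card_initial; last first.
  move=> i j ij /=; apply: le_trans; apply: hlam; rewrite /=; lia.
apply/existsP/idP => [[i /andP[/eqP <- /=]]|]; rewrite /row_fun.
  have -> : (n - i.+1)%N = rev_ord i by [].
  by rewrite valK ltn_ord; lia.
case: insubP => [i bn ib|_]; last by lia.
case: ifP => bn'; last by lia.
move=> h; exists (Ordinal bn'); rewrite eqxx /=.
have -> : rev_ord (Ordinal bn') = i by apply: val_inj; rewrite /= ib.
lia.
Qed.

Lemma row_fun_bound sd b : (0 < b)%N -> (row_fun sd b <= lam_bound lam)%N.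
Proof.
case: b => // b _; rewrite /row_fun; case: insubP => // i _ _; case: ifP => // _.
by have := lam_bound_ge lam i; case: (sd); lia.
Qed.

Lemma content_kap_fer sd l : (0 < l)%N -> content (kap lam) (fer sd l) = col_fun sd l.
Proof.
move=> l0; rewrite /content /col_fun -sum1_card [RHS]big_mkcond; apply: eq_bigr => i _.
rewrite /kap /= oddz_fer side_fer// inE /fer; case: (sd) => /=.
  have -> : ((2 * l)%N%:Z <= 2 * lam i) = (l%:Z <= lam i) by lia.
  by case: (_ <= _).
have -> : (2 * lam i < 2 - (2 * l)%N%:Z) = (lam i <= - l%:Z) by lia.
by case: (_ <= _).
Qed.

Lemma content_kap_bos sd b : content (kap lam) (bos sd b) = 0%N.
Proof. by apply: kap_odd; rewrite oddz_bos. Qed.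

Lemma kapf_raise_even t u : t < u -> ~~ oddz t -> ~~ oddz u -> fE t u (kapf C lam) = 0.
Proof.
move=> tu te ue; rewrite bil_neq ?lt_eqF// /bil big1// => i _.
have [ou|ou] := boolP (occ (i, u) (kap lam)); last by rewrite de_kapf// linear0.
have ot : occ (i, t) (kap lam) by move: ou; rewrite !occ_kap//; lia.
have nut : (i, u) != (i, t) by rewrite xpair_eqE eqxx gt_eqF.
apply/eqP; rewrite -oppr_eq0 -de_st_neq//.
by rewrite st_kapf// linear0.
Qed.

Lemma col_fun0 sd l : (lam_bound lam < l)%N -> col_fun sd l = 0%N.
Proof.
move=> hl; apply/eqP; rewrite -leqn0 leqNgt; apply/negP => c0.
have := row_col_galois sd (ltn0Sn 0) (leq_ltn_trans (leq0n _) hl); rewrite c0.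
by have := row_fun_bound sd (ltn0Sn 0); lia.
Qed.

(** An operator that raises for the initial order either is even and meets a filled sea, or needs a
    particle of an empty level, bosonic or beyond the bound. *)
Lemma stage_init :
  stage col_fun row_fun (kapf C lam) (fun=> 1%N) (fun=> lam_bound lam).
Proof.
have wk := @wvec_kapf C n lam.
exists (kapf C lam); split.
- apply: wvec_extm wk => t; have [sd [k [k0 [->|->]]]] := fer_or_bos t.
    rewrite mm_fer// content_kap_fer//= min0n add0n; have [kl|] := ltnP; last by rewrite subn0.
    by rewrite col_fun0.
  rewrite mm_bos// content_kap_bos ltnS leqn0 eqn0Ngt k0 /=; case: eqP => // ->.
  by apply/esym/eqP; rewrite subn_eq0 row_fun_bound.
- exact: fin_supp_kapf.
- exact: kapf_neq0.
- exact: gen_base.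
move=> t u htu; have ntu := bef_irr htu.
have emp := fE_empty wk ntu.
have [sd [k [k0 et]]] := fer_or_bos t; have [sd' [k' [k'0 eu]]] := fer_or_bos u.
have c0 (x : bool) l : (lam_bound lam < l)%N -> content (kap lam) (fer x l) = 0%N.
  by move=> hl; rewrite content_kap_fer ?col_fun0//; lia.
have [ds|ds] := eqVneq sd sd'; last first.
  have side : (0 < t) != (0 < u).
    by case: et => ->; case: eu => ->; rewrite ?side_fer ?side_bos.
  move: (htu); rewrite bef_cross// => t0.
  have u0 : 0 < u by move: side; rewrite ltNge t0 /=; case: (0 < u).
  case: et => et; last by apply: emp; rewrite et content_kap_bos eqxx -et t0 orbT.
  case: eu => eu; last by apply: emp; rewrite eu content_kap_bos eqxx -eu u0.
  by apply: kapf_raise_even; rewrite ?et ?eu ?oddz_fer// -et -eu; lia.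
subst sd'; move: htu; case: et => et; case: eu => eu; rewrite et eu.
- rewrite bef_ff// => h; apply: kapf_raise_even; rewrite ?oddz_fer//.
  by move: h; rewrite /fer; case: (sd) => /=; lia.
- rewrite bef_fb// -et -eu => h; apply: emp; rewrite eu content_kap_bos eqxx side_bos// andbT.
  case es: sd h et => //= h et; rewrite et c0 ?eqxx ?andbT ?leNgt ?side_fer//.
  by move: h; rewrite /cr; lia.
- rewrite bef_bf// -et -eu => h; apply: emp; rewrite et content_kap_bos eqxx leNgt side_bos// andbT.
  case es: sd h eu => //= h eu; last by rewrite orbT.
  by rewrite eu c0 ?eqxx ?andbT ?side_fer//; move: h; rewrite /cr; lia.
- rewrite -et -eu => _; apply: emp; rewrite {2}et {2}eu !content_kap_bos !eqxx !andbT leNgt.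
  by rewrite et eu !side_bos//; case: (sd).
Qed.

Lemma hwcoef_fer sd k : (0 < k)%N -> hwcoef lam (fer sd k) =
  (if sd then 1 else -1) * (col_fun sd k - (k - ~~ sd))%N%:Z.
Proof.
move=> k0; rewrite /hwcoef oddz_fer /=.
have -> : (fer sd k %/ 2)%Z = if sd then k%:Z else 1 - k%:Z.
  by rewrite /fer; case: (sd); lia.
have cl (a : int) (P : pred 'I_n) : (forall i, in_diagram lam i a = P i) -> col_len lam a = #|P|%:Z.
  move=> h; rewrite /col_len; congr Posz; apply: eq_card => i.
  by apply/idP/idP => [/set_mem|hi]; [|apply: mem_set]; rewrite /= h.
case: (sd).
  rewrite (cl _ [pred i | k%:Z <= lam i]) => [|i]; last by rewrite /in_diagram /=; lia.
  have -> : 0 < k%:Z by lia.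
  by rewrite mul1r -[#|_|]/(col_fun true k) /=; lia.
have -> : (0 < 1 - k%:Z) = false by lia.
rewrite (cl _ [pred i | lam i <= - k%:Z]) => [|i]; last by rewrite /in_diagram /=; lia.
by rewrite mulN1r -[#|_|]/(col_fun false k) /=; lia.
Qed.

Lemma row_lenE (j : int) : row_len lam j =
  if (0 < j) then (if insub (`|j|%N.-1) is Some i then lam i else 0) else 0.
Proof.
rewrite /row_len; case: (ltP 0 j) => j0; last by rewrite big1// => i /eqP; lia.
case: insubP => [i _ ei|hj].
  by rewrite (big_pred1 i) // => k /=; rewrite -val_eqE /= ei; lia.
by rewrite big1// => i /eqP e; have := ltn_ord i; move: hj; lia.
Qed.

Lemma hwcoef_bos sd k : (0 < k)%N -> hwcoef lam (bos sd k) =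
  (if sd then 1 else -1) * (row_fun sd k - (k + ~~ sd).-1)%N%:Z.
Proof.
case: k => // k _; rewrite /hwcoef oddz_bos /= side_bos//.
case: (sd).
  have -> : ((bos true k.+1 + 1) %/ 2)%Z = k.+1%:Z by rewrite /bos /=; lia.
  have -> : ((bos true k.+1 - 1) %/ 2)%Z = k%:Z by rewrite /bos /=; lia.
  rewrite row_lenE /row_fun /= mul1r; case: insubP => [i kn _|kn]; last by lia.
  by rewrite kn; lia.
have -> : ((bos false k.+1 + 1) %/ 2)%Z = - k%:Z by rewrite /bos /=; lia.
have -> : ((bos false k.+1 - 1) %/ 2)%Z = - k.+1%:Z by rewrite /bos /=; lia.
rewrite row_lenE /row_fun mulN1r; congr (- _).
have [kn|kn] := ltnP k n; last first.
  have -> : (0 < n%:Z - k%:Z) = false by lia.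
  by case: insubP => [i _ _|_]; lia.
have -> : 0 < n%:Z - k%:Z by lia.
have -> : (`|(n%:Z - k%:Z)%R|%N.-1) = (n - k.+1)%N by lia.
by case: insubP => [i _ _|_]; lia.
Qed.

Lemma highest_vector : exists f (m : int -> nat),
  [/\ wvec m f, fin_supp f, f != 0, gen (kapf C lam) f & (forall t u, t < u -> fE t u f = 0) /\
    (forall r, (hwcoef lam r) = (if 0 < r then (m r)%:Z else - (m r)%:Z))].
Proof.
have [f [m [wf ff f0 gf [sf hm]]]] := stage_final row_col_galois row_fun_bound stage_init.
exists f, m; split=> //; split=> // r.
have [sd [k [k0 er]]] := fer_or_bos r; have [h1 h2] := hm sd k k0.
case: er => ->; rewrite ?hwcoef_fer ?hwcoef_bos// ?side_fer ?side_bos// ?h1 ?h2.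
  by case: (sd); rewrite ?mul1r ?mulN1r.
by case: (sd); rewrite ?mul1r ?mulN1r.
Qed.

End HighestVector.

(** * Simplicity, and exhaustion of the singular vectors *)

Section FockIrreducible.
Variables (C : numClosedFieldType) (n : nat).
Notation mode := (mode n).
Notation H := (fock C mode).
Notation fE := (@fE C n).
Notation gen := (gen (fun r s => fE r s)).
Implicit Types (f g u w x y z : H) (i j : 'I_n) (r s t : int) (k : config mode).

Lemma fin_supp_gen u x : fin_supp u -> gen u x -> fin_supp x.
Proof.
move=> hu; elim=> {x} [|a x y _ hx _ hy|r s x _ hx] //; first exact: fin_suppZD.
exact: fin_supp_fE.
Qed.

Lemma form0r f : form f 0 = 0.
Proof. by rewrite /form fsbig1// => k _; rewrite conjC0 mulr0. Qed.

Lemma form0l f : form 0 f = 0.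
Proof. by rewrite /form fsbig1// => k _; rewrite mul0r. Qed.

Lemma nu_neq0 r : nu C r != 0.
Proof. by rewrite /nu; case: ifP => _; rewrite ?oner_neq0// expf_neq0// oppr_eq0 oner_neq0. Qed.

(** Contravariance yields in [gen x] a vector not orthogonal to [w]; a sieve then reduces that
    vector to a nonzero multiple of [w]. *)
Lemma fock_simple w (m : int -> nat) : wvec m w -> fin_supp w -> w != 0 ->
  (forall r s, r < s -> fE r s w = 0) -> cyclic_simple (fun r s => fE r s) w.
Proof.
move=> mw fw w0 sw x gx x0; have fx := fin_supp_gen fw gx.
pose Lam r := sg C r * (m r)%:R.
have ew : eigen (fun r s => fE r s) Lam w by move=> r; exact: wvec_weight.
(* Otherwise [x] would be orthogonal to all of [gen w], hence to itself. *)
have [y [gy yw]] : exists y, gen x y /\ form y w != 0.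
  apply: contrapT => h; case/eqP: x0; apply: form_eq0 => //.
  suff : forall z, gen w z -> forall y, gen x y -> form y z = 0 by apply=> //; exact: gen_base.
  move=> z; elim=> {z} [|a z z' hz IH hz' IH'|r s z hz IH] y gy.
  - by apply/eqP; apply: contraT => yw; case: h; exists y.
  - have fy := fin_supp_gen fx gy.
    by rewrite form_linearr ?IH ?IH' ?mulr0 ?addr0//; apply: fin_supp_gen fw _.
  - have fy := fin_supp_gen fx gy.
    have e := IH _ (gen_act s r gy); apply/eqP; move/eqP: e.
    rewrite /= form_fE//; last exact: fin_supp_gen fw hz.
    by rewrite !mulf_eq0 !(negPf (nu_neq0 _)).
have fy := fin_supp_gen fx gy.
have [c [l [hl /eqP e]]] := gen_top (@fE_rel C n) sw ew (gen_trans gx gy).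
(* Diagonal operators are self-adjoint with real eigenvalues on [w], so a sieve multiplies the
   pairing with [w] by the scalar by which it acts on [w]. *)
have hs l' : form (sieve (fun r s => fE r s) l' y) w = (\prod_(p <- l') (Lam p.1 - p.2)) * form y w.
  have fsl l'' : fin_supp (sieve (fun r s => fE r s) l'' y).
    by apply: fin_supp_gen fy _; apply: gen_sieve; exact: gen_base.
  elim: l' => [|p l' IH] /=; first by rewrite big_nil mul1r.
  rewrite big_cons addrC -scaleNr form_linearl//; last exact: fin_supp_fE.
  rewrite form_fE// nuK mul1r ew formZr// IH /Lam.
  rewrite rmorphM /= conjC_nat /sg; case: ifP => _; rewrite ?rmorphN ?rmorph1; ring.
have p0 := sieve_v_neq0 hl.
move: e; rewrite linearB /= subr_eq0 [sieve _ _ (_ *: _)]linearZ /= (sieve_v ew) scalerA => /eqP e.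
have cp : c * \prod_(p <- l) (Lam p.1 - p.2) != 0.
  apply: contraTneq yw => cp; rewrite cp scale0r in e.
  have := hs l; rewrite e form0l => /esym/eqP; rewrite mulf_eq0 (negPf p0) /= => ->//.
have -> : w = (c * \prod_(p <- l) (Lam p.1 - p.2))^-1 *: sieve (fun r s => fE r s) l y.
  by rewrite e scalerA mulVf ?scale1r.
by apply: genZ; apply: gen_sieve.
Qed.

(** Gram-Schmidt along the list [l]: the vectors of [P] vanishing at the first configuration form a
    subspace of codimension at most one. *)
Lemma orthogonal_projection (l : seq (config mode)) (P : H -> Prop) f :
  P 0 -> (forall a u v, P u -> P v -> P (a *: u + v)) ->
  (forall u, P u -> fin_supp u /\ forall k, u k != 0 -> k \in l) -> fin_supp f ->
  exists2 g, P g & forall u, P u -> form (f - g) u = 0.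
Proof.
elim: l P f => [|k l IH] P f P0 PL Ps ff.
  exists 0 => // u Pu; suff -> : u = 0 by rewrite form0r.
  apply/funext => k; apply/eqP; apply: contraT => uk.
  by have [_ /(_ k uk)] := Ps u Pu.
have PZ a u : P u -> P (a *: u) by move=> Pu; rewrite -[_ *: _]addr0; exact: PL.
have PB u v : P u -> P v -> P (u - v) by move=> Pu Pv; rewrite addrC -scaleN1r; exact: PL.
pose P' u := P u /\ u k = 0.
have P'0 : P' 0 by [].
have P'L a u v : P' u -> P' v -> P' (a *: u + v).
  by move=> [Pu uk] [Pv vk]; split; [exact: PL|rewrite addfE scalefE uk vk mulr0 addr0].
have P's u : P' u -> fin_supp u /\ forall k', u k' != 0 -> k' \in l.
  move=> [Pu uk]; have [fu su] := Ps u Pu; split=> // k' uk'.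
  by have := su k' uk'; rewrite inE => /orP[/eqP e|//]; rewrite e uk eqxx in uk'.
have [[u [Pu uk]]|h] := pselect (exists u, P u /\ u k != 0); last first.
  have [g [Pg gk] hg] := IH P' f P'0 P'L P's ff; exists g => // u Pu.
  apply: hg; split=> //; apply/eqP; apply: contraT => uk.
  by case: h; exists u.
have [fu _] := Ps u Pu.
have [g [Pg gk] hg] := IH P' u P'0 P'L P's fu.
have [fg _] := Ps g Pg.
(* [u'] is orthogonal to the vectors of [P] vanishing at [k], and together with them it spans
   [P]. *)
pose u' := u - g; have Pu' : P u' by exact: PB.
have [fu' _] := Ps u' Pu'.
have u'k : u' k = u k by rewrite /u' addfE oppfE gk subr0.
have nu' : form u' u' != 0.
  by apply: contraNneq uk => /(form_eq0 fu') e; rewrite -u'k e.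
have [g' [Pg' _] hg'] := IH P' f P'0 P'L P's ff.
have [fg' _] := Ps g' Pg'.
have fB a b : fin_supp a -> fin_supp b -> fin_supp (a - b).
  by move=> ha hb; rewrite addrC -scaleN1r; exact: fin_suppZD.
pose c := form (f - g') u' / form u' u'.
exists (c *: u' + g'); first exact: PL.
move=> z Pz; have [fz _] := Ps z Pz.
pose d := z k / u' k.
have u'k0 : u' k != 0 by rewrite u'k.
have Pz' : P' (- d *: u' + z).
  split; first exact: PL.
  by rewrite addfE scalefE /d mulNr divfK// addNr.
have [fz' _] := P's _ Pz'.
have -> : z = d *: u' + (- d *: u' + z) by rewrite addrA -scalerDl subrr scale0r add0r.
have -> : f - (c *: u' + g') = (- c) *: u' + (f - g').
  by rewrite opprD addrCA scaleNr.
rewrite form_linearr//; last by apply: fin_suppZD => //; exact: fB.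
rewrite !form_linearl ?(hg _ Pz') ?(hg' _ Pz')//; try exact: fB.
by rewrite mulr0 addr0 addr0 /c mulNr divfK// addNr mulr0.
Qed.

Definition config_set (m : int -> nat) : set (config mode) :=
  [set k | (forall r, content k r = m r) /\ good k]%classic.

Lemma finite_configs W m : finw W m -> finite_set (config_set m).
Proof.
move=> hW; pose B := (\sum_(r <- win W) m r)%N.
pose g (x : {ffun 'I_n * 'I_W.*2.+1 -> 'I_B.+1}) : config mode := fun q =>
  if (`|q.2| <= W)%N then nat_of_ord (x (q.1, inord `|(q.2 + W%:Z)%R|%N)) else 0%N.
have fT : finite_set [set: {ffun 'I_n * 'I_W.*2.+1 -> 'I_B.+1}] by exact: finite_finset.
apply: sub_finite_set (finite_image g fT) => k /= [ck _].
have kB i r : (k (i, r) <= m r)%N by rewrite -ck /content (bigD1 i)//= leq_addr.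
exists [ffun x : 'I_n * 'I_W.*2.+1 => inord (k (x.1, (x.2 : nat)%:Z - W%:Z))] => //.
apply/funext => -[i r]; rewrite /g /=; case: leqP => hr; last first.
  by have := kB i r; rewrite hW// leqn0 => /eqP.
rewrite ffunE /= inordK inordK; try lia.
  by congr (k (_, _)); lia.
have -> : `|(r + W%:Z)%R|%N%:Z - W%:Z = r by lia.
rewrite ltnS; apply: leq_trans (kB i r) _.
by rewrite /B (bigD1_seq r) ?mem_win ?win_uniq//= leq_addr.
Qed.

Lemma wvec_disjoint m m' f g : wvec m f -> wvec m' g -> m <> m' -> form f g = 0.
Proof.
move=> hf hg mm'; rewrite /form fsbig1// => k _.
have [->|fk] := eqVneq (f k) 0; first by rewrite mul0r.
have [->|gk] := eqVneq (g k) 0; first by rewrite conjC0 mulr0.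
by case: mm'; apply/funext => r; have [<- _] := hf k fk; have [<- _] := hg k gk.
Qed.

Lemma wvec_act m f r s : wvec m f -> exists m', wvec m' (fE r s f).
Proof.
have [<-|rs] := eqVneq r s => hf; last by exists (m_act r s m); exact: fE_wvec.
by exists m; rewrite (wvec_weight _ hf); exact: wvecZ.
Qed.

(** Let [h] be [f] minus its projection to the part of [gen w] of content [m]. It is still singular
    for gl_n, and contravariance makes [gen h] orthogonal to the weight vectors of [gen w]. If [h]
    were nonzero, [kapf] would lie in both and be orthogonal to itself. *)
Lemma hwm_gen lam w mw W m f : wvec mw w -> fin_supp w -> gen w (kapf C lam) ->
  hwm lam w -> finw W m -> wvec m f -> fin_supp f -> hwm lam f -> gen w f.
Proof.
move=> hw fw gk hlw hW hf ff hlf.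
pose P z := gen w z /\ wvec m z.
have fs z : P z -> fin_supp z /\ forall k, z k != 0 -> k \in fset_set (config_set m).
  move=> [gz mz]; split; first exact: fin_supp_gen gz.
  by move=> k /mz h; rewrite in_fset_set; [exact: mem_set|exact: finite_configs hW].
have [g [gg mg] hg] : exists2 g, P g & forall u, P u -> form (f - g) u = 0.
  apply: (orthogonal_projection (l := fset_set (config_set m))) => //.
  - by split; [exact: gen0|exact: wvec0].
  - by move=> a u v [? ?] [? ?]; split; [exact: gen_lin|exact: wvecP].
have fg := fin_supp_gen fw gg.
pose h := f - g.
have mh : wvec m h by rewrite /h addrC -scaleN1r; exact: wvecP.
have fh : fin_supp h by rewrite /h addrC -scaleN1r; exact: fin_suppZD.
have hlg : hwm lam g.
  elim: gg {mg hg fg h mh fh} => {g} [|a x y _ hx _ hy|r s x _ hx] //; first exact: hwmP.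
  exact: hwm_fE.
have hlh : hwm lam h by rewrite /h addrC -scaleN1r; exact: hwmP.
have [h0|h0] := eqVneq h 0; first by rewrite -[f](subrK g) -/h h0 add0r.
have gkh := reach_kapf hW mh fh h0 hlh.
suff orth : forall y, gen h y -> forall z, gen w z -> (exists m', wvec m' z) -> form y z = 0.
  have ek : exists m', wvec m' (kapf C lam) by eexists; exact: wvec_kapf.
  have /(form_eq0 (fin_supp_kapf C lam)) /eqP := orth _ gkh _ gk ek.
  by rewrite (negPf (kapf_neq0 C lam)).
move=> y; elim=> {y} [|a x y hx IHx hy IHy|r s y hy IH] z gz [m' mz].
- have [em|mm'] := pselect (m = m'); last exact: wvec_disjoint mh mz mm'.
  by apply: hg; split=> //; rewrite em.
- have fx := fin_supp_gen fh hx; have fy := fin_supp_gen fh hy.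
  rewrite form_linearl ?IHx ?IHy ?mulr0 ?addr0//.
  + by exists m'.
  + by exists m'.
- have fy := fin_supp_gen fh hy; have fz := fin_supp_gen fw gz; rewrite form_fE//.
  by rewrite IH ?mulr0//; [exact: (gen_act s r gz)|exact: wvec_act mz].
Qed.

End FockIrreducible.

(** * Highest weight multiplicities of unitary gl_n-modules *)

Section HermitianFunctions.
Variables (C : numClosedFieldType) (B : finType).
Notation U := {ffun B -> C^o}.
Implicit Types (f g h : U) (a : C).

Definition hform f g : C := \sum_b f b * (g b)^*.

Lemma hformC f g : hform g f = (hform f g)^*.
Proof.
rewrite /hform rmorph_sum; apply: eq_bigr => b _ /=.
by rewrite rmorphM /= conjCK mulrC.
Qed.
Lemma hform_linl a f g h : hform (a *: f + g) h = a * hform f h + hform g h.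
Proof.
rewrite /hform mulr_sumr -big_split; apply: eq_bigr => b _ /=.
by rewrite !ffunE mulrDl mulrA.
Qed.
Lemma hform_linr a f g h : hform h (a *: f + g) = a^* * hform h f + hform h g.
Proof. by rewrite hformC hform_linl rmorphD rmorphM /= -!hformC. Qed.
Lemma hform0l f : hform 0 f = 0.
Proof. by rewrite /hform big1// => b _; rewrite ffunE mul0r. Qed.
Lemma hform0r f : hform f 0 = 0.
Proof. by rewrite hformC hform0l conjC0. Qed.
Lemma hformDl f g h : hform (f + g) h = hform f h + hform g h.
Proof. by have := hform_linl 1 f g h; rewrite scale1r mul1r. Qed.
Lemma hformDr f g h : hform h (f + g) = hform h f + hform h g.
Proof. by have := hform_linr 1 f g h; rewrite scale1r conjC1 mul1r. Qed.
Lemma hformNl f h : hform (- f) h = - hform f h.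
Proof. by have := hform_linl (-1) f 0 h; rewrite addr0 scaleN1r mulN1r hform0l addr0. Qed.
Lemma hformNr f h : hform h (- f) = - hform h f.
Proof. by rewrite hformC hformNl rmorphN /= -hformC. Qed.
Lemma hformBr f g h : hform h (f - g) = hform h f - hform h g.
Proof. by rewrite hformDr hformNr. Qed.
Lemma hform_suml (I : Type) (r : seq I) (P : pred I) (F : I -> U) h :
  hform (\sum_(i <- r | P i) F i) h = \sum_(i <- r | P i) hform (F i) h.
Proof. by apply: (big_morph (fun x => hform x h)) => [x y|]; rewrite ?hformDl ?hform0l. Qed.
Lemma hform_sumr (I : Type) (r : seq I) (P : pred I) (F : I -> U) h :
  hform h (\sum_(i <- r | P i) F i) = \sum_(i <- r | P i) hform h (F i).
Proof. by apply: (big_morph (fun x => hform h x)) => [x y|]; rewrite ?hformDr ?hform0r. Qed.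
Lemma hform_ge0 f : 0 <= hform f f.
Proof. by rewrite sumr_ge0// => b _; exact: mul_conjC_ge0. Qed.
Lemma hform_eq0 f : hform f f = 0 -> f = 0.
Proof.
move=> /eqP; rewrite psumr_eq0 => [/allP h|b _]; last exact: mul_conjC_ge0.
apply/ffunP => b; have := h b (mem_index_enum b).
by rewrite /= mul_conjC_eq0 ffunE => /eqP.
Qed.

End HermitianFunctions.

Section UnitaryGl.
Variable C : numClosedFieldType.

(** Modules are functions on a finite set of weight vectors, so that weights are counted on basis
    elements and tensoring with an exterior algebra only replaces [B] by [B * {set 'I_n}]. *)
Record gl_unitary (n : nat) (B : finType) (wt : B -> 'I_n -> int)
    (X : 'I_n -> 'I_n -> 'End({ffun B -> C^o})) : Prop := GlUnitary {
  glu_rel : forall i j k l u, X i j (X k l u) =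
    X k l (X i j u) + (j == k)%:R *: X i l u - (l == i)%:R *: X k j u;
  glu_adj : forall i j u v, hform (X i j u) v = hform u (X j i v);
  glu_diag : forall i u b, X i i u b = (wt b i)%:~R * u b }.

Definition restrict (B : finType) (P : pred B) (u : {ffun B -> C^o}) : {ffun B -> C^o} :=
  [ffun b => if P b then 0 else u b].
Fact restrict_is_linear (B : finType) (P : pred B) : linear (restrict P).
Proof. by move=> a u v; apply/ffunP => b; rewrite !ffunE; case: ifP; rewrite ?scaler0 ?addr0. Qed.
HB.instance Definition _ (B : finType) (P : pred B) :=
  GRing.isLinear.Build C {ffun B -> C^o} {ffun B -> C^o} _ (restrict P) (restrict_is_linear P).

(** [Z] selects basis elements whose span is stable: the induction restricts to a parity and a
    degree in this way, without changing the module. *)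
Definition hwsp (n : nat) (B : finType) (wt : B -> 'I_n -> int)
    (X : 'I_n -> 'I_n -> 'End({ffun B -> C^o})) (Z : pred B) (lam : 'I_n -> int) :
    {vspace {ffun B -> C^o}} :=
  ((\bigcap_(p : 'I_n * 'I_n | (p.1 < p.2)%N) lker (X p.1 p.2))
   :&: lker (linfun (restrict [pred b | Z b && [forall i, wt b i == lam i]])))%VS.

Lemma hwspP (n : nat) (B : finType) (wt : B -> 'I_n -> int)
  (X : 'I_n -> 'I_n -> 'End({ffun B -> C^o})) (Z : pred B) lam (u : {ffun B -> C^o}) : reflect
  ((forall i j : 'I_n, (i < j)%N -> X i j u = 0) /\
   (forall b, ~~ (Z b && [forall i, wt b i == lam i]) -> u b = 0))
  (u \in hwsp wt X Z lam).
Proof.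
rewrite memv_cap memv_ker lfunE /=; apply: (iffP andP) => [[h1 /eqP h2]|[h1 h2]]; split.
- move=> i j ij; apply/eqP; rewrite -memv_ker.
  by move: h1; rewrite !memvE => /subv_bigcapP/(_ (i, j) ij).
- move=> b hb; have := congr1 (fun x : {ffun B -> C^o} => x b) h2.
  by rewrite !ffunE /= (negPf hb).
- by rewrite memvE; apply/subv_bigcapP => -[i j] /= ij; rewrite -memvE memv_ker h1.
- by apply/eqP/ffunP => b; rewrite !ffunE; case: ifPn => //= /h2.
Qed.

End UnitaryGl.

(** * Exterior multiplication and contraction *)

Section Clifford.
Variables (C : numClosedFieldType) (B : finType) (n : nat).
Notation B' := (B * {set 'I_n})%type.
Notation U := {ffun B -> C^o}.
Notation U' := {ffun B' -> C^o}.
Implicit Types (f g : U') (i j k : 'I_n) (S : {set 'I_n}).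

Definition sgs i S : C := (-1) ^+ #|[set j in S | (j < i)%N]|.

Lemma sgs_U1 i j S : j \notin S -> sgs i (j |: S)%SET = (-1) ^+ (j < i)%N * sgs i S.
Proof.
move=> jS; rewrite /sgs -exprD; congr (_ ^+ _).
have [ji|ji] := ltnP j i.
  have -> : [set k in (j |: S)%SET | (k < i)%N]%SET = (j |: [set k in S | (k < i)%N])%SET.
    by apply/setP => k; rewrite !inE; case: eqP => // ->; rewrite ji.
  by rewrite cardsU1 !inE (negPf jS).
congr #|pred_of_set _|; apply/setP => k; rewrite !inE; case: eqP => // ->.
by rewrite ltnNge ji (negPf jS).
Qed.

Lemma sgsK i S : sgs i S * sgs i S = 1.
Proof. by rewrite -expr2 sqrr_sign. Qed.

Definition psi_p i f : U' := [ffun x : B' => if i \in x.2 then sgs i x.2 * f (x.1, x.2 :\ i)%SET else 0].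
Definition psi_m i f : U' := [ffun x : B' => if i \in x.2 then 0 else sgs i x.2 * f (x.1, i |: x.2)%SET].
Definition tens (A : 'End(U)) f : U' := [ffun x : B' => A [ffun b => f (b, x.2)] x.1].

Fact psi_p_is_linear i : linear (psi_p i).
Proof.
move=> a f g; apply/ffunP => x; rewrite !ffunE; case: ifP => _; last by rewrite scaler0 addr0.
by rewrite mulrDr mulrCA.
Qed.
HB.instance Definition _ i := GRing.isLinear.Build C U' U' _ (psi_p i) (psi_p_is_linear i).
Fact psi_m_is_linear i : linear (psi_m i).
Proof.
move=> a f g; apply/ffunP => x; rewrite !ffunE; case: ifP => _; first by rewrite scaler0 addr0.
by rewrite mulrDr mulrCA.
Qed.
HB.instance Definition _ i := GRing.isLinear.Build C U' U' _ (psi_m i) (psi_m_is_linear i).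
Fact tens_is_linear A : linear (tens A).
Proof.
move=> a f g; apply/ffunP => x; rewrite !ffunE.
have -> : [ffun b => (a *: f + g) (b, x.2)] =
    a *: [ffun b => f (b, x.2)] + [ffun b => g (b, x.2)] :> U.
  by apply/ffunP => b; rewrite !ffunE.
by rewrite linearP !ffunE.
Qed.
HB.instance Definition _ A := GRing.isLinear.Build C U' U' _ (tens A) (tens_is_linear A).

Lemma sgs_swap i j S : i != j -> i \notin S -> j \notin S ->
  sgs i S * sgs j (i |: S)%SET = - (sgs j S * sgs i (j |: S)%SET).
Proof.
move=> ij iS jS; rewrite !sgs_U1// mulrCA [sgs j S * _]mulrCA [sgs j S * _]mulrC -mulNr.
congr (_ * _); have : (i != j :> nat) by [].
by case: ltngtP => //= _ _; rewrite ?expr0 ?expr1 ?opprK.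
Qed.

Lemma psi_mm i j f : psi_m i (psi_m j f) = - psi_m j (psi_m i f).
Proof.
apply/ffunP => -[b S]; rewrite !ffunE /= !inE.
have [->|ij] := eqVneq i j; first by rewrite /= mulr0 if_same oppr0.
rewrite /=; case: ifPn => iS; case: ifPn => jS; rewrite ?mulr0 ?oppr0//.
by rewrite !mulrA (sgs_swap ij iS jS) mulNr finset.setUCA.
Qed.

Lemma hform_psi i f g : hform (psi_p i f) g = hform f (psi_m i g).
Proof.
rewrite /hform (bigID (fun x : B' => i \in x.2)) /= [X in _ + X]big1 ?addr0; last first.
  by move=> x /negPf ix; rewrite ffunE ix mul0r.
rewrite [RHS](bigID (fun x : B' => i \in x.2)) /= [X in _ = X + _]big1 ?add0r; last first.
  by move=> x ix; rewrite ffunE ix conjC0 mulr0.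
rewrite (reindex_onto (fun x : B' => (x.1, i |: x.2)%SET) (fun x : B' => (x.1, x.2 :\ i)%SET)) /=; last first.
  by move=> [b S] /= iS; rewrite finset.setD1K.
apply: eq_big => [[b S]|[b S]] /=.
  rewrite finset.setU11 /=; apply/eqP/idP => [[<-]|iS]; first by rewrite !inE eqxx.
  by rewrite finset.setU1K.
rewrite finset.setU11 /= => /eqP[eS]; have iS : i \notin S by rewrite -eS !inE eqxx.
rewrite !ffunE /= finset.setU11 (negPf iS) finset.setU1K// rmorphM /= rmorph_sign sgs_U1//.
by rewrite ltnn expr0 mul1r -/(sgs i S); ring.
Qed.

Lemma hform_ext f g : (forall h, hform f h = hform g h) -> f = g.
Proof.
move=> e; apply/eqP; rewrite -subr_eq0; apply/eqP/hform_eq0.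
by rewrite hformDl hformNl e addrN.
Qed.

Lemma hform_psi_m i f g : hform (psi_m i f) g = hform f (psi_p i g).
Proof. by rewrite hformC -hform_psi -hformC. Qed.

Lemma psi_pp i j f : psi_p i (psi_p j f) = - psi_p j (psi_p i f).
Proof. by apply: hform_ext => h; rewrite !hform_psi psi_mm hformNr hformNl !hform_psi. Qed.

Lemma sgs_id i S : sgs i (i |: S)%SET = sgs i S.
Proof.
rewrite /sgs; congr (_ ^+ #|pred_of_set _|); apply/setP => k; rewrite !inE.
by case: eqP => [->|//]; rewrite ltnn !andbF.
Qed.

Lemma sgs_D1 i S : sgs i (S :\ i)%SET = sgs i S.
Proof.
rewrite /sgs; congr (_ ^+ #|pred_of_set _|); apply/setP => k; rewrite !inE.
by case: eqP => [->|//]; rewrite ltnn !andbF.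
Qed.

Lemma psi_mp i j f : psi_m i (psi_p j f) = - psi_p j (psi_m i f) + (i == j)%:R *: f.
Proof.
apply/ffunP => -[b S]; rewrite !ffunE /= !inE.
have [<-|ij] := eqVneq i j.
  rewrite ?eqxx /= scale1r; case: ifPn => iS.
    by rewrite sgs_D1 finset.setD1K// mulrA sgsK mul1r addNr.
  by rewrite oppr0 add0r finset.setU1K// mulrA sgs_id sgsK mul1r.
rewrite scale0r addr0 /=.
case: ifPn => iS; case: ifPn => jS; rewrite ?mulr0 ?oppr0//.
have jT : j \notin (S :\ j)%SET by rewrite !inE eqxx.
have iT : i \notin (S :\ j)%SET by rewrite !inE negb_and iS orbT.
have eS : (j |: (S :\ j))%SET = S by rewrite finset.setD1K.
have -> : ((i |: S) :\ j)%SET = (i |: S :\ j)%SET.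
  by apply/setP => k; rewrite !inE; case: (k =P i) => [->|_]; rewrite ?orbF//= ij.
rewrite !mulrA -mulNr; congr (_ * _).
have -> : sgs i S = (-1) ^+ (j < i)%N * sgs i (S :\ j)%SET by rewrite -sgs_U1// eS.
have sg : (-1) ^+ (j < i)%N * (-1) ^+ (i < j)%N = -1 :> C.
  have : (i != j :> nat) by [].
  by case: ltngtP => //= _ _; rewrite expr0 expr1 ?mul1r ?mulr1.
by rewrite sgs_U1// mulrACA sg mulN1r [sgs j S * _]mulrC.
Qed.

Definition slice S f : U := [ffun b => f (b, S)].
Fact slice_is_linear S : linear (slice S).
Proof. by move=> a f g; apply/ffunP => b; rewrite !ffunE. Qed.
HB.instance Definition _ S := GRing.isLinear.Build C U' U _ (slice S) (slice_is_linear S).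

Lemma slice_tens S A f : slice S (tens A f) = A (slice S f).
Proof. by apply/ffunP => b; rewrite !ffunE. Qed.

Lemma slice_psi_p S i f :
  slice S (psi_p i f) = if i \in S then sgs i S *: slice (S :\ i)%SET f else 0.
Proof. by apply/ffunP => b; rewrite !ffunE /=; case: ifP; rewrite !ffunE. Qed.

Lemma slice_psi_m S i f :
  slice S (psi_m i f) = if i \in S then 0 else sgs i S *: slice (i |: S)%SET f.
Proof. by apply/ffunP => b; rewrite !ffunE /=; case: ifP; rewrite !ffunE. Qed.

Lemma sliceP f g : (forall S, slice S f = slice S g) -> f = g.
Proof.
move=> e; apply/ffunP => -[b S].
by have := congr1 (fun u : U => u b) (e S); rewrite !ffunE.
Qed.

Lemma tens_psi_p A i f : tens A (psi_p i f) = psi_p i (tens A f).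
Proof.
apply: sliceP => S; rewrite slice_tens !slice_psi_p.
by case: ifP; rewrite ?linear0// linearZ slice_tens.
Qed.

Lemma tens_psi_m A i f : tens A (psi_m i f) = psi_m i (tens A f).
Proof.
apply: sliceP => S; rewrite slice_tens !slice_psi_m.
by case: ifP; rewrite ?linear0// linearZ slice_tens.
Qed.

Lemma hform_slice f g : hform f g = \sum_S hform (slice S f) (slice S g).
Proof.
rewrite /hform exchange_big pair_big; apply: eq_bigr => -[b S] _ /=.
by rewrite !ffunE.
Qed.

Lemma hform_tens (A A' : 'End(U)) f g : (forall u v : U, hform (A u) v = hform u (A' v)) ->
  hform (tens A f) g = hform f (tens A' g).
Proof. by move=> h; rewrite !hform_slice; apply: eq_bigr => S _; rewrite !slice_tens. Qed.

End Clifford.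

(** * The Dirac operator of gl_n inside gl_(n+1) *)

Definition supported (T : Type) (C : nmodType) (P : pred T) (f : T -> C) : Prop :=
  forall x, ~~ P x -> f x = 0.

Section DiracStep.
Variables (C : numClosedFieldType) (n : nat) (B : finType).
Variables (wt : B -> 'I_n.+1 -> int) (X : 'I_n.+1 -> 'I_n.+1 -> 'End({ffun B -> C^o})).
Hypothesis uX : gl_unitary wt X.
Notation B' := (B * {set 'I_n})%type.
Notation U := {ffun B -> C^o}.
Notation U' := {ffun B' -> C^o}.
Implicit Types (f g : U') (i j k : 'I_n) (S : {set 'I_n}).

Let z : 'I_n.+1 := ord_max.
Let w (i : 'I_n) : 'I_n.+1 := widen_ord (leqnSn n) i.
Local Notation T := (fun a b => tens (X a b)).
Local Notation pp := (@psi_p C B n).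
Local Notation pm := (@psi_m C B n).

Lemma wz i : (w i == z) = false.
Proof. by apply/eqP => /(congr1 val) /= h; have := ltn_ord i; rewrite h ltnn. Qed.
Lemma zw i : (z == w i) = false.
Proof. by rewrite eq_sym wz. Qed.
Lemma ww i j : (w i == w j) = (i == j).
Proof. by []. Qed.

Lemma tens_rel a b c d f : T a b (T c d f) =
  T c d (T a b f) + (b == c)%:R *: T a d f - (d == a)%:R *: T c b f.
Proof.
apply: sliceP => S; rewrite linearB linearD !linearZ /= !slice_tens.
by rewrite (glu_rel uX) scalerN.
Qed.

Lemma tens_adj a b f g : hform (T a b f) g = hform f (T b a g).
Proof. exact: hform_tens (glu_adj uX a b). Qed.

Lemma tens_diag a f (x : B') : T a a f x = (wt x.1 a)%:~R * f x.
Proof. by rewrite ffunE (glu_diag uX) ffunE; case: x. Qed.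

(** The action of gl_n on the tensor product with the exterior algebra of the dual of its standard
    module; hence the minus sign and the transposed indices. *)
Definition yop i j f : U' := T (w i) (w j) f - pp j (pm i f).
Fact yop_is_linear i j : linear (yop i j).
Proof.
move=> a f g; rewrite /yop [pm i _]linearP /= [pp j _]linearP [tens _ _]linearP /=.
by rewrite scalerBr opprD addrACA.
Qed.
HB.instance Definition _ i j := GRing.isLinear.Build C U' U' _ (yop i j) (yop_is_linear i j).

Definition dop f : U' := \sum_i T (w i) z (pp i f).
Definition eop f : U' := \sum_i T z (w i) (pm i f).
Definition dirac f : U' := dop f + eop f.
Fact dop_is_linear : linear dop.
Proof.
move=> a f g; rewrite /dop scaler_sumr -big_split; apply: eq_bigr => i _ /=.
by rewrite [pp i _]linearP [tens _ _]linearP.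
Qed.
HB.instance Definition _ := GRing.isLinear.Build C U' U' _ dop dop_is_linear.
Fact eop_is_linear : linear eop.
Proof.
move=> a f g; rewrite /eop scaler_sumr -big_split; apply: eq_bigr => i _ /=.
by rewrite [pm i _]linearP [tens _ _]linearP.
Qed.
HB.instance Definition _ := GRing.isLinear.Build C U' U' _ eop eop_is_linear.
Fact dirac_is_linear : linear dirac.
Proof. by move=> a f g; rewrite /dirac [dop _]linearP [eop _]linearP /= scalerDr addrACA. Qed.
HB.instance Definition _ := GRing.isLinear.Build C U' U' _ dirac dirac_is_linear.

Lemma hform_dop f g : hform (dop f) g = hform f (eop g).
Proof.
rewrite hform_suml hform_sumr; apply: eq_bigr => i _.
by rewrite tens_adj hform_psi -tens_psi_m.
Qed.
Lemma hform_eop f g : hform (eop f) g = hform f (dop g).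
Proof. by rewrite hformC -hform_dop -hformC. Qed.
Lemma hform_dirac f g : hform (dirac f) g = hform f (dirac g).
Proof. by rewrite hformDl hformDr hform_dop hform_eop addrC. Qed.

Lemma yop_adj i j f g : hform (yop i j f) g = hform f (yop j i g).
Proof. by rewrite /yop hformDl hformNl hformBr tens_adj hform_psi hform_psi_m. Qed.

Lemma yop_diag i f (x : B') : yop i i f x = (wt x.1 (w i) - (i \in x.2)%:Z)%:~R * f x.
Proof.
rewrite /yop !ffunE /= -/(T _ _ f x) (glu_diag uX) ffunE intrB mulrBl.
case: x => b S /=; congr (_ - _); rewrite /= !inE eqxx /=; case: ifPn => iS; last by rewrite mul0r.
by rewrite finset.setD1K// mulrA sgs_D1 sgsK.
Qed.

Lemma yop_rel i j k l f : yop i j (yop k l f) =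
  yop k l (yop i j f) + (j == k)%:R *: yop i l f - (l == i)%:R *: yop k j f.
Proof.
rewrite /yop !linearB /= !tens_psi_p !tens_psi_m tens_rel !ww.
have -> : pp j (pm i (pp l (pm k f))) = pp j (pp l (pm k (pm i f))) + (i == l)%:R *: pp j (pm k f).
  rewrite psi_mp [pm i (pm k f)]psi_mm [pp l (- _)]linearN opprK.
  by rewrite [pp j (_ + _)]linearD /= [pp j (_ *: _)]linearZ.
have -> : pp l (pm k (pp j (pm i f))) = pp j (pp l (pm k (pm i f))) + (k == j)%:R *: pp l (pm i f).
  rewrite psi_mp [pp l (_ + _)]linearD /= [pp l (- _)]linearN /= [pp l (_ *: _)]linearZ /=.
  by rewrite [pp l (pp j _)]psi_pp opprK.
rewrite (eq_sym k) (eq_sym i) !opprK.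
set a1 := tens _ _; set a2 := tens _ _; set a3 := tens _ _; set a4 := pp l _.
set a5 := pp j _; set a6 := pp j _; set a7 := pp j _; set a8 := pp l _.
by apply/ffunP => x; rewrite !ffunE; ring.
Qed.

(** Each summand fails to commute by one term at i = k and one at i = l, and these two cancel in the
    sum. *)
Lemma dop_yop k l f : dop (yop k l f) = yop k l (dop f).
Proof.
have e1 i : T (w i) z (pp i (yop k l f)) = yop k l (T (w i) z (pp i f)) +
    ((k == i)%:R *: T (w i) z (pp l f) - (l == i)%:R *: pp i (T (w k) z f)).
  have -> : pp i (yop k l f) = pp i (T (w k) (w l) f) - pp l (pm k (pp i f)) + (k == i)%:R *: pp l f.
    rewrite /yop [pp i _]linearB /= psi_mp [pp l (_ + _)]linearD /= [pp l (- _)]linearN /=.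
    by rewrite [pp l (_ *: _)]linearZ /= [pp l (pp i _)]psi_pp opprK opprD addrA subrK.
  rewrite [tens _ _]linearD /= [tens _ (_ - _)]linearB /= [tens _ (_ *: _)]linearZ /=.
  rewrite /yop !tens_psi_p !tens_psi_m tens_rel zw ww scale0r addr0 !tens_psi_p.
  rewrite [pp i (_ - _)]linearB /= [pp i (_ *: _)]linearZ /= -!tens_psi_p.
  set a1 := tens _ _; set a2 := tens _ _; set a3 := tens _ _; set a4 := pp l _.
  by apply/ffunP => x; rewrite !ffunE; ring.
rewrite /dop; under eq_bigr => i _ do rewrite e1.
rewrite big_split /= -linear_sum -[RHS]addr0; congr (_ + _); rewrite sumrB.
rewrite (bigD1 k) //= eqxx scale1r big1 ?addr0; last first.
  by move=> i; rewrite eq_sym => /negPf ->; rewrite scale0r.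
rewrite (bigD1 l) //= eqxx scale1r big1 ?addr0; last first.
  by move=> i; rewrite eq_sym => /negPf ->; rewrite scale0r.
by rewrite tens_psi_p subrr.
Qed.

Lemma eop_yop k l f : eop (yop k l f) = yop k l (eop f).
Proof.
by apply: hform_ext => h; rewrite hform_eop yop_adj yop_adj hform_eop dop_yop.
Qed.

Lemma dirac_yop k l f : dirac (yop k l f) = yop k l (dirac f).
Proof. by rewrite /dirac dop_yop eop_yop [yop k l (_ + _)]linearD. Qed.

(** The last weight plus the exterior degree. The Dirac operator preserves it, E_(i,z) lowering the
    last weight while [psi_p] raises the degree. *)
Definition nzop f : U' := [ffun x : B' => (wt x.1 z + #|x.2|%:Z)%:~R * f x].
Fact nzop_is_linear : linear nzop.
Proof. by move=> a f g; apply/ffunP => x; rewrite !ffunE /= mulrDr mulrCA. Qed.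
HB.instance Definition _ := GRing.isLinear.Build C U' U' _ nzop nzop_is_linear.

Lemma slice_nz S f : slice S (nzop f) = X z z (slice S f) + #|S|%:R *: slice S f.
Proof.
apply/ffunP => b; rewrite !ffunE (glu_diag uX) ffunE /= intrD mulrDl.
by rewrite -pmulrn.
Qed.

Lemma nz_tens a b f : nzop (T a b f) =
  T a b (nzop f) + (z == a)%:R *: T z b f - (b == z)%:R *: T a z f.
Proof.
apply: sliceP => S; rewrite !(linearB, linearD) /= !linearZ /= !slice_tens !slice_nz !slice_tens.
have eX c (u v : U) : X a b (u + c *: v) = X a b u + c *: X a b v by rewrite linearD linearZ.
rewrite (glu_rel uX) eX.
set a1 := X _ _ _; set a2 := X _ _ _; set a3 := X _ _ _; set a4 := X _ _ _.
by apply/ffunP => x; rewrite !ffunE; ring.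
Qed.

Lemma nz_psi_p i f : nzop (pp i f) = pp i (nzop f) + pp i f.
Proof.
apply/ffunP => -[b S]; rewrite !ffunE /=; case: ifPn => iS; last by rewrite mulr0 addr0.
rewrite (cardsD1 i S) iS !(PoszD, intrD) mulrCA -mulrDr; congr (_ * _).
by rewrite addrCA [LHS]mulrDl mul1r [LHS]addrC.
Qed.

Lemma nz_psi_m i f : nzop (pm i f) = pm i (nzop f) - pm i f.
Proof.
apply/ffunP => -[b S]; rewrite !ffunE /=; case: ifPn => iS; first by rewrite mulr0 subr0.
rewrite cardsU1 iS !(PoszD, intrD) -mulrBr [LHS]mulrCA; congr (_ * _).
rewrite addrCA [in RHS]mulrDl [X in _ = X - _]addrC. by rewrite mul1r addrK.
Qed.

Lemma nz_yop i j f : nzop (yop i j f) = yop i j (nzop f).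
Proof.
rewrite /yop [nzop _]linearB /= nz_tens zw wz !scale0r addr0 subr0; congr (_ - _).
by rewrite nz_psi_p nz_psi_m [pp j (_ - _)]linearB /= subrK.
Qed.

Lemma nz_dop f : nzop (dop f) = dop (nzop f).
Proof.
rewrite /dop linear_sum; apply: eq_bigr => i _ /=.
rewrite nz_tens zw eqxx scale0r scale1r addr0 nz_psi_p [tens _ (_ + _)]linearD /=.
by rewrite addrK.
Qed.

Lemma hform_nz f g : hform (nzop f) g = hform f (nzop g).
Proof.
apply: eq_bigr => x _; rewrite !ffunE rmorphM /= rmorph_int; ring.
Qed.

Lemma nz_dirac f : nzop (dirac f) = dirac (nzop f).
Proof.
rewrite /dirac [nzop _]linearD /= nz_dop; congr (_ + _).
by apply: hform_ext => h; rewrite hform_nz !hform_eop hform_nz nz_dop.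
Qed.

Lemma supp_nz (nu : int) f :
  supported (fun x : B' => wt x.1 z + #|x.2|%:Z == nu) f <-> nzop f = nu%:~R *: f.
Proof.
split=> [h|h x nx].
  apply/ffunP => x; rewrite !ffunE.
  by have [->//|/h ->] := eqVneq (wt x.1 z + #|x.2|%:Z) nu; rewrite scaler0 mulr0.
have := congr1 (fun u : U' => u x) h; rewrite !ffunE => /eqP.
rewrite -subr_eq0 -mulrBl -intrB mulf_eq0 intr_eq0 subr_eq0 (negPf nx) /=.
by move/eqP.
Qed.

Definition parity p (x : B') := odd #|x.2| == p.

Lemma supp_slice (P : pred B) (P' : pred {set 'I_n}) f :
  supported (fun x : B' => P x.1 && P' x.2) f <->
  (forall S, if P' S then supported P (slice S f) else slice S f = 0).
Proof.
split=> [h S|h [b S]] /=.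
  case: ifPn => PS; first by move=> b nb; rewrite ffunE h//= (negPf nb).
  by apply/ffunP => b; rewrite !ffunE h//= (negPf PS) andbF.
have := h S; case: ifPn => PS; first by rewrite andbT => h1 /h1; rewrite ffunE.
by move/(congr1 (fun u : U => u b)); rewrite !ffunE.
Qed.

Variable Z : pred B.
Hypothesis stab : forall a b (u : U), supported Z u -> supported Z (X a b u).

Definition blk p (x : B') := Z x.1 && parity p x.

Lemma blk_slice p f : supported (blk p) f <->
  (forall S, if odd #|S| == p then supported Z (slice S f) else slice S f = 0).
Proof. exact: (supp_slice Z (fun S => odd #|S| == p)). Qed.

Lemma blkD p f g : supported (blk p) f -> supported (blk p) g -> supported (blk p) (f + g).
Proof. by move=> hf hg x nx; rewrite ffunE hf// hg// addr0. Qed.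
Lemma blkN p f : supported (blk p) f -> supported (blk p) (- f).
Proof. by move=> hf x nx; rewrite ffunE hf// oppr0. Qed.
Lemma blk_sum p (F : 'I_n -> U') : (forall i, supported (blk p) (F i)) -> supported (blk p) (\sum_i F i).
Proof. by move=> hf x nx; rewrite sum_ffunE big1// => i _; rewrite hf. Qed.

Lemma blk_tens p a b f : supported (blk p) f -> supported (blk p) (T a b f).
Proof.
move=> /blk_slice h; apply/blk_slice => S; have := h S; rewrite slice_tens.
by case: ifP => _; [exact: stab | move=> ->; rewrite linear0].
Qed.

Lemma blk_psi_p p i f : supported (blk p) f -> supported (blk (~~ p)) (pp i f).
Proof.
move=> h [b S]; rewrite ffunE /= /blk /parity /= => nb; case: ifPn => // iS.
rewrite h ?mulr0//; move: nb; rewrite /blk /parity /= (cardsD1 i S) iS /=.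
by case: p {h}; case: odd.
Qed.

Lemma blk_psi_m p i f : supported (blk p) f -> supported (blk (~~ p)) (pm i f).
Proof.
move=> h [b S]; rewrite ffunE /= /blk /parity /= => nb; case: ifPn => // iS.
rewrite h ?mulr0//; move: nb; rewrite /blk /parity /= cardsU1 iS /=.
by case: p {h}; case: odd.
Qed.

Lemma blk_yop p i j f : supported (blk p) f -> supported (blk p) (yop i j f).
Proof.
move=> h; apply: blkD; first exact: blk_tens.
by apply: blkN; rewrite -[p]negbK; apply/blk_psi_p/blk_psi_m.
Qed.

Lemma blk_dirac p f : supported (blk p) f -> supported (blk (~~ p)) (dirac f).
Proof.
move=> h; apply: blkD; apply: blk_sum => i; apply: blk_tens.
  exact: blk_psi_p.
exact: blk_psi_m.
Qed.

End DiracStep.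

(** * Kernel and index of the Dirac operator *)

Lemma suppI (T : Type) (C : nmodType) (P Q : pred T) (f : T -> C) :
  supported (fun x => P x && Q x) f <-> supported P f /\ supported Q f.
Proof.
split=> [h|[hP hQ] x].
  by split=> x nx; apply: h; rewrite (negPf nx) ?andbF.
by rewrite negb_and => /orP[/hP|/hQ].
Qed.

Section DiracKernel.
Variables (C : numClosedFieldType) (n : nat) (B : finType).
Variables (wt : B -> 'I_n.+1 -> int) (X : 'I_n.+1 -> 'I_n.+1 -> 'End({ffun B -> C^o})).
Hypothesis uX : gl_unitary wt X.
Notation B' := (B * {set 'I_n})%type.
Notation U := {ffun B -> C^o}.
Notation U' := {ffun B' -> C^o}.
Implicit Types (f g : U') (i j k : 'I_n) (S : {set 'I_n}).
Variable Z : pred B.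
Hypothesis stab : forall a b (u : U), supported Z u -> supported Z (X a b u).
Variable nu : 'I_n.+1 -> int.
Hypothesis hnu : forall a b : 'I_n.+1, (a <= b)%N -> nu b <= nu a.

Let z : 'I_n.+1 := ord_max.
Let w (i : 'I_n) : 'I_n.+1 := widen_ord (leqnSn n) i.
Local Notation T := (fun a b => tens (X a b)).
Local Notation pp := (@psi_p C B n).
Local Notation pm := (@psi_m C B n).
Local Notation yop := (yop X).
Local Notation D := (dirac X).

Definition wt' (x : B') i : int := wt x.1 (w i) - (i \in x.2)%:Z.
Definition Y i j : 'End(U') := linfun (yop i j).
Definition zdeg (x : B') := wt x.1 z + #|x.2|%:Z == nu z.
Definition Z' p (x : B') := blk Z p x && zdeg x.
Definition Hsp p := hwsp wt' Y (Z' p) (nu \o w).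

Lemma gl_unitaryY : gl_unitary wt' Y.
Proof.
split=> [i j k l f|i j f g|i f x]; rewrite !lfunE /=.
- exact: (yop_rel uX).
- exact: (yop_adj uX).
- exact: (yop_diag uX).
Qed.

Lemma supp_eigen (c : B' -> 'I_n -> int) (e : 'I_n -> int) f :
  supported (fun x => [forall i, c x i == e i]) f <->
  (forall i x, (c x i)%:~R * f x = (e i)%:~R * f x).
Proof.
split=> [h i x|h x]; last first.
  rewrite negb_forall => /existsP[i ni]; have /eqP := h i x.
  rewrite -subr_eq0 -mulrBl -intrB mulf_eq0 intr_eq0 subr_eq0 (negPf ni) /=.
  by move/eqP.
by have [->//|ni] := eqVneq (c x i) (e i); rewrite h ?mulr0//; apply/forallPn; exists i.
Qed.

Lemma HspP p f : f \in Hsp p <->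
  [/\ forall i j, (i < j)%N -> yop i j f = 0, supported (blk Z p) f,
      nzop wt f = (nu z)%:~R *: f & forall i, yop i i f = (nu (w i))%:~R *: f].
Proof.
have e1 : supported (fun x : B' => [forall i, wt' x i == (nu \o w) i]) f <->
    (forall i, yop i i f = (nu (w i))%:~R *: f).
  rewrite supp_eigen; split=> h i.
    by apply/ffunP => x; rewrite !(yop_diag uX) h ffunE.
  by move=> x; rewrite -(yop_diag uX) h ffunE.
split.
- move=> /hwspP[h1 /suppI[/suppI[h2 h3] h4]]; split=> //.
  + by move=> i j /h1; rewrite lfunE.
  + by apply/supp_nz.
  + exact/e1.
- move=> [h1 h2 h3 h4]; apply/hwspP; split.
  + by move=> i j /h1; rewrite lfunE.
  + by apply/suppI; split; [apply/suppI; split=> //; apply/supp_nz | apply/e1].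
Qed.

Lemma stabY p i j f : supported (Z' p) f -> supported (Z' p) (Y i j f).
Proof.
move=> /suppI[h1 /supp_nz h2]; apply/suppI; rewrite lfunE; split.
  exact: blk_yop.
by apply/supp_nz; rewrite (nz_yop uX) h2 [yop _ _ (_ *: _)]linearZ.
Qed.

Lemma dirac_Hsp p f : f \in Hsp p -> D f \in Hsp (~~ p).
Proof.
move=> /HspP[h1 h2 h3 h4]; apply/HspP; split.
- by move=> i j ij; rewrite -(dirac_yop uX) h1// linear0.
- exact: blk_dirac.
- by rewrite (nz_dirac uX) h3 linearZ.
- by move=> i; rewrite -(dirac_yop uX) h4 linearZ.
Qed.

(** The E_(z,i) commute and the [psi_m] anticommute, so the double sum is its own opposite. *)
Lemma eop_eop f : eop X (eop X f) = 0.
Proof.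
have e : eop X (eop X f) = \sum_i \sum_j T z (w i) (T z (w j) (pm i (pm j f))).
  apply: eq_bigr => i _; rewrite linear_sum linear_sum /=; apply: eq_bigr => j _.
  by rewrite -tens_psi_m.
have e2 : eop X (eop X f) = - eop X (eop X f).
  rewrite {1}e exchange_big e -sumrN; apply: eq_bigr => i _; rewrite -sumrN; apply: eq_bigr => j _.
  rewrite psi_mm [tens _ (- _)]linearN /= [tens _ (- _)]linearN /= (tens_rel uX) !wz !scale0r addr0 subr0.
  by [].
apply/ffunP => x; have := congr1 (fun g : U' => g x) e2; by rewrite !ffunE => /eqP; rewrite eq_sym eqNr => /eqP ->.
Qed.

Lemma dop_dop f : dop X (dop X f) = 0.
Proof. apply: hform_ext => h; rewrite !(hform_dop uX) eop_eop hform0l. exact: hform0r. Qed.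

Lemma hformZr (I : finType) (a : C) (f g : {ffun I -> C^o}) : hform f (a *: g) = a^* * hform f g.
Proof. by have := hform_linr a g 0 f; rewrite hform0r !addr0. Qed.

Definition pair_term f i j : C :=
  (i == j)%:R * hform (T (w i) z f) (T (w i) z f) + hform f (T (w i) (w j) (pp i (pm j f)))
  - (i == j)%:R * hform f (T z z (pp i (pm j f))).

(** Both halves of D have square zero, so D^2 is their anticommutator; commuting E_(i,z) with
    E_(z,j) leaves the terms of [pair_term]. *)
Lemma hform_dirac2 f : hform (D f) (D f) = \sum_i \sum_j pair_term f i j.
Proof.
have -> : hform (D f) (D f) = hform f (eop X (dop X f) + dop X (eop X f)).
  rewrite (hform_dirac uX) /dirac; congr hform.
  by rewrite [dop X _]linearD /= [eop X (_ + _)]linearD /= eop_eop dop_dop add0r addr0 addrC.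
have e1 : eop X (dop X f) = \sum_i \sum_j T z (w j) (T (w i) z (pm j (pp i f))).
  rewrite exchange_big; apply: eq_bigr => i _; rewrite linear_sum linear_sum /=.
  by apply: eq_bigr => j _; rewrite -tens_psi_m.
have e2 : dop X (eop X f) = \sum_i \sum_j T (w i) z (T z (w j) (pp i (pm j f))).
  apply: eq_bigr => i _; rewrite linear_sum linear_sum /=.
  by apply: eq_bigr => j _; rewrite -tens_psi_p.
rewrite e1 e2 -big_split hform_sumr; apply: eq_bigr => i _ /=.
rewrite -big_split hform_sumr; apply: eq_bigr => j _ /=; rewrite /pair_term.
rewrite psi_mp [T (w i) z (T _ _ _)](tens_rel uX) eqxx scale1r (ww j i) (eq_sym i).
set g := pp i (pm j f).
have -> : T z (w j) (T (w i) z (- g + (j == i)%:R *: f)) =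
    - T z (w j) (T (w i) z g) + (j == i)%:R *: T z (w j) (T (w i) z f).
  by rewrite [T (w i) z _]linearD /= [T (w i) z (- _)]linearN /= [T (w i) z (_ *: _)]linearZ /=
    [tens _ (_ + _)]linearD /= [tens _ (- _)]linearN /= [tens _ (_ *: _)]linearZ.
rewrite (_ : _ + _ = (j == i)%:R *: T z (w j) (T (w i) z f) + T (w i) (w j) g
   - (j == i)%:R *: T z z g); last by apply/ffunP => x; rewrite !ffunE; ring.
rewrite hformBr hformDr !hformZr conjC_nat; case: eqP => [->|_]; last by rewrite !mul0r.
by rewrite !mul1r -[in LHS](tens_adj uX).
Qed.

Lemma psi_pmE i f (x : B') : pp i (pm i f) x = (i \in x.2)%:R * f x.
Proof.
case: x => b S; rewrite !ffunE /= !inE eqxx /=; case: ifPn => iS; last by rewrite mul0r.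
by rewrite finset.setD1K// mulrA sgs_D1 sgsK.
Qed.

(* <Df, Df> is a sum of nonnegative terms; dominance of nu is what makes the
   diagonal ones at least |E_iz f|^2 + |psi_p psi_m f|^2. *)
Lemma dirac_ker p f : f \in Hsp p -> D f = 0 ->
  (forall i, T (w i) z f = 0) /\ (forall i, pp i (pm i f) = 0).
Proof.
move=> /HspP[h1 h2 h3 h4] Df.
have hY i j : (i < j)%N -> T (w i) (w j) f = pp j (pm i f).
  by move=> /h1/eqP; rewrite subr_eq0 => /eqP.
have ge_diag i : hform (T (w i) z f) (T (w i) z f) + hform (pp i (pm i f)) (pp i (pm i f))
    <= pair_term f i i.
  rewrite /pair_term eqxx !mul1r -addrA lerD2l -!(tens_adj uX) -sumrB; apply: ler_sum => x _.
  rewrite psi_pmE !(tens_diag uX) -mulrBl -mulrBl -intrB rmorphM /= rmorph_nat.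
  case: (boolP (i \in x.2)) => ix; last by rewrite !mul0r mulr0.
  rewrite !mul1r; have [fx|fx] := eqVneq (f x) 0; first by rewrite fx mulr0 !mul0r.
  have e1 : wt x.1 (w i) - 1 = nu (w i).
    have := congr1 (fun g : U' => g x) (h4 i); rewrite (yop_diag uX) ix ffunE.
    by move/(mulIf fx)/intr_inj.
  have e2 : wt x.1 z + #|x.2|%:Z = nu z.
    by have := congr1 (fun g : U' => g x) h3; rewrite !ffunE => /(mulIf fx)/intr_inj.
  have e3 : nu z <= nu (w i) by apply: hnu; rewrite /= ltnW.
  rewrite -mulrA -[leLHS]mul1r ler_wpM2r ?mul_conjC_ge0// ler1z.
  move: e1 e2 e3; move: (wt x.1 z) (wt x.1 (w i)) (nu z) (nu (w i)) #|x.2|.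
  by move=> a b c d e; lia.
have ge_off i j : i != j -> 0 <= pair_term f i j.
  move=> ij; rewrite /pair_term (negPf ij) !mul0r add0r subr0.
  have : (i != j :> nat) by [].
  case: ltngtP => // ltij _.
    rewrite tens_psi_p tens_psi_m hY//.
    by rewrite -hform_psi_m -hform_psi hform_ge0.
  by rewrite -(tens_adj uX) hY// hform_ge0.
have ge_all i j : 0 <= pair_term f i j.
  have [<-|/ge_off//] := eqVneq i j.
  by apply: le_trans (ge_diag i); rewrite addr_ge0// hform_ge0.
have /esym := hform_dirac2 f; rewrite Df hform0l => /eqP.
rewrite psumr_eq0 => [/allP h0|i _]; last by apply: sumr_ge0.
have hd i : hform (T (w i) z f) (T (w i) z f) + hform (pp i (pm i f)) (pp i (pm i f)) = 0.
  have := h0 i (mem_index_enum i); rewrite psumr_eq0 => [/allP/(_ i (mem_index_enum i))/eqP e|j _//].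
  by apply: le_anti; rewrite addr_ge0 ?hform_ge0// andbT -e ge_diag.
split=> i; have /eqP := hd i; rewrite paddr_eq0 ?hform_ge0// => /andP[/eqP e1 /eqP e2].
  exact: hform_eq0.
exact: hform_eq0.
Qed.

Definition vac (u : U) : U' := [ffun x : B' => if x.2 == finset.set0 then u x.1 else 0].
Fact vac_is_linear : linear vac.
Proof. by move=> a u v; apply/ffunP => x; rewrite !ffunE; case: ifP; rewrite ?scaler0 ?addr0. Qed.
HB.instance Definition _ := GRing.isLinear.Build C U U' _ vac vac_is_linear.

Lemma slice_vac S u : slice S (vac u) = if S == finset.set0 then u else 0.
Proof. by apply/ffunP => b; rewrite !ffunE /=; case: ifP; rewrite ?ffunE. Qed.

Lemma vacK u : slice finset.set0 (vac u) = u.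
Proof. by rewrite slice_vac eqxx. Qed.

Lemma tens_vac a b u : T a b (vac u) = vac (X a b u).
Proof. by apply: sliceP => S; rewrite slice_tens !slice_vac; case: ifP; rewrite ?linear0. Qed.

Lemma psi_m_vac i u : pm i (vac u) = 0.
Proof.
apply: sliceP => S; rewrite slice_psi_m slice_vac linear0; case: ifP => // _.
by case: eqP => [/setP/(_ i)|_]; rewrite ?scaler0// !inE eqxx.
Qed.

Lemma wzP (a : 'I_n.+1) : a = z \/ exists i, a = w i.
Proof.
have [e|ne] := eqVneq a z; [by left | right].
have lt : (a < n)%N by have := ltn_ord a; rewrite ltnS leq_eqVlt (negPf (ne : a != n :> nat)).
by exists (Ordinal lt); apply: val_inj.
Qed.

Lemma vac_Hsp u : u \in hwsp wt X Z nu -> vac u \in Hsp false /\ D (vac u) = 0.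
Proof.
move=> /hwspP[h1 h2]; split; last first.
  rewrite /dirac /dop /eop !big1 ?addr0// => i _; first by rewrite psi_m_vac linear0.
  by rewrite tens_psi_p tens_vac h1 ?linear0//; exact: (ltn_ord i).
apply/hwspP; split=> [i j ij|[b S] nx].
  by rewrite lfunE /= /yop psi_m_vac linear0 tens_vac h1// linear0 subr0.
rewrite ffunE /=; case: eqP => // eS; apply: h2; apply: contra nx => /andP[Zb /forallP hb].
rewrite /Z' /blk /parity /zdeg /= eS cards0 Zb /= addr0 hb /=.
by apply/forallP => i; rewrite /wt' /= finset.in_set0 subr0.
Qed.

(** By [dirac_ker] no index occurs in the exterior factor, so [f] sits in exterior degree zero;
    being killed also by the E_(i,z), it is singular for gl_(n+1). *)
Lemma Hsp_vac p f : f \in Hsp p -> D f = 0 ->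
  f = vac (slice finset.set0 f) /\ slice finset.set0 f \in hwsp wt X Z nu.
Proof.
move=> hf Df; have [hT hN] := dirac_ker hf Df; split.
  apply: sliceP => S; rewrite slice_vac; case: eqP => [-> //|/eqP/set0Pn[i iS]].
  apply/ffunP => b; have := congr1 (fun g : U' => g (b, S)) (hN i).
  by rewrite psi_pmE /= iS mul1r !ffunE.
have /hwspP[h1 h2] := hf; apply/hwspP; split.
  move=> a b ab; rewrite -slice_tens; have [eb|[j eb]] := wzP b.
    have [ea|[i ea]] := wzP a; last by rewrite eb ea hT linear0.
    by move: ab; rewrite ea eb ltnn.
  have [ea|[i ea]] := wzP a.
    by move: ab; rewrite ea eb /= ltnNge ltnW.
  move: ab; rewrite ea eb => /(h1 i j); rewrite lfunE /= => /eqP; rewrite subr_eq0 => /eqP ->.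
  by rewrite slice_psi_p finset.in_set0.
move=> b nb; rewrite ffunE h2//; apply: contra nb => /andP[/andP[/andP[/= -> _] e1] /forallP h3] /=.
apply/forallP => a; have [->|[i ->]] := wzP a.
  by move: e1; rewrite /zdeg cards0 addr0.
by have := h3 i; rewrite /wt' /= finset.in_set0 subr0.
Qed.

Lemma Hsp_vac1 f : f \in Hsp true -> D f = 0 -> f = 0.
Proof.
move=> hf Df; have [-> _] := Hsp_vac hf Df.
have /hwspP[_ h2] := hf; apply/ffunP => -[b S]; rewrite !ffunE /=; case: eqP => // eS.
by rewrite h2// /Z' /blk /parity /= cards0 /= andbF.
Qed.

(* D is self-adjoint and exchanges the two parities: outside its kernel, which
   consists of the singular vectors of the bigger algebra, they cancel. *)
Lemma dim_step : (\dim (hwsp wt X Z nu))%:Z = (\dim (Hsp false))%:Z - (\dim (Hsp true))%:Z.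
Proof.
pose Dl : 'End(U') := linfun D.
have DE f : Dl f = D f by rewrite lfunE.
have e1 : \dim (Hsp false :&: lker Dl) = \dim (hwsp wt X Z nu).
  have -> : (Hsp false :&: lker Dl)%VS = (linfun vac @: hwsp wt X Z nu)%VS.
    apply/vspaceP => f; apply/idP/memv_imgP.
      rewrite memv_cap memv_ker DE => /andP[hf /eqP /(Hsp_vac hf)[e hu]].
      by exists (slice finset.set0 f) => //; rewrite lfunE.
    by move=> [u /vac_Hsp[h1 h2] ->]; rewrite lfunE memv_cap memv_ker DE /= h1 h2 eqxx.
  apply: limg_dim_eq; apply/eqP; rewrite -subv0; apply/subvP => u.
  rewrite memv_cap memv_ker lfunE /= => /andP[_ /eqP e].
  by rewrite -(vacK u) e linear0 mem0v.
have e2 : \dim (Dl @: Hsp true) = \dim (Hsp true).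
  apply: limg_dim_eq; apply/eqP; rewrite -subv0; apply/subvP => f.
  by rewrite memv_cap memv_ker DE => /andP[hf /eqP/(Hsp_vac1 hf) ->]; rewrite mem0v.
have D2 f : D (D f) = 0 -> D f = 0.
  by move=> h; apply: hform_eq0; rewrite (hform_dirac uX) h hform0r.
have e3 : \dim (Dl @: (Dl @: Hsp true)) = \dim (Dl @: Hsp true).
  apply: limg_dim_eq; apply/eqP; rewrite -subv0; apply/subvP => f.
  rewrite memv_cap memv_ker => /andP[/memv_imgP[g _ ->]]; rewrite !DE => /eqP/D2 ->.
  by rewrite mem0v.
have sub p : (Dl @: Hsp p <= Hsp (~~ p))%VS.
  by apply/subvP => f /memv_imgP[g /dirac_Hsp hg ->]; rewrite DE.
have e4 : \dim (Dl @: Hsp false) = \dim (Hsp true).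
  apply: anti_leq; rewrite (dimvS (sub false)) /=.
  by rewrite -e2 -e3 dimvS// limgS// (sub true).
by rewrite -(limg_ker_dim Dl (Hsp false)) e1 e4 PoszD addrK.
Qed.
End DiracKernel.

(** * Weyl's formula as an alternating count *)

Definition alt n (a : 'I_n -> int) : int :=
  \sum_(s : 'S_n) (-1) ^+ s * [forall i, a i == (s i : nat)%:Z]%:R.

Lemma prod_nat_bool (I : finType) (R : comNzRingType) (P : pred I) :
  \prod_i (P i)%:R = [forall i, P i]%:R :> R.
Proof.
case: (boolP [forall i, P i]) => [/forallP h|/forallPn[i ni]]; first by rewrite big1// => i _; rewrite h.
by rewrite (bigD1 i)//= (negPf ni) mul0r.
Qed.

(** Thus [alt a] is the coefficient of the monomial with exponents [a] in the Vandermonde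
    determinant of the x_i^j. *)
Lemma alt_det n (a : 'I_n -> int) : alt a = \det (\matrix_(i, j) (a i == (j : nat)%:Z)%:R).
Proof.
apply: eq_bigr => s _; congr (_ * _); rewrite -prod_nat_bool.
by apply: eq_bigr => i _; rewrite mxE.
Qed.

Lemma lift_max n (i : 'I_n) : lift ord_max i = widen_ord (leqnSn n) i :> 'I_n.+1.
Proof. by apply: val_inj; rewrite /= /bump leqNgt ltn_ord. Qed.

(* Subtracting from each column the next one clears the all-ones row. *)
Lemma det_ones n (b : 'I_n.+1 -> int) :
  \det (\matrix_(i, j) (if i == ord_max then 1 else (b i == (j : nat)%:Z)%:R)) =
  \det (\matrix_(i < n, j < n) ((b (widen_ord (leqnSn n) i) == (j : nat)%:Z)%:R
     - (b (widen_ord (leqnSn n) i) == (j.+1)%:Z)%:R)) :> int.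
Proof.
set M := \matrix_(i, j) _.
pose V : 'M[int]_n.+1 := \matrix_(k, j) ((k == j)%:R - (k == j.+1 :> nat)%:R).
have dV : \det V = 1.
  rewrite det_trig ?big1// => [i _|]; first by rewrite mxE eqxx eqn_leq ltnn andbF subr0.
  apply/is_trig_mxP => i j ij; rewrite mxE (ltn_eqF ij : (i == j) = false) ltn_eqF ?subrr//.
  exact: ltnW.
have MV i j : (M *m V) i j = M i j - (if (j < n)%N then M i (inord j.+1) else 0).
  rewrite mxE; under eq_bigr => k _ do rewrite [V _ _]mxE mulrBr.
  rewrite sumrB (bigD1 j)//= eqxx mulr1 [X in _ + X - _]big1 ?addr0 => [|k /negPf ->]; last by rewrite mulr0.
  have -> : \sum_k M i k * (k == j.+1 :> nat)%:R = if (j < n)%N then M i (inord j.+1) else 0; last by [].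
  case: ltnP => jn.
    rewrite (bigD1 (inord j.+1))//= inordK// eqxx mulr1 big1 ?addr0// => k kj.
    case: eqP => [e|_]; last by rewrite mulr0.
    by move: kj; rewrite -e inord_val eqxx.
  by rewrite big1// => k _; rewrite (ltn_eqF (leq_trans (ltn_ord k) _)) ?mulr0// ltnS.
have -> : \det M = \det (M *m V) by rewrite det_mulmx dV mulr1.
rewrite (expand_det_row _ ord_max) (bigD1 ord_max)//= big1 ?addr0; last first.
  move=> j jn; rewrite MV !mxE eqxx ifT ?subrr ?mul0r//.
  by move: jn (ltn_ord j); rewrite -val_eqE /= => jn; rewrite ltnS leq_eqVlt (negPf jn).
rewrite MV mxE eqxx ltnn subr0 mul1r /cofactor addnn -signr_odd odd_double expr0 mul1r.
congr (\det _); apply/matrixP => i j; rewrite 2![LHS]mxE MV !mxE !lift_max /= ltn_ord.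
by rewrite -val_eqE/= ltn_eqF// inordK// ltnS.
Qed.

Lemma sum_perm n (s : 'S_n) : \sum_i (s i : nat)%:Z = \sum_(i < n) (i : nat)%:Z.
Proof. by rewrite [RHS](reindex_inj (@perm_inj _ s)). Qed.

(** On coefficients, this is the factorization of a Vandermonde determinant as the smaller one times
    the product of the differences x_z - x_i, expanded over the subsets [S] where x_i is chosen. *)
Lemma alt_step n (a : 'I_n.+1 -> int) : alt a =
  \sum_(S : {set 'I_n}) (-1) ^+ #|S| *
    (if a ord_max + #|S|%:Z == n%:Z
     then alt (fun i => a (widen_ord (leqnSn n) i) - (i \in S)%:Z) else 0).
Proof.
have cS (S : {set 'I_n}) : \sum_i (i \in S)%:Z = #|S|%:Z.
  by rewrite -sum1_card -(big_morph Posz PoszD (erefl _)) -big_mkcond.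
set w := widen_ord (leqnSn n).
(* The values of a permutation have a fixed sum. Under [ok] the condition on the last row follows
   from the others, and that row may be replaced by ones. *)
pose ok := \sum_i a i == \sum_(i < n.+1) (i : nat)%:Z.
have e1 : alt a = if ok then
    \det (\matrix_(i, j) (if i == ord_max then 1 else (a i == (j : nat)%:Z)%:R)) else 0.
  rewrite /alt; case: ifPn => hok.
    apply: eq_bigr => s _; congr (_ * _); rewrite -prod_nat_bool !big_ord_recr /= mxE eqxx.
    rewrite [X in _ = X * _](eq_bigr (fun i => (a (w i) == (s (w i) : nat)%:Z)%:R)); last first.
      move=> i _; rewrite mxE -val_eqE /= (ltn_eqF (ltn_ord i)) //.
    rewrite (prod_nat_bool _ (fun i => a (w i) == _)).
    case: (boolP [forall i, _]) => [/forallP h|_]; last by rewrite !mul0r.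
    rewrite !mul1r; suff -> : a ord_max == (s ord_max : nat)%:Z by [].
    move: hok; rewrite /ok -(sum_perm s) !big_ord_recr /=.
    by rewrite (eq_bigr (fun i => (s (w i) : nat)%:Z)) => [|i _]; [rewrite (inj_eq (addrI _)) | exact/eqP].
  rewrite big1// => s _; case: (boolP [forall i, _]) => [/forallP h|_]; last by rewrite mulr0.
  case/negP: hok; rewrite /ok -(sum_perm s); apply/eqP/eq_bigr => i _; exact/eqP.
rewrite e1 det_ones -/w.
have e2 (S : {set 'I_n}) (s : 'S_n) : [forall i, a (w i) - (i \in S)%:Z == (s i : nat)%:Z] ->
    (a ord_max + #|S|%:Z == n%:Z) = ok.
  move=> /forallP h; rewrite /ok !big_ord_recr /=.
  have -> : \sum_i a (w i) = \sum_(i < n) (i : nat)%:Z + #|S|%:Z.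
    rewrite -cS -(sum_perm s) -big_split; apply: eq_bigr => i _ /=.
    by rewrite -(eqP (h i)) subrK.
  by rewrite -addrA (inj_eq (addrI _)) addrC.
have e3 (S : {set 'I_n}) : (if a ord_max + #|S|%:Z == n%:Z
     then alt (fun i => a (w i) - (i \in S)%:Z) else 0) =
   if ok then alt (fun i => a (w i) - (i \in S)%:Z) else 0.
  rewrite /alt -[LHS]mulr1 -[RHS]mulr1.
  have key (c : bool) : (if c then alt (fun i => a (w i) - (i \in S)%:Z) else 0) =
      \sum_(s : 'S_n) (-1) ^+ s * (c && [forall i, a (w i) - (i \in S)%:Z == (s i : nat)%:Z])%:R.
    by case: c => //=; rewrite big1// => s _; rewrite mulr0.
  rewrite !mulr1 !key; apply: eq_bigr => s _; congr (_ * _).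
  by case: (boolP [forall i, _]) => [/e2 ->|]; rewrite ?andbF.
under eq_bigr => S _ do rewrite e3.
case: ok {e1 e2 e3}; last by rewrite big1// => S _; rewrite mulr0.
rewrite /alt; under [RHS]eq_bigr => S _ do rewrite mulr_sumr.
rewrite [RHS]exchange_big; apply: eq_bigr => s _ /=.
(* In the expansion of this product [S] is the set of rows where the term with [(s i).+1] is
   taken. *)
transitivity ((-1) ^+ s * \prod_i (- (a (w i) == (s i).+1%:Z)%:R + (a (w i) == (s i : nat)%:Z)%:R) : int).
  by congr (_ * _); apply: eq_bigr => i _; rewrite mxE addrC.
rewrite bigA_distr mulr_sumr; apply: eq_bigr => S _.
rewrite mulrCA; congr (_ * _); rewrite -prod_nat_bool -[(-1) ^+ #|S|]prodr_const.
rewrite [X in _ = X * _]big_mkcond -big_split; apply: eq_bigr => i _ /=; case: ifP => _; last by rewrite mul1r subr0.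
by rewrite mulN1r subr_eq -[1]/(1%:Z) -PoszD addn1.
Qed.

Lemma dim_supp (C : fieldType) (B : finType) (P : pred B) (W : {vspace {ffun B -> C^o}}) :
  (forall u : {ffun B -> C^o}, u \in W <-> supported P u) -> \dim W = #|P|.
Proof.
move=> hW; pose I := {x : B | P x}.
pose E (v : {ffun I -> C^o}) : {ffun B -> C^o} := [ffun b => if insub b is Some i then v i else 0].
have El : linear E by move=> a u v; apply/ffunP => b; rewrite !ffunE; case: insub => [i|]; rewrite ?ffunE ?scaler0 ?addr0.
pose EL := HB.pack_for {linear {ffun I -> C^o} -> {ffun B -> C^o}} E (GRing.isLinear.Build _ _ _ _ E El).
have -> : W = (linfun EL @: fullv)%VS.
  apply/vspaceP => u; apply/idP/memv_imgP => [/hW hu|[v _ ->]].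
    exists [ffun i => u (val i)]; first exact: memvf.
    apply/ffunP => b; rewrite lfunE /= ffunE; case: insubP => [i _ <-|/hu //]; by rewrite ffunE.
  by apply/hW => b nb; rewrite lfunE /= ffunE insubN.
rewrite limg_dim_eq ?dimvf; last first.
  apply/eqP; rewrite -subv0; apply/subvP => v; rewrite memv_cap memv_ker lfunE /= => /andP[_ /eqP e].
  rewrite memv0; apply/eqP/ffunP => i; have := congr1 (fun u : {ffun B -> C^o} => u (val i)) e.
  by rewrite !ffunE valK.
by transitivity (#|{: I}| * 1)%N => //; rewrite muln1 card_sig; apply: eq_card.
Qed.

(** The multiplicity of [nu] is a coefficient of the character times a Vandermonde determinant in
    the inverse variables. Both sides obey one recursion in [n]: [dim_step] and [alt_step] run over
    the same subsets, with sign the parity of their size. *)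
Theorem wcf (C : numClosedFieldType) n (B : finType) (wt : B -> 'I_n -> int)
    (X : 'I_n -> 'I_n -> 'End({ffun B -> C^o})) (Z : pred B) (nu : 'I_n -> int) :
  gl_unitary wt X -> (forall i j (u : {ffun B -> C^o}), supported Z u -> supported Z (X i j u)) ->
  (forall i j : 'I_n, (i <= j)%N -> nu j <= nu i) ->
  (\dim (hwsp wt X Z nu))%:Z = \sum_(b | Z b) alt (fun i => wt b i - nu i + i%:Z).
Proof.
elim: n => [|n IH] in B wt X Z nu * => uX stab hnu.
  have a1 (a : 'I_0 -> int) : alt a = 1.
    by rewrite alt_det det_mx00.
  under eq_bigr => b _ do rewrite a1.
  rewrite sumr_const pmulrn intz; congr Posz; apply: dim_supp => u; split.
    by move=> /hwspP[_ h] b nb; apply: h; rewrite (negPf nb).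
  move=> h; apply/hwspP; split=> [[]//|b]; rewrite negb_and => /orP[/h//|].
  by move=> /forallPn[[]].
rewrite (dim_step uX stab hnu).
have hp p : (\dim (Hsp wt X Z nu p))%:Z = \sum_(x : B * {set 'I_n} | Z' wt Z nu p x)
    alt (fun i => wt' wt x i - nu (widen_ord (leqnSn n) i) + i%:Z).
  apply: IH => [|i j u|i j ij]; [exact: gl_unitaryY | exact: stabY | exact: hnu].
rewrite !hp.
under [RHS]eq_bigr => b _ do rewrite alt_step.
rewrite [RHS]pair_big /=.
transitivity (\sum_(x : B * {set 'I_n} | Z x.1) if zdeg wt nu x
   then (-1) ^+ odd #|x.2| * alt (fun i => wt' wt x i - nu (widen_ord (leqnSn n) i) + i%:Z)
   else 0); last first.
  apply: eq_big => [[b S]|[b S] _] /=; first by rewrite andbT.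
  rewrite signr_odd /zdeg /=.
  have -> : (wt b ord_max - nu ord_max + n%:Z + #|S|%:Z == n%:Z) = (wt b ord_max + #|S|%:Z == nu ord_max).
    by apply/eqP/eqP; lia.
  case: ifP => _; last by rewrite mulr0.
  congr (_ * alt _); by apply/funext => i; rewrite /wt' /=; ring.
rewrite -big_mkcondr [RHS](bigID (fun x : B * {set 'I_n} => odd #|x.2|)) /= addrC -sumrN.
congr (_ + _); apply: eq_big => [x|x]; rewrite /Z' /blk /parity /zdeg.
- by rewrite eqbF_neg andbAC.
- by move=> /andP[/andP[_ /eqP ->] _]; rewrite expr0 mul1r.
- by rewrite eqb_id andbAC.
- by move=> /andP[/andP[_ /eqP ->] _]; rewrite expr1 mulN1r.
Qed.

(** * Weight spaces and characters *)

Section RowAlgebra.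
Variables (C : numClosedFieldType) (n : nat).
Local Notation mode := (mode n).
Local Notation H := (fock C mode).
Local Notation row_op := (@row_op C n).
Implicit Types (f g : H) (i j k q : 'I_n) (m : int -> nat).

Lemma row_op_row l i j k q f : uniq l -> row_op l i j (row_op l k q f) =
  row_op l k q (row_op l i j f) + (j == k)%:R *: row_op l i q f - (i == q)%:R *: row_op l k j f.
Proof.
move=> ul; have e t : t \in l -> row_op l i j (st (k, t) (de (q, t) f)) =
    st (k, t) (de (q, t) (row_op l i j f)) + (j == k)%:R *: st (i, t) (de (q, t) f)
    - (i == q)%:R *: st (k, t) (de (j, t) f).
  move=> tl; rewrite row_op_st// row_op_de// linearB /= [st _ (_ *: _)]linearZ /=.
  by rewrite addrAC.
rewrite {2}/Submission.row_op linear_sum /= (eq_big_seq _ e) !big_split /= sumrN.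
by rewrite -!scaler_sumr.
Qed.

Lemma form_row l i j f g : fin_supp f -> fin_supp g ->
  form (row_op l i j f) g = form f (row_op l j i g).
Proof.
move=> hf hg.
have h1 (q p : mode) (f' : H) : fin_supp f' -> fin_supp (st q (de p f')).
  by move=> h; exact/fin_supp_st/fin_supp_de.
rewrite form_suml => [|t]; last exact: h1.
rewrite (formC _ hf); last by apply: fin_supp_sum => t; exact: h1.
rewrite form_suml => [|t]; last exact: h1.
rewrite rmorph_sum; apply: eq_bigr => t _ /=.
rewrite -formC//; last exact: h1.
rewrite form_st//; last exact: fin_supp_de.
by rewrite form_de// ?mulrA ?nuK ?mul1r//; exact: fin_supp_de.
Qed.

Lemma wvec_row m l i j f : wvec m f -> wvec m (row_op l i j f).
Proof.
move=> hf; apply: wvec_sum => t.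
have [t0|t0] := ltP 0 t; last first.
  apply: wvec_extm (wvec_st (q := (i, t)) (wvec_de (q := (j, t)) hf)) => r.
  by rewrite /m_st /m_de /= ltNge t0 /= /md /mi addnK.
have [m0|m0] := posnP (m t).
  have -> : de (j, t) f = 0 by rewrite /Submission.de /= t0 (ann_empty hf).
  by rewrite linear0; exact: wvec0.
apply: wvec_extm (wvec_st (q := (i, t)) (wvec_de (q := (j, t)) hf)) => r.
rewrite /m_st /m_de /= t0 /= /md /mi; case: eqP => [->|_]; first by rewrite subnK.
by rewrite addn0 subn0.
Qed.

(** In a column outside the window either [de] has nothing to annihilate or, the two modes being
    distinct, [st] can be moved first and has nothing to annihilate. *)
Lemma row_op_win m W Q i j f : finw W m -> (W <= Q)%N -> wvec m f -> i != j ->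
  row_op (win Q) i j f = row_op (win W) i j f.
Proof.
move=> hW hQ hf ij.
have h0 t : (W < `|t|)%N -> st (i, t) (de (j, t) f) = 0.
  move=> /hW m0; have [t0|t0] := ltP 0 t.
    have -> : de (j, t) f = 0 by rewrite /Submission.de /= t0 (ann_empty hf).
    exact: linear0.
  have -> : st (i, t) (de (j, t) f) = exch C (@fermionic n) (i, t) (j, t) *: de (j, t) (st (i, t) f).
    by rewrite de_st xpair_eqE eq_sym (negPf ij) scale0r addr0 scalerA exchC exchK scale1r.
  have -> : st (i, t) f = 0 by rewrite /Submission.st /= ltNge t0 /= (ann_empty (q := (i, t)) hf)// scaler0.
  by rewrite linear0 scaler0.
rewrite /Submission.row_op (bigID (fun t : int => (`|t| <= W)%N)) /= [X in _ + X]big1 ?addr0; last first.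
  by move=> t; rewrite -ltnNge => /h0.
rewrite -big_filter; apply: perm_big; apply: uniq_perm; rewrite ?filter_uniq ?win_uniq//.
by move=> t; rewrite mem_filter !mem_win; case: leqP => //= /leq_trans; apply.
Qed.

Lemma charge_win W Q i (k : config mode) : finw W (content k) -> (W <= Q)%N ->
  charge (win Q) i k = charge (win W) i k.
Proof.
move=> hW hQ; rewrite /charge (bigID (fun t : int => (`|t| <= W)%N)) /= [X in _ + X]big1 ?addr0; last first.
  move=> t; rewrite -ltnNge => /hW; rewrite /content (bigD1 i) //= => /eqP.
  by rewrite addn_eq0 => /andP[/eqP -> _]; rewrite oppr0; case: ifP.
rewrite -big_filter; apply: perm_big; apply: uniq_perm; rewrite ?filter_uniq ?win_uniq//.
by move=> t; rewrite mem_filter !mem_win; case: leqP => //= /leq_trans; apply.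
Qed.

(** One window containing the support of the content decides singularity, and the diagonal condition
    becomes one on charges, free of [ocs]. *)
Lemma hwm_win lam m W f : finw W m -> wvec m f -> hwm lam f <->
  (forall i j, (i < j)%N -> row_op (win W) i j f = 0) /\
  (forall k : config mode, f k != 0 -> forall i, charge (win W) i k = lam i).
Proof.
move=> hW hf; split=> [[Q0 h]|[h1 h2]].
  have [h1 h2] := h (maxn Q0 W) (leq_maxl _ _); split=> [i j ij|k fk i].
    by rewrite -(row_op_win hW (leq_maxr Q0 W) hf) ?h1//; apply: contraTneq ij => ->; rewrite ltnn.
  have [ck gk] := hf k fk.
  rewrite -(charge_win _ _ (leq_maxr Q0 W)); first exact: (wvec_charge h2).
  by move=> r /hW; rewrite ck.
exists W => Q hQ; split=> [i j ij|i].
  by rewrite (row_op_win hW hQ hf) ?h1//; apply: contraTneq ij => ->; rewrite ltnn.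
apply/funext => k; rewrite scalefE.
have [fk|fk] := eqVneq (f k) 0.
  rewrite fk mulr0; have [//|/(wvec_row hf)[ck gk]] := eqVneq (row_op (win Q) i i f k) 0.
  by rewrite row_op_diag// fk mulr0.
have [ck gk] := hf k fk.
rewrite row_op_diag// (charge_win _ _ hQ) ?h2//.
by move=> r /hW; rewrite ck.
Qed.

End RowAlgebra.

(** * The unitary gl_n-module of a given content *)

Section FiniteLevel.
Variables (C : numClosedFieldType) (n : nat) (m : int -> nat) (W : nat).
Hypothesis hW : finw W m.
Local Notation mode := (mode n).
Local Notation H := (fock C mode).
Variables (B : finType) (cfg : B -> config mode).
Hypothesis cfg_inj : injective cfg.
Hypothesis cfgP : forall k, config_set m k <-> exists b, cfg b = k.
Notation U := {ffun B -> C^o}.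
Implicit Types (f g : H) (u v : U) (i j : 'I_n).

Definition ext_cfg u : H := fun k => \sum_(b | `[< cfg b = k >]) u b.
Definition res_cfg f : U := [ffun b => f (cfg b)].
Fact ext_cfg_is_linear : linear ext_cfg.
Proof.
move=> a u v; apply/funext => k; rewrite addfE scalefE /ext_cfg mulr_sumr -big_split.
by apply: eq_bigr => b _; rewrite !ffunE.
Qed.
HB.instance Definition _ := GRing.isLinear.Build C U H _ ext_cfg ext_cfg_is_linear.
Fact res_cfg_is_linear : linear res_cfg.
Proof. by move=> a f g; apply/ffunP => b; rewrite !ffunE addfE scalefE. Qed.
HB.instance Definition _ := GRing.isLinear.Build C H U _ res_cfg res_cfg_is_linear.

Lemma ext_cfgE u b : ext_cfg u (cfg b) = u b.
Proof.
rewrite /ext_cfg (bigD1 b) /=; last exact/asboolP.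
by rewrite big1 ?addr0// => b' /andP[/asboolP/cfg_inj -> ]; rewrite eqxx.
Qed.

Lemma res_extK u : res_cfg (ext_cfg u) = u.
Proof. by apply/ffunP => b; rewrite ffunE ext_cfgE. Qed.

Lemma wvec_ext_cfg u : wvec m (ext_cfg u).
Proof.
move=> k; have [/asboolP hk|/asboolP hk] := boolP `[< config_set m k >]; first by [].
rewrite /ext_cfg big1 ?eqxx// => b /asboolP e; case: hk; apply/cfgP; by exists b.
Qed.

Lemma ext_resK f : wvec m f -> ext_cfg (res_cfg f) = f.
Proof.
move=> hf; apply/funext => k.
have [/asboolP/cfgP[b <-]|/asboolP hk] := boolP `[< config_set m k >].
  by rewrite ext_cfgE ffunE.
have [->|/wvec_ext_cfg//] := eqVneq (ext_cfg (res_cfg f) k) 0.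
by have [->//|/hf] := eqVneq (f k) 0.
Qed.

Lemma good_cfg b : good (cfg b).
Proof. by have /cfgP[] : exists b', cfg b' = cfg b by exists b. Qed.

Lemma fin_supp_wvec f : wvec m f -> fin_supp f.
Proof. by move=> hf; rewrite /fin_supp; apply: sub_finite_set (finite_configs n hW) => k /hf. Qed.

Lemma form_ext u v : form (ext_cfg u) (ext_cfg v) = hform u v.
Proof.
rewrite (form_seq (s := [seq cfg b | b <- index_enum B])).
- by rewrite big_map; apply: eq_bigr => b _; rewrite !ext_cfgE.
- by rewrite map_inj_uniq// index_enum_uniq.
- by move=> k /wvec_ext_cfg/cfgP[b <-]; rewrite map_f ?mem_index_enum.
Qed.

(** Without the vacuum constant the diagonal eigenvalues are the integer charges; the relations
    persist because the constant is the same in every row. *)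
Definition rop i j f : H := row_op (win W) i j f - ((i == j)%:R * ocs C (win W)) *: f.
Fact rop_is_linear i j : linear (rop i j).
Proof.
move=> a f g; rewrite /rop [row_op _ _ _ _]linearP /= !scalerDr !scalerN opprD !scalerA addrACA.
by rewrite [a * _]mulrC.
Qed.
HB.instance Definition _ i j := GRing.isLinear.Build C H H _ (rop i j) (rop_is_linear i j).

Lemma wvec_rop i j f : wvec m f -> wvec m (rop i j f).
Proof. by move=> hf; rewrite /rop addrC -scaleNr; apply: wvecP => //; exact: wvec_row. Qed.

Definition Xop i j : 'End(U) := linfun (res_cfg \o (rop i j \o ext_cfg)).

Lemma ext_Xop i j u : ext_cfg (Xop i j u) = rop i j (ext_cfg u).
Proof. by rewrite lfunE /= ext_resK//; apply: wvec_rop; exact: wvec_ext_cfg. Qed.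

Definition wtc (b : B) i : int := charge (win W) i (cfg b).

Lemma ext_inj : injective ext_cfg.
Proof. exact: can_inj res_extK. Qed.

Lemma form_rop i j f g : wvec m f -> wvec m g -> form (rop i j f) g = form f (rop j i g).
Proof.
move=> /fin_supp_wvec hf /fin_supp_wvec hg.
have hr a b h : fin_supp h -> fin_supp (row_op (win W) a b h).
  by move=> hh; apply: fin_supp_sum => t; exact/fin_supp_st/fin_supp_de.
rewrite /rop addrC -scaleNr form_linearl//; last exact: hr.
rewrite [row_op _ _ _ _ - _]addrC -scaleNr form_linearr//; last exact: hr.
rewrite form_row//; congr (_ * _ + _); rewrite rmorphN rmorphM /= conjC_nat eq_sym.
congr (- (_ * _)); rewrite /ocs rmorph_sum; apply: eq_bigr => t _.
by rewrite /oc rmorphM /= conjC_nat rmorph_sign.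
Qed.

Lemma gl_unitaryX : gl_unitary wtc Xop.
Proof.
split=> [i j k l u|i j u v|i u b].
- apply: ext_inj; rewrite linearB linearD !linearZ /= !ext_Xop.
  set f := ext_cfg u; rewrite /rop !linearB /= !(linearZ_LR (row_op _ _ _)) /=.
  rewrite row_op_row ?win_uniq//.
  apply/funext => q; rewrite !(addfE, scalefE, oppfE).
  rewrite (eq_sym l i) (eq_sym k j).
  move: (row_op (win W) k l (row_op (win W) i j f) q) (row_op (win W) i l f q) (row_op (win W) k j f q)
    (row_op (win W) i j f q) (row_op (win W) k l f q) (f q) (ocs C (win W)) => x1 x2 x3 x4 x5 x6 x7.
  by ring.
- by rewrite -!form_ext !ext_Xop form_rop//; exact: wvec_ext_cfg.
- rewrite -ext_cfgE ext_Xop /rop addfE oppfE scalefE eqxx mul1r.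
  by rewrite (row_op_diag _ _ _ (@good_cfg b)) ext_cfgE mulrDl addrK.
Qed.

Theorem hwm_dim (lam : 'I_n -> int) : genpart lam -> exists V : {vspace U},
  (\dim V)%:Z = \sum_b alt (fun i => wtc b i - lam i + i%:Z) /\
  forall u, u \in V <-> hwm lam (ext_cfg u).
Proof.
move=> hlam; exists (hwsp wtc Xop predT lam); split.
  by rewrite (wcf gl_unitaryX).
move=> u; rewrite (hwm_win _ hW (@wvec_ext_cfg u)); split.
  move=> /hwspP[h1 h2]; split=> [i j ij|k].
    have := congr1 ext_cfg (h1 i j ij); rewrite ext_Xop linear0 /rop.
    by rewrite (_ : (i == j) = false) ?mul0r ?scale0r ?subr0//; apply: contraTF ij => /eqP ->; rewrite ltnn.
  move=> uk; have /cfgP[b eb] := wvec_ext_cfg uk; rewrite -eb in uk *; rewrite ext_cfgE in uk.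
  have := h2 b; case: (boolP (predT b && _)) => [/= /forallP h _ i|_ /(_ isT) ub].
    by apply/eqP; exact: h.
  by rewrite ub eqxx in uk.
move=> [h1 h2]; apply/hwspP; split=> [i j ij|b].
  apply: ext_inj; rewrite ext_Xop linear0 /rop h1//.
  by rewrite (_ : (i == j) = false) ?mul0r ?scale0r ?subr0//; apply: contraTF ij => /eqP ->; rewrite ltnn.
move=> nb; apply/eqP; apply: contraNT nb; rewrite -ext_cfgE => ub /=; apply/forallP => i.
by rewrite /wtc (h2 _ ub).
Qed.

End FiniteLevel.

(** * Coefficients of products and determinants of series *)

Lemma series_sumE (I : Type) (r : seq I) (P : pred I) (F : I -> series) (m : monomial) :
  (\sum_(i <- r | P i) F i) m = \sum_(i <- r | P i) F i m.
Proof. by apply: (big_morph (fun f : series => f m)). Qed.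

Lemma series_signE (b : bool) (f : series) (m : monomial) : ((-1) ^+ b * f) m = (-1) ^+ b * f m.
Proof.
case: b; last by rewrite !expr0 !mul1r.
by rewrite !expr1 !mulN1r.
Qed.

Definition sterm (a : monomial) (c : int) : series := fun m => if a == m then c else 0.

Lemma sterm1 : sterm mset0 1 = 1.
Proof.
apply/funext => m; rewrite /sterm -[RHS]/(series_one m) /series_one eq_sym.
by case: eqP.
Qed.

Lemma stermM a b c d : sterm a c * sterm b d = sterm (msetD a b) (c * d).
Proof.
apply/funext => m; rewrite -[LHS]/(series_mul _ _ m).
have [S uS hS] := submsets_ex m; rewrite (series_mulE _ _ uS); last by move=> x /hS.
transitivity (\sum_(x <- S) \sum_(y <- S)
    (if ((msetD x y == m) && (a == x)) && (b == y) then c * d else 0)).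
  apply: eq_bigr => x _; apply: eq_bigr => y _; rewrite /sterm.
  by case: (_ == m) => //=; case: (a == x); case: (b == y); rewrite /= ?mul0r ?mulr0.
transitivity (\sum_(x <- S) (if (msetD x b == m) && (a == x) then c * d else 0)).
  apply: eq_bigr => x _.
  apply: (@sum_pick S b m (fun y => (msetD x y == m) && (a == x))) => // /andP[/eqP e _].
  by apply/hS => r; rewrite -e msetE2 leq_addl.
rewrite (@sum_pick S a m (fun x => msetD x b == m))//.
by move=> /eqP e; apply/hS => r; rewrite -e msetE2 leq_addr.
Qed.

Lemma sterm_prod (I : Type) (r : seq I) (a : I -> monomial) (c : I -> int) :
  \prod_(i <- r) sterm (a i) (c i) = sterm (\big[msetD/mset0]_(i <- r) a i) (\prod_(i <- r) c i).
Proof.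
elim: r => [|i r IH]; first by rewrite !big_nil sterm1.
by rewrite !big_cons IH stermM.
Qed.

Lemma msetD_bigE (I : Type) (r : seq I) (a : I -> monomial) (x : int) :
  (\big[msetD/mset0]_(i <- r) a i) x = (\sum_(i <- r) a i x)%N.
Proof.
elim: r => [|i r IH]; first by rewrite !big_nil mset0E.
by rewrite !big_cons msetE2 IH.
Qed.

(** Equality on the divisors of [m0], a relation compatible with products, which allows truncation
    to finite sums. *)
Definition agree (m0 : monomial) (f g : series) :=
  forall m : monomial, (forall r, (m r <= m0 r)%N) -> f m = g m.

Lemma agreeM m0 f f' g g' : agree m0 f f' -> agree m0 g g' -> agree m0 (f * g) (f' * g').
Proof.
move=> hf hg m hm; rewrite -[LHS]/(series_mul _ _ m) -[RHS]/(series_mul _ _ m).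
have [S uS hS] := submsets_ex m; rewrite !(series_mulE _ _ uS); try by move=> x /hS.
apply: eq_big_seq => x /hS hx; apply: eq_big_seq => y /hS hy.
by rewrite hf ?hg// => r; apply: leq_trans (hm r).
Qed.

Section Families.
Variables (n : nat) (m : monomial).

Definition submsets : {fset monomial} :=
  fset_set [set a : monomial | forall r, (a r <= m r)%N]%classic.

Lemma submsetsP (a : monomial) : (a \in submsets) <-> (forall r, (a r <= m r)%N).
Proof. by rewrite in_fset_set; [rewrite inE | exact: finite_submset]. Qed.

Definition family := {ffun 'I_n -> submsets}.
Definition fam_ok (gd : pred monomial) (phi : family) : bool :=
  (\big[msetD/mset0]_(i < n) val (phi i) == m) && [forall i, gd (val (phi i))].

Lemma series_prodE (f : 'I_n -> series) : (\prod_i f i) m =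
  \sum_(phi : family | \big[msetD/mset0]_(i < n) val (phi i) == m) \prod_i f i (val (phi i)).
Proof.
pose tr (g : series) : series := \sum_(a : submsets) sterm (val a) (g (val a)).
have ag : agree m (\prod_i f i) (\prod_i tr (f i)).
  apply: (big_ind2 (agree m)) => [//|g1 g2 g3 g4|i _ a ha]; first exact: agreeM.
  rewrite /tr series_sumE; have ia : a \in submsets by apply/submsetsP.
  rewrite (bigD1 [` ia]%fset) //= /sterm eqxx big1 ?addr0// => b ba.
  by case: eqP => // e; case/eqP: ba; apply: val_inj.
rewrite ag// bigA_distr_bigA /= series_sumE [RHS]big_mkcond; apply: eq_bigr => phi _.
by rewrite sterm_prod /sterm.
Qed.

(** In the Leibniz expansion the product attached to [s] counts the good families of product [m]
    with charges [lam i - i + s i]; summing over [s] inside the sum over families gives [alt]. *)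
Lemma det_families (gd : pred monomial) (chg : monomial -> int) (lam : 'I_n -> int)
    (h : int -> series) :
  (forall k (a : monomial), (forall r, (a r <= m r)%N) -> h k a = (gd a && (chg a == k))%:R) ->
  (\det (\matrix_(i < n, j < n) h (lam i - i%:Z + j%:Z))) m =
  \sum_(phi : family | fam_ok gd phi) alt (fun i => chg (val (phi i)) - lam i + i%:Z).
Proof.
move=> hh; rewrite /determinant series_sumE exchange_big; apply: eq_bigr => s _.
rewrite series_signE -mulr_sumr; congr (_ * _).
under eq_bigr => i _ do rewrite mxE.
rewrite series_prodE /fam_ok [RHS]big_mkcondr; apply: eq_bigr => phi _.
rewrite (eq_bigr (fun i => (gd (val (phi i)) && (chg (val (phi i)) == lam i - i%:Z + (s i : nat)%:Z))%:R)); last first.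
  by move=> i _; rewrite hh//; apply/submsetsP; exact: valP.
rewrite prod_nat_bool; case: (boolP [forall i, gd _]) => [/forallP g|/forallPn[i ni]]; last first.
  by rewrite (_ : [forall i, _] = false) //; apply/forallPn; exists i; rewrite (negPf ni).
congr (_%:R); congr nat_of_bool; apply: eq_forallb => i; rewrite g /=.
by apply/eqP/eqP; lia.
Qed.

End Families.

(** * Dimensions, and configurations as families of monomials *)

Section HasDim.
Variables (F : fieldType) (M : smodule F) (W : set (carrier M)).
Hypothesis W0 : W 0.

(** Uniqueness of the coordinates of zero in the second basis makes the transition matrix row free,
    which bounds its number of rows. *)
Lemma has_dim_le d d' : has_dim W d -> has_dim W d' -> (d' <= d)%N.
Proof.
move=> [b [hb ub]] [b' [hb' ub']].
have /choice[a ha] : forall j, exists c : 'rV[F]_d, b' j = \sum_i c 0 i *: b i.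
  by move=> j; have [c [hc _]] := ub _ (hb' j); exists c.
pose A : 'M[F]_(d', d) := \matrix_j a j.
suff /eqP <- : row_free A by exact: rank_leq_col.
apply: inj_row_free => c cA.
have [c0 [_ hc0]] := ub' 0 W0.
have e (x : 'rV[F]_d') : 0 = \sum_j x 0 j *: b' j -> c0 = x by exact: hc0.
rewrite -(e c) ?(e 0)//; first by rewrite big1// => j _; rewrite mxE scale0r.
under eq_bigr => j _ do rewrite ha scaler_sumr.
rewrite exchange_big big1// => i _ /=.
under eq_bigr => j _ do rewrite scalerA.
rewrite -scaler_suml; have := congr1 (fun x : 'rV[F]_d => x 0 i) cA; rewrite !mxE => e0.
by rewrite (eq_bigr (fun j => c 0 j * A j i)) ?e0 ?scale0r// => j _; rewrite !mxE.
Qed.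

Lemma has_dim_xget d : has_dim W d -> xget 0%N [set d | has_dim W d]%classic = d.
Proof.
move=> hd; apply: xget_unique => // d' hd'; apply: anti_leq.
by rewrite !has_dim_le.
Qed.
End HasDim.

Definition msetf (W : nat) (f : int -> nat) : monomial :=
  seq_mset (flatten [seq nseq (f r) r | r <- win W]).

Lemma msetfE W f r : finw W f -> msetf W f r = f r.
Proof.
move=> hW; rewrite mset_seqE count_flatten -map_comp.
rewrite (eq_map (g := fun t => (f t * (t == r))%N)); last by move=> t /=; rewrite count_nseq mulnC.
rewrite sumnE big_map; have [rW|rW] := leqP `|r|%N W.
  rewrite (bigD1_seq r) ?mem_win ?win_uniq//= eqxx muln1 big1 ?addn0// => t /negPf ->.
  by rewrite muln0.
rewrite hW// big_seq big1// => t; rewrite mem_win; case: eqP => [->|_]; last by rewrite muln0.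
by rewrite leqNgt rW.
Qed.

Lemma finw_mset (m : monomial) : exists W, finw W m.
Proof.
exists (\sum_(r <- enum_mset m) `|r|)%N => r hr; apply/eqP; apply: contraTT hr.
rewrite -lt0n -in_mset -leqNgt => rm.
by rewrite (big_rem r) /= ?leq_addr// enum_msetE.
Qed.

Section FamilyConfigs.
Variables (n W : nat) (m : monomial).
Hypothesis hW : finw W m.

Definition gdm (a : monomial) : bool := all (fun r => oddz r || (a r <= 1)%N) (win W).
Definition chg (a : monomial) : int :=
  \sum_(r <- win W) (if 0 < r then (a r)%:Z else - (a r)%:Z).

Definition famB := {phi : family n m | fam_ok gdm phi}.
Definition cfg (b : famB) : config (mode n) := fun q => (val (val b q.1) : monomial) q.2.

Lemma fam_sum (b : famB) r : (\sum_(i < n) val (val b i) r)%N = m r.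
Proof. by rewrite -msetD_bigE; have /andP[/eqP -> _] := valP b. Qed.

Lemma cfg_inj : injective cfg.
Proof.
move=> b b' e; apply: val_inj; apply/ffunP => i; apply: val_inj; apply/msetP => r.
exact: (congr1 (fun k => k (i, r)) e).
Qed.

Lemma cfg_config_set k : config_set m k <-> exists b, cfg b = k.
Proof.
split=> [[ck gk]|[b <-]]; last first.
  split=> [r|i r er]; first by rewrite /content /cfg /= fam_sum.
  rewrite /cfg /=; have /andP[_ /forallP/(_ i)/allP h] := valP b.
  have [rW|rW] := leqP `|r|%N W.
    by have := h r; rewrite mem_win rW (negPf er) => /(_ isT).
  have := hW rW; rewrite -(fam_sum b) (bigD1 i) //= => /eqP; rewrite addn_eq0 => /andP[/eqP -> _] //.
have le i r : (k (i, r) <= m r)%N by rewrite -ck /content (bigD1 i) //= leq_addr.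
have fk i : finw W (fun r => k (i, r)).
  by move=> r rW; apply/eqP; rewrite -leqn0 -(hW rW).
pose a i := msetf W (fun r => k (i, r)).
have aE i r : a i r = k (i, r) by rewrite msetfE.
have ha i : a i \in submsets m by apply/submsetsP => r; rewrite aE.
pose phi : family n m := [ffun i => [` ha i]%fset].
have ok : fam_ok gdm phi.
  apply/andP; split.
    apply/eqP/msetP => r; rewrite msetD_bigE -ck /content; apply: eq_bigr => i _.
    by rewrite ffunE /= aE.
  apply/forallP => i; apply/allP => r _; rewrite ffunE /= aE.
  by case: (boolP (oddz r)) => //= /(gk i).
exists (exist _ phi ok); apply/funext => -[i r].
by rewrite /cfg /= ffunE /= aE.
Qed.

End FamilyConfigs.

Lemma big_famB n W m (G : family n m -> int) :
  \sum_(b : famB n W m) G (val b) = \sum_(phi | fam_ok (gdm W) phi) G phi.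
Proof.
(* [insubd] needs a default element, so the case of no admissible family is treated apart. *)
have [b0|nb] := pselect (exists b : famB n W m, True); last first.
  rewrite [RHS]big_pred0 => [|phi].
    by rewrite big1// => b _; case: nb; exists b.
  by apply/negP => h; apply: nb; exists (exist _ phi h).
case: b0 => b0 _; rewrite [RHS](reindex_onto (val : famB n W m -> _) (insubd b0)) /=.
  by apply: eq_bigl => b; rewrite (valP b) valKd eqxx.
by move=> phi h; exact: (@insubdK _ _ _ b0 phi h).
Qed.

Lemma finw_hwcoef n (lam : 'I_n -> int) : exists R : nat, forall r : int, (R < `|r|)%N -> hwcoef lam r = 0.
Proof.
pose S := (\sum_i `|lam i|)%N.
have rl j : `|row_len lam j| <= S%:Z.
  rewrite /row_len; apply: le_trans (ler_norm_sum _ _ _) _.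
  rewrite /S (big_morph Posz PoszD (erefl _)) big_mkcond; apply: ler_sum => i _.
  by case: ifP => _; rewrite ?abszE// normr_ge0.
have cl j : 0 <= col_len lam j <= n%:Z.
  by rewrite /col_len lez_nat /= (leq_trans (max_card _))// card_ord.
exists (2 * (n + S) + 4)%N => r hr; rewrite /hwcoef.
have k1 := cl (r %/ 2)%Z; have k2 := cl ((r %/ 2)%Z - 1).
have k3 := rl ((r + 1) %/ 2)%Z; have k4 := rl (n%:Z + ((r + 1) %/ 2)%Z).
move: k1 k2 k3 k4; move: (col_len _ _) (col_len _ _) (row_len _ _) (row_len _ _) => c1 c2 r1 r2.
have d0 := divz_eq r 2; have d1 := divz_eq (r + 1) 2; have d2 := divz_eq (r - 1) 2.
have m0 : 0 <= (r %% 2)%Z < 2 by rewrite modz_ge0// ltz_pmod.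
have m1 : 0 <= ((r + 1) %% 2)%Z < 2 by rewrite modz_ge0// ltz_pmod.
have m2 : 0 <= ((r - 1) %% 2)%Z < 2 by rewrite modz_ge0// ltz_pmod.
move: d0 d1 d2 m0 m1 m2; move: (r %/ 2)%Z (r %% 2)%Z ((r + 1) %/ 2)%Z ((r + 1) %% 2)%Z ((r - 1) %/ 2)%Z ((r - 1) %% 2)%Z.
move=> q0 s0 q1 s1 q2 s2 d0 d1 d2 m0 m1 m2 k1 k2 k3 k4.
case: ifP => _; case: (ltP 0) => h0; rewrite ?(@max_r _ int) ?oppr0//; lia.
Qed.

(** * Passage of weight spaces from Fock space to the module *)

Section Transfer.
Variables (C : numClosedFieldType) (n : nat) (lam : 'I_n -> int) (L : smodule C).
Hypothesis hlam : genpart lam.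
Local Notation H := (fock C (mode n)).
Local Notation e := (fun r s => @elem C L r s).
Local Notation f := (fun r s => @fE C n r s).
Variables (v : carrier L) (w : H) (mw : int -> nat) (Ww : nat).
Local Notation G := (gen (fun r s => pair_act e f r s) (v, w)).
Hypothesis gen_v : forall x, gen e v x.
Hypothesis graph_fun : forall y, G (0, y) -> y = 0.
Hypothesis graph_inj : forall x, G (x, 0) -> x = 0.
Hypothesis wvec_w : wvec mw w.
Hypothesis fin_w : finw Ww mw.
Hypothesis supp_w : fin_supp w.
Hypothesis gen_w_kapf : gen f w (kapf C lam).
Hypothesis hwm_w : hwm lam w.
Implicit Types (x : carrier L) (y : H).

Lemma graph_lin a x x' y y' : G (x, y) -> G (x', y') -> G (a *: x + x', a *: y + y').
Proof. by move=> h h'; exact: (gen_lin a h h'). Qed.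

Lemma graph_act r s x y : G (x, y) -> G (elem r s x, fE r s y).
Proof. by move=> h; exact: (gen_act r s h). Qed.

Lemma graph00 : G (0, 0).
Proof. exact: (gen0 (fun r s => pair_act e f r s) (v, w)). Qed.

Lemma graph_sum (I : Type) (l : seq I) (a : I -> C) (x : I -> carrier L) (y : I -> H) :
  (forall i, G (x i, y i)) -> G (\sum_(i <- l) a i *: x i, \sum_(i <- l) a i *: y i).
Proof.
move=> h; elim: l => [|i l IH]; first by rewrite !big_nil; exact: graph00.
by rewrite !big_cons; exact: graph_lin.
Qed.

Lemma graph_eq x x' y : G (x, y) -> G (x', y) -> x = x'.
Proof.
move=> h h'; apply/eqP; rewrite -subr_eq0 addrC -scaleN1r; apply/eqP/graph_inj.
have -> : 0 = -1 *: y + y by rewrite scaleN1r addNr.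
exact: graph_lin.
Qed.

Lemma graph_eq2 x y y' : G (x, y) -> G (x, y') -> y = y'.
Proof.
move=> h h'; apply/eqP; rewrite -subr_eq0 addrC -scaleN1r; apply/eqP/graph_fun.
have -> : 0 = -1 *: x + x by rewrite scaleN1r addNr.
exact: graph_lin.
Qed.

Lemma graph_left x : exists y, G (x, y).
Proof. exact: gen_pair (gen_v x). Qed.

Lemma graph_right y : gen f w y -> exists x, G (x, y).
Proof. by move=> /(gen_pair e v)[x /gen_swap h]; exists x. Qed.

Definition weighty y := gen f w y /\ exists m W, finw W m /\ wvec m y.

Lemma weighty_act r s y : weighty y -> weighty (fE r s y).
Proof.
move=> [gy [m [W [hW hy]]]]; split; first exact: gen_act.
have [<-|rs] := eqVneq r s.
  by exists m, W; split=> //; rewrite (wvec_weight r hy); exact: wvecZ.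
exists (m_act r s m), (W + `|r| + `|s|)%N; split; last exact: fE_wvec.
move=> t ht; have nr : (t == r) = false by apply/eqP => et; move: ht; rewrite et; lia.
have ns : (t == s) = false by apply/eqP => et; move: ht; rewrite et; lia.
have mt : m t = 0%N by apply: hW; lia.
by rewrite /m_act /m_st /m_de; case: ifP => _; case: ifP => _; rewrite /mi /md nr ns mt.
Qed.

Lemma weight_decomposition y : gen f w y ->
  exists l : seq H, y = \sum_(z <- l) z /\ forall z, z \in l -> weighty z.
Proof.
elim=> {y} [|a y y' _ [l [-> hl]] _ [l' [-> hl']]|r s y _ [l [-> hl]]].
- exists [:: w]; split=> [|z]; first by rewrite big_seq1.
  by rewrite inE => /eqP ->; split; [exact: gen_base | exists mw, Ww].
- exists ([seq a *: z | z <- l] ++ l'); split; first by rewrite big_cat big_map scaler_sumr.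
  move=> z; rewrite mem_cat => /orP[/mapP[u /hl[gu [m [W [hW hu]]]] ->]|/hl'//].
  by split; [exact: genZ | exists m, W; split=> //; exact: wvecZ].
- exists [seq fE r s z | z <- l]; split; first by rewrite big_map linear_sum.
  by move=> z /mapP[u /hl hu ->]; exact: weighty_act.
Qed.

Lemma sum_funE (l : seq H) (F : H -> H) k : (\sum_(z <- l) F z) k = \sum_(z <- l) F z k.
Proof. by apply: (big_morph (fun g : H => g k)). Qed.

Lemma gen_weight (m : int -> nat) y : gen f w y ->
  (forall r, fE r r y = (sg C r * (m r)%:R) *: y) -> wvec m y.
Proof.
move=> /weight_decomposition[l [ey hl]] hy k yk.
have gk : good k.
  apply: contrapT => ngk; case/eqP: yk; rewrite ey sum_funE big_seq big1// => z /hl[_ [m' [W [_ hz]]]].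
  by have [//|/hz[]] := eqVneq (z k) 0.
split=> // r; have := congr1 (fun g : H => g k) (hy r); rewrite scalefE.
have -> : fE r r y k = (sg C r * (content k r)%:R) * y k.
  rewrite {1}ey linear_sum sum_funE ey sum_funE mulr_sumr /=; apply: eq_big_seq => z /hl[_ [m' [W [_ hz]]]].
  rewrite (wvec_weight r hz) scalefE; have [->|/hz[<- _]//] := eqVneq (z k) 0.
  by rewrite !mulr0.
have s0 : sg C r != 0 by rewrite /sg; case: ifP => _; rewrite ?oner_eq0// oppr_eq0 oner_eq0.
by move/(mulIf yk)/(mulfI s0)/eqP; rewrite eqr_nat => /eqP.
Qed.

Lemma graph_weight (m : monomial) x y : G (x, y) -> @weight_space C L m x <-> wvec m y.
Proof.
move=> hG; have cE r : (if 0 < r then (m r)%:R else - (m r)%:R) = sg C r * (m r)%:R :> C.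
  by rewrite /sg; case: ifP => _; rewrite ?mul1r ?mulN1r.
have act1 r : elem r r x = act (Ekk C r) x by exact: elemE.
split=> [hx|hy].
  apply: gen_weight (gen_snd hG) _ => r; have := hx r; rewrite cE -act1 => ex.
  apply: (graph_eq2 (graph_act r r hG)); rewrite ex.
  have := graph_lin (sg C r * (m r)%:R) hG graph00; by rewrite !addr0.
move=> r; rewrite cE -act1; apply: (graph_eq (graph_act r r hG)).
rewrite (wvec_weight r hy).
have := graph_lin (sg C r * (m r)%:R) hG graph00; by rewrite !addr0.
Qed.

Lemma gen_hwm y : gen f w y -> hwm lam y.
Proof.
elim=> {y} [//|a y y' _ hy _ hy'|r s y _ hy]; first exact: hwmP.
exact: hwm_fE.
Qed.

(** The graph matches the weight space with the gl_n-singular vectors of content [m]: it lands among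
    them by [gen_hwm] and reaches them all by [hwm_gen]. *)
Lemma weight_space_dim W (m : monomial) : finw W m -> exists d,
  has_dim (@weight_space C L m) d /\
  d%:Z = \sum_(phi : family n m | fam_ok (gdm W) phi)
    alt (fun i => chg W (val (phi i)) - lam i + i%:Z).
Proof.
move=> hW; pose K := @cfg n W m.
have [V [dV hV]] := hwm_dim C hW (@cfg_inj n W m) (cfg_config_set hW) hlam.
exists (\dim V); split; last by rewrite dV; exact: big_famB.
have hb (i : 'I_(\dim V)) : exists x, G (x, ext_cfg K (vbasis V)`_i).
  apply: graph_right; apply: (hwm_gen wvec_w supp_w gen_w_kapf hwm_w hW).
  - exact: (wvec_ext_cfg (cfg_config_set hW)).
  - apply: (fin_supp_wvec hW); exact: (wvec_ext_cfg (cfg_config_set hW)).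
  - by apply/hV; rewrite vbasis_mem// mem_nth ?size_tuple.
have /choice[b hGb] := hb.
have comb (c : 'rV[C]_(\dim V)) : G (\sum_i c 0 i *: b i, ext_cfg K (\sum_i c 0 i *: (vbasis V)`_i)).
  rewrite linear_sum /=; under [X in G (_, X)]eq_bigr => i _ do rewrite linearZ.
  exact: (graph_sum _ (fun i => c 0 i)).
exists b; split=> [i|x hx].
  by apply/(graph_weight _ (hGb i)); exact: (wvec_ext_cfg (cfg_config_set hW)).
have [y hG] := graph_left x.
have hy : wvec m y by apply/(graph_weight _ hG).
pose u := res_cfg K y.
have eu : ext_cfg K u = y by exact: (ext_resK (@cfg_inj n W m) (cfg_config_set hW)).
have uV : u \in V by apply/hV; rewrite -/K eu; exact: gen_hwm (gen_snd hG).
exists (\row_i coord (vbasis V) i u); split.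
  apply: (graph_eq hG); have eu2 : u = \sum_i (\row_i coord (vbasis V) i u) 0 i *: (vbasis V)`_i.
    by rewrite {1}(coord_vbasis uV); apply: eq_bigr => i _; rewrite mxE.
  by have := comb (\row_i coord (vbasis V) i u); rewrite -eu2 eu.
move=> c ex; apply/rowP => i; rewrite mxE.
have : ext_cfg K u = ext_cfg K (\sum_i c 0 i *: (vbasis V)`_i).
  by rewrite eu; apply: graph_eq2 hG _; rewrite ex.
move/(ext_inj (@cfg_inj n W m)) => ->.
by rewrite coord_sum_free// (basis_free (vbasisP V)).
Qed.

Lemma weight_space0 (m : monomial) : @weight_space C L m 0.
Proof. by move=> r; rewrite scaler0 -(elemE r r 0) linear0. Qed.

Lemma transfer_has_ch : has_ch L.
Proof.
split=> [m|x].
  by have [W hW] := finw_mset m; have [d [hd _]] := weight_space_dim hW; exists d.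
have [y hG] := graph_left x.
have [l [ey hl]] := weight_decomposition (gen_snd hG).
suff [s [hs hsum]] : exists s : seq (carrier L),
    (forall z, z \in s -> exists m, @weight_space C L m z) /\ G (\sum_(z <- s) z, \sum_(z <- l) z).
  exists s; split=> //; by apply: graph_eq hG _; move: ey => /= ->.
elim: l {ey} hl => [|z l IH] hl.
  by exists [::]; split=> //; rewrite !big_nil; exact: graph00.
have [|s [hs hsum]] := IH; first by move=> u ul; apply: hl; rewrite inE ul orbT.
have [gz [m [W [hW hz]]]] := hl z (mem_head _ _).
have [x' hx'] := graph_right gz; exists (x' :: s); split.
  move=> u; rewrite inE => /orP[/eqP ->|/hs//]; exists (msetf W m).
  by apply/(graph_weight _ hx'); apply: wvec_extm hz => r; rewrite msetfE.
by rewrite !big_cons; have := graph_lin 1 hx' hsum; rewrite !scale1r.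
Qed.

Lemma transfer_ch W (m : monomial) : finw W m -> ch L m =
  \sum_(phi : family n m | fam_ok (gdm W) phi) alt (fun i => chg W (val (phi i)) - lam i + i%:Z).
Proof.
move=> hW; have [d [hd <-]] := weight_space_dim hW.
by rewrite /ch (has_dim_xget (weight_space0 m) hd).
Qed.

End Transfer.

(** * Characters of the irreducible modules *)

Theorem irr_hw_ch (C : numClosedFieldType) (n : nat) (lam : 'I_n -> int) (L : smodule C) :
  genpart lam -> irr_hw_module L (Lambda lam) ->
  has_ch L /\ forall W (m : monomial), finw W m -> ch L m =
    \sum_(phi : family n m | fam_ok (gdm W) phi) alt (fun i => chg W (val (phi i)) - lam i + i%:Z).
Proof.
move=> hlam [irr [v [hv genv]]].
have [w [mw [wvec_w supp_w w0 gw [raise_w cw]]]] := highest_vector C hlam.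
have [R0 hR] := finw_hwcoef lam.
have [p0 hp0] : exists p, vhom p v by case: hv.
have hwm_w : hwm lam w.
  elim: gw {wvec_w supp_w w0 raise_w} => {w} [|a y y' _ hy _ hy'|r s y _ hy].
  - exact: hwm_kapf.
  - exact: hwmP.
  - exact: hwm_fE.
have fin_w : finw R0 mw.
  by move=> r /hR; rewrite cw; case: ifP => _ /eqP; rewrite ?oppr_eq0 => /eqP [].
(* [w] was obtained from [kapf]; the way back is what lets [hwm_gen] exhaust the singular vectors
   from [w]. *)
have gwk := reach_kapf fin_w wvec_w supp_w w0 hwm_w.
have simp_v := elem_simple hR irr hv genv hp0.
have simp_w := fock_simple wvec_w supp_w w0 raise_w.
have eig_v := elem_weight hv.
have eig_w : eigen (fun r s => @fE C n r s) (fun r => (hwcoef lam r)%:~R) w.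
  move=> r /=; rewrite (wvec_weight r wvec_w) cw /sg; case: ifP => _; first by rewrite mul1r -pmulrn.
  by rewrite mulN1r intrN -pmulrn.
have gf := gen_all hR irr hv genv hp0.
(* Simplicity on each side makes the graph that of a bijection. *)
have gi x := graph_ker (x := x) (elem_rel hv genv) (@fE_rel C n) (fun r s => elem_raise hv (r:=r) (s:=s)) raise_w
  eig_v eig_w (hv_neq0 hv) w0 simp_v.
have gf2 y := graph_ker (x := y) (@fE_rel C n) (elem_rel hv genv) raise_w (fun r s => elem_raise hv (r:=r) (s:=s))
  eig_w eig_v w0 (hv_neq0 hv) simp_w.
have gfun y : gen (fun r s => pair_act (fun r s => @elem C L r s) (fun r s => @fE C n r s) r s) (v, w) (0, y) -> y = 0.
  by move=> /gen_swap/gf2.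
split=> [|W m hW].
  exact: (transfer_has_ch hlam gf gfun gi wvec_w fin_w supp_w gwk hwm_w).
exact: (transfer_ch hlam gf gfun gi wvec_w fin_w supp_w gwk hwm_w).
Qed.

Lemma alt1 (a : 'I_1 -> int) : alt a = (a ord0 == 0)%:R.
Proof. by rewrite alt_det det_mx11 mxE. Qed.

(** The only family of one monomial with product [a] is [a] itself, so at level one every
    coefficient is 0 or 1. *)
Lemma families1 (W : nat) (k : int) (a : monomial) :
  \sum_(phi : family 1 a | fam_ok (gdm W) phi) alt (fun i => chg W (val (phi i)) - k + i%:Z) =
  (gdm W a && (chg W a == k))%:R.
Proof.
have ia : a \in submsets a by apply/submsetsP.
have okE (phi : family 1 a) : fam_ok (gdm W) phi = (phi == [ffun=> [` ia]%fset]) && gdm W a.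
  rewrite /fam_ok big_ord_recl big_ord0 msetD0; apply/andP/andP => [[/eqP e /forallP/(_ ord0) g]|[/eqP -> g]].
    split; last by have := congr1 (gdm W) e; rewrite g => <-.
    by apply/eqP/ffunP => i; apply: val_inj; rewrite ffunE /= (ord1 i).
  by rewrite ffunE /= eqxx; split=> //; apply/forallP => i; rewrite ffunE.
rewrite (eq_bigl _ _ okE); case: (gdm W a); last by rewrite big_pred0 // => phi; rewrite andbF.
rewrite (big_pred1 [ffun=> [` ia]%fset]) => [|phi]; last by rewrite andbT.
by rewrite alt1 ffunE /= addr0 subr_eq0.
Qed.

Theorem corollary5p4 (R : realType) (n : nat) (lam : 'I_n -> int)
    (hlam : genpart lam)
    (L : smodule R[i]) (hL : irr_hw_module L (Lambda lam))
    (L1 : int -> smodule R[i])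
    (hL1 : forall k : int, irr_hw_module (L1 k) (Lambda (fun _ : 'I_1 => k))) :
  [/\ has_ch L,
      forall k : int, has_ch (L1 k)
    & ch L = \det (\matrix_(i < n, j < n) ch (L1 (lam i - i%:Z + j%:Z)))].
Proof.
have [hch chE] := irr_hw_ch hlam hL.
have h1 k := irr_hw_ch (fun _ _ _ => lexx k) (hL1 k).
split=> // [k|]; first by have [] := h1 k.
apply/funext => m; have [W hW] := finw_mset m; rewrite (chE W m hW).
rewrite (@det_families n m (gdm W) (chg W) lam (fun k => ch (L1 k)))// => k a am.
(* The window of [m] serves for all its divisors, so a single [gdm] and a single charge are used
   throughout the determinant. *)
have hWa : finw W a by move=> r /hW mr; have := am r; rewrite mr leqn0 => /eqP.
by have [_ h] := h1 k; rewrite (h W a hWa) families1.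
Qed.
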